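(* $\mathsf{RCA}_0^{\ast}$ proves the following. For each $c\in\mathbb{N}$, $\mathrm{DL}_c$ and $\mathrm{RPH}_c$ are equivalent; hence $\mathrm{WO}(\omega^c)$ and $\mathrm{RPH}_c$ are equivalent. In particular, $\mathrm{DL}$, $\mathrm{WO}(\omega^\omega)$ and $\forall c\,\mathrm{RPH}_c$ are pairwise equivalent.
   Context: $\mathsf{RCA}_0^{\ast}$ is the subsystem of second order arithmetic, in the usual language augmented by a binary function symbol $\exp$ (written $m^n$), whose axioms are: the basic axioms of second order arithmetic (the usual quantifier-free axioms for $0,1,+,\cdot,<$); the exponentiation axioms $m^0=1$, $m^{n+1}=m\cdot m^n$; the induction scheme for all $\Sigma^0_0$ formulas (possibly containing $\exp$); and the comprehension scheme for all $\Delta^0_1$ formulas (possibly containing $\exp$). $\mathbb{N}$ is the set of nonnegative integers, and $c\in\mathbb{N}$ is identified with $\{0,\dots,c-1\}$. For $\overline{m},\overline{n}\in\mathbb{N}^c$, $\overline{m}\le\overline{n}$ means $m_k\le n_k$ for all $k<c$. $\mathrm{DL}_c$ (Dickson's lemma for $c$-tuples): for every infinite sequence $\overline{m}_0,\overline{m}_1,\ldots\in\mathbb{N}^c$ there exist $i<j$ with $\overline{m}_i\le\overline{m}_j$. $\mathrm{DL}$ is $\forall c\,\mathrm{DL}_c$. For $a,R\in\mathbb{N}$, $[a,R]=\{n\in\mathbb{N}:a\le n\le R\}$ and $[a,R]^2=\{(n,m)\in\mathbb{N}^2:a\le n<m\le R\}$. For a coloring $C\colon[a,R]^2\to c$, a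 set $H=\{h_0<h_1<\cdots\}\subseteq[a,R]$ is $C$-weakly homogeneous if $C(h_i,h_{i+1})=C(h_{i+1},h_{i+2})$ for all $h_i,h_{i+1},h_{i+2}\in H$. For $f\colon\mathbb{N}\to\mathbb{N}$, $\mathrm{WPH}^f_c$ is the statement: for every $a$ there exists $R$ such that for every coloring $C\colon[a,R]^2\to c$ there is a (nonempty) $C$-weakly homogeneous set $H\subseteq[a,R]$ with $|H|>f(\min H)$. $\mathrm{RPH}_c$ is the statement that $\mathrm{WPH}^f_c$ holds for every $f\colon\mathbb{N}\to\mathbb{N}$. $\mathrm{WO}(\omega^c)$ and $\mathrm{WO}(\omega^\omega)$ state that (the standard Cantor normal form notation systems for) the ordinals $\omega^c$ and $\omega^\omega$ are well-ordered, i.e. have no infinite descending sequence. *)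

(* Defs.v *)
(* Plain Stdlib: lists and natural numbers only. *)
From Stdlib Require Import List.
Import ListNotations.

Set Implicit Arguments.
Unset Strict Implicit.
Unset Printing Implicit Defensive.

(** * The language of second order arithmetic with exponentiation

    Two-sorted syntax with de Bruijn indices.  Number variables and set
    variables are indexed separately: a number quantifier shifts only the
    number variables and a set quantifier only the set variables.  As usual,
    equality is primitive for numbers only. *)

Inductive term : Type :=
| tVar (i : nat)
| tZero
| tOne
| tAdd (t u : term)
| tMul (t u : term)
| tExp (t u : term).

Inductive form : Type :=
| fEq (t u : term)
| fLt (t u : term)
| fMem (t : term) (X : nat)
| fBot
| fImp (p q : form)
| fAnd (p q : form)
| fOr (p q : form)
| fAllN (p : form)
| fExN (p : form)
| fAllS (p : form)
| fExS (p : form).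

Definition fNot (p : form) : form := fImp p fBot.
Definition fIff (p q : form) : form := fAnd (fImp p q) (fImp q p).

Fixpoint substT (sigma : nat -> term) (t : term) : term :=
  match t with
  | tVar i => sigma i
  | tZero => tZero
  | tOne => tOne
  | tAdd t u => tAdd (substT sigma t) (substT sigma u)
  | tMul t u => tMul (substT sigma t) (substT sigma u)
  | tExp t u => tExp (substT sigma t) (substT sigma u)
  end.

Definition shiftN (i : nat) : term := tVar (S i).

Definition scons {A : Type} (a : A) (f : nat -> A) (i : nat) : A :=
  match i with O => a | S j => f j end.

Definition upN (sigma : nat -> term) : nat -> term :=
  scons (tVar 0) (fun i => substT shiftN (sigma i)).

Definition upS (rho : nat -> nat) : nat -> nat :=
  scons 0 (fun i => S (rho i)).

(** Terms are substituted for number variables and, the set sort having no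
    terms other than variables, variables for set variables. *)
Fixpoint subst (sigma : nat -> term) (rho : nat -> nat) (p : form) : form :=
  match p with
  | fEq t u => fEq (substT sigma t) (substT sigma u)
  | fLt t u => fLt (substT sigma t) (substT sigma u)
  | fMem t X => fMem (substT sigma t) (rho X)
  | fBot => fBot
  | fImp p q => fImp (subst sigma rho p) (subst sigma rho q)
  | fAnd p q => fAnd (subst sigma rho p) (subst sigma rho q)
  | fOr p q => fOr (subst sigma rho p) (subst sigma rho q)
  | fAllN p => fAllN (subst (upN sigma) rho p)
  | fExN p => fExN (subst (upN sigma) rho p)
  | fAllS p => fAllS (subst sigma (upS rho) p)
  | fExS p => fExS (subst sigma (upS rho) p)
  end.

Definition liftN (p : form) : form := subst shiftN (fun X => X) p.
Definition liftS (p : form) : form := subst tVar S p.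
Definition instN (t : term) (p : form) : form :=
  subst (scons t tVar) (fun X => X) p.
Definition instS (X : nat) (p : form) : form :=
  subst tVar (scons X (fun Y => Y)) p.

(** * Derivability: classical two-sorted natural deduction with equality *)

(** An open axiom stands for its universal closure: [pr_ax] is available in
    every context, so that its variables can always be generalized. *)
Inductive prf (Ax : form -> Prop) : list form -> form -> Prop :=
| pr_ax G p : Ax p -> prf Ax G p
| pr_hyp G p : In p G -> prf Ax G p
| pr_raa G p : prf Ax (fNot p :: G) fBot -> prf Ax G p
| pr_impI G p q : prf Ax (p :: G) q -> prf Ax G (fImp p q)
| pr_impE G p q : prf Ax G (fImp p q) -> prf Ax G p -> prf Ax G q
| pr_andI G p q : prf Ax G p -> prf Ax G q -> prf Ax G (fAnd p q)
| pr_andE1 G p q : prf Ax G (fAnd p q) -> prf Ax G p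
| pr_andE2 G p q : prf Ax G (fAnd p q) -> prf Ax G q
| pr_orI1 G p q : prf Ax G p -> prf Ax G (fOr p q)
| pr_orI2 G p q : prf Ax G q -> prf Ax G (fOr p q)
| pr_orE G p q r :
    prf Ax G (fOr p q) -> prf Ax (p :: G) r -> prf Ax (q :: G) r -> prf Ax G r
| pr_allNI G p : prf Ax (map liftN G) p -> prf Ax G (fAllN p)
| pr_allNE G p t : prf Ax G (fAllN p) -> prf Ax G (instN t p)
| pr_exNI G p t : prf Ax G (instN t p) -> prf Ax G (fExN p)
| pr_exNE G p q :
    prf Ax G (fExN p) -> prf Ax (p :: map liftN G) (liftN q) -> prf Ax G q
| pr_allSI G p : prf Ax (map liftS G) p -> prf Ax G (fAllS p)
| pr_allSE G p X : prf Ax G (fAllS p) -> prf Ax G (instS X p)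
| pr_exSI G p X : prf Ax G (instS X p) -> prf Ax G (fExS p)
| pr_exSE G p q :
    prf Ax G (fExS p) -> prf Ax (p :: map liftS G) (liftS q) -> prf Ax G q
| pr_eqI G t : prf Ax G (fEq t t)
| pr_eqE G p t u :
    prf Ax G (fEq t u) -> prf Ax G (instN t p) -> prf Ax G (instN u p).

(** * The axioms of RCA_0^* *)

(** The bound of a bounded quantifier may not contain the bound variable,
    hence the shift.  Set variables may occur as parameters. *)
Inductive Sigma00 : form -> Prop :=
| S00_eq t u : Sigma00 (fEq t u)
| S00_lt t u : Sigma00 (fLt t u)
| S00_mem t X : Sigma00 (fMem t X)
| S00_bot : Sigma00 fBot
| S00_imp p q : Sigma00 p -> Sigma00 q -> Sigma00 (fImp p q)
| S00_and p q : Sigma00 p -> Sigma00 q -> Sigma00 (fAnd p q)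
| S00_or p q : Sigma00 p -> Sigma00 q -> Sigma00 (fOr p q)
| S00_all t p :
    Sigma00 p -> Sigma00 (fAllN (fImp (fLt (tVar 0) (substT shiftN t)) p))
| S00_ex t p :
    Sigma00 p -> Sigma00 (fExN (fAnd (fLt (tVar 0) (substT shiftN t)) p)).

Inductive Sigma01 : form -> Prop :=
| S01_ex p : Sigma00 p -> Sigma01 (fExN p).

Inductive Pi01 : form -> Prop :=
| P01_all p : Sigma00 p -> Pi01 (fAllN p).

(** In the induction and comprehension schemes the distinguished variable is
    number variable 0; all other variables are parameters. *)
Definition induction_ax (p : form) : form :=
  let succ_p :=
    subst (scons (tAdd (tVar 0) tOne) shiftN) (fun X => X) p in
  fImp (fAnd (instN tZero p) (fAllN (fImp p succ_p))) (fAllN p).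

Definition comprehension_ax (p q : form) : form :=
  fImp (fAllN (fIff p q))
       (fExS (fAllN (fIff (fMem (tVar 0) 0) (liftS p)))).

Inductive RCA0star : form -> Prop :=
| ax_succ_ne0 : RCA0star (fNot (fEq (tAdd (tVar 0) tOne) tZero))
| ax_succ_inj :
    RCA0star (fImp (fEq (tAdd (tVar 0) tOne) (tAdd (tVar 1) tOne))
                   (fEq (tVar 0) (tVar 1)))
| ax_add0 : RCA0star (fEq (tAdd (tVar 0) tZero) (tVar 0))
| ax_addS :
    RCA0star (fEq (tAdd (tVar 0) (tAdd (tVar 1) tOne))
                  (tAdd (tAdd (tVar 0) (tVar 1)) tOne))
| ax_mul0 : RCA0star (fEq (tMul (tVar 0) tZero) tZero)
| ax_mulS :
    RCA0star (fEq (tMul (tVar 0) (tAdd (tVar 1) tOne))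
                  (tAdd (tMul (tVar 0) (tVar 1)) (tVar 0)))
| ax_lt0 : RCA0star (fNot (fLt (tVar 0) tZero))
| ax_ltS :
    RCA0star (fIff (fLt (tVar 0) (tAdd (tVar 1) tOne))
                   (fOr (fLt (tVar 0) (tVar 1)) (fEq (tVar 0) (tVar 1))))
| ax_exp0 : RCA0star (fEq (tExp (tVar 0) tZero) tOne)
| ax_expS :
    RCA0star (fEq (tExp (tVar 0) (tAdd (tVar 1) tOne))
                  (tMul (tVar 0) (tExp (tVar 0) (tVar 1))))
| ax_induction p : Sigma00 p -> RCA0star (induction_ax p)
| ax_comprehension p q :
    Sigma01 p -> Pi01 q -> RCA0star (comprehension_ax p q).

(** * Writing formulas with named binders

    An expression is a function of the numbers [n] and [s] of number and set
    quantifiers in whose scope it occurs.  A quantifier introduced below [n]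
    others binds the variable with de Bruijn level [n], i.e. with index
    [n' - S n] at any later depth [n' > n].  A closed expression denotes its
    value at depth 0. *)

Definition nexp : Type := nat -> term.
Definition sexp : Type := nat -> nat.
Definition fexp : Type := nat -> nat -> form.

Declare Scope so_scope.
Delimit Scope so_scope with SO.
Bind Scope so_scope with nexp sexp fexp.

Definition nZero : nexp := fun _ => tZero.
Definition nOne : nexp := fun _ => tOne.
Definition nAdd (x y : nexp) : nexp := fun n => tAdd (x n) (y n).
Definition nMul (x y : nexp) : nexp := fun n => tMul (x n) (y n).
Definition nExp (x y : nexp) : nexp := fun n => tExp (x n) (y n).

Definition eEq (x y : nexp) : fexp := fun n _ => fEq (x n) (y n).
Definition eLt (x y : nexp) : fexp := fun n _ => fLt (x n) (y n).
Definition eMem (x : nexp) (X : sexp) : fexp := fun n s => fMem (x n) (X s).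
Definition eNot (P : fexp) : fexp := fun n s => fNot (P n s).
Definition eImp (P Q : fexp) : fexp := fun n s => fImp (P n s) (Q n s).
Definition eAnd (P Q : fexp) : fexp := fun n s => fAnd (P n s) (Q n s).
Definition eOr (P Q : fexp) : fexp := fun n s => fOr (P n s) (Q n s).
Definition eIff (P Q : fexp) : fexp := fun n s => fIff (P n s) (Q n s).

Definition eAllN (P : nexp -> fexp) : fexp :=
  fun n s => fAllN (P (fun n' => tVar (n' - S n)) (S n) s).
Definition eExN (P : nexp -> fexp) : fexp :=
  fun n s => fExN (P (fun n' => tVar (n' - S n)) (S n) s).
Definition eAllS (P : sexp -> fexp) : fexp :=
  fun n s => fAllS (P (fun s' => s' - S s) n (S s)).
Definition eExS (P : sexp -> fexp) : fexp :=
  fun n s => fExS (P (fun s' => s' - S s) n (S s)).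

Definition proves (Ax : form -> Prop) (P : fexp) : Prop :=
  prf Ax [] (P 0 0).

Notation "0" := nZero : so_scope.
Notation "1" := nOne : so_scope.
Notation "2" := (nAdd nOne nOne) : so_scope.
Notation "x + y" := (nAdd x y) : so_scope.
Notation "x * y" := (nMul x y) : so_scope.
Notation "x ^ y" := (nExp x y) : so_scope.
Notation "x = y" := (eEq x y) : so_scope.
Notation "x < y" := (eLt x y) : so_scope.
Notation "x <= y" := (eOr (eLt x y) (eEq x y)) : so_scope.
Notation "~ P" := (eNot P) : so_scope.
Notation "P -> Q" := (eImp P Q) : so_scope.
Notation "P /\ Q" := (eAnd P Q) : so_scope.
Notation "P \/ Q" := (eOr P Q) : so_scope.
Notation "P <-> Q" := (eIff P Q) : so_scope.
Notation "'alln' x .. y , P" := (eAllN (fun x => .. (eAllN (fun y => P)) ..))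
  (at level 200, x binder, y binder, right associativity) : so_scope.
Notation "'exn' x .. y , P" := (eExN (fun x => .. (eExN (fun y => P)) ..))
  (at level 200, x binder, y binder, right associativity) : so_scope.
Notation "'alls' X .. Y , P" := (eAllS (fun X => .. (eAllS (fun Y => P)) ..))
  (at level 200, X binder, Y binder, right associativity) : so_scope.

Local Open Scope so_scope.

Definition exn_unique (P : nexp -> fexp) : fexp :=
  (exn x, P x) /\ (alln x y, P x -> P y -> x = y).

(** * Coding inside RCA_0^* *)

Definition pair (x y : nexp) : nexp := (x + y) * (x + y) + x.

(** A finite set of numbers is coded by its binary representation: [x] is an
    element of [s] iff the binary digit of [s] of weight [2 ^ x] is 1. *)
Definition inF (x s : nexp) : fexp :=
  exn q r, r < 2 ^ x /\ s = q * 2 ^ (x + 1) + 2 ^ x + r.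

(** [s] is (the code of the graph of) a finite sequence of length [l];
    for [l = c] these are the elements of N^c. *)
Definition fin_seq (l s : nexp) : fexp :=
  (alln z, inF z s -> exn k x, k < l /\ z = pair k x) /\
  (alln k, k < l -> exn_unique (fun x => inF (pair k x) s)).

(** [F] is (the graph of) a function from N to N. *)
Definition is_fun (F : sexp) : fexp :=
  (alln z, eMem z F -> exn x y, z = pair x y) /\
  (alln x, exn_unique (fun y => eMem (pair x y) F)).

(** * Dickson's lemma *)

Definition tuple_le (c s t : nexp) : fexp :=
  alln k x y, k < c -> inF (pair k x) s -> inF (pair k y) t -> x <= y.

Definition DL_ (c : nexp) : fexp :=
  alls F, is_fun F -> (alln i s, eMem (pair i s) F -> fin_seq c s) ->
    exn i j s t, i < j /\ eMem (pair i s) F /\ eMem (pair j t) F /\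
      tuple_le c s t.

Definition DL : fexp := alln c, DL_ c.

(** * The relativized weak Paris-Harrington principle *)

(** [C] is the code of the graph [{((n, m), k)}] of a coloring
    [a, R]^2 -> c. *)
Definition coloring (a R c C : nexp) : fexp :=
  (alln z, inF z C ->
     exn n m k, a <= n /\ n < m /\ m <= R /\ k < c /\
       z = pair (pair n m) k) /\
  (alln n m, a <= n -> n < m -> m <= R ->
     exn_unique (fun k => inF (pair (pair n m) k) C)).

(** The finite set [H] is [{h_0 < ... < h_(l-1)}], hence [l] is its
    cardinality and, if [0 < l], [h_0] is its minimum. *)
Definition increasing_enum (H l h : nexp) : fexp :=
  fin_seq l h /\
  (alln i j x y, i < j -> inF (pair i x) h -> inF (pair j y) h -> x < y) /\
  (alln x, inF x H <-> exn i, inF (pair i x) h).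

Definition weakly_homogeneous (C l h : nexp) : fexp :=
  alln i x y z, inF (pair i x) h -> inF (pair (i + 1) y) h ->
    inF (pair (i + 2) z) h ->
    exn k, inF (pair (pair x y) k) C /\ inF (pair (pair y z) k) C.

Definition WPH (F : sexp) (c : nexp) : fexp :=
  alln a, exn R, alln C, coloring a R c C ->
    exn H l h,
      (alln x, inF x H -> a <= x /\ x <= R) /\
      increasing_enum H l h /\
      weakly_homogeneous C l h /\
      0 < l /\
      (exn x y, inF (pair 0 x) h /\ eMem (pair x y) F /\ y < l).

Definition RPH_ (c : nexp) : fexp := alls F, is_fun F -> WPH F c.

(** * Well-foundedness of omega^c and omega^omega *)

(** A nonincreasing finite sequence [n_0 >= ... >= n_(l-1)] denotes the
    Cantor normal form [omega^n_0 + ... + omega^n_(l-1)]; the empty sequence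
    denotes 0.  These are the notations for the ordinals below omega^omega,
    and those with all exponents below [c] are the notations for the ordinals
    below omega^c. *)
Definition below_omega_omega (s : nexp) : fexp :=
  exn l, fin_seq l s /\
    (alln i x y, inF (pair i x) s -> inF (pair (i + 1) y) s -> y <= x).

Definition below_omega_pow (c s : nexp) : fexp :=
  below_omega_omega s /\ (alln i x, inF (pair i x) s -> x < c).

(** Comparison of Cantor normal forms: lexicographic, proper initial segments
    being smaller. *)
Definition cnf_lt (s t : nexp) : fexp :=
  exn i,
    (alln j, j < i -> exn x, inF (pair j x) s /\ inF (pair j x) t) /\
    (exn y, inF (pair i y) t /\
       ((~ exn x, inF (pair i x) s) \/ (exn x, inF (pair i x) s /\ x < y))).

Definition no_descending_sequence (D : nexp -> fexp) : fexp :=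
  ~ eExS (fun F => is_fun F /\ (alln i s, eMem (pair i s) F -> D s) /\
      (alln i s t, eMem (pair i s) F -> eMem (pair (i + 1) t) F ->
         cnf_lt t s)).

Definition WO_omega_pow (c : nexp) : fexp :=
  no_descending_sequence (below_omega_pow c).

Definition WO_omega_omega : fexp :=
  no_descending_sequence below_omega_omega.

(* Main.v *)
(* By completeness it suffices to argue in an arbitrary, possibly nonstandard,
   model of RCA_0^*; induction there is only available for predicates definable
   by a bounded formula.

   DL_c -> WO(omega^c): a Cantor normal form below omega^c is sent to the tuple
   whose [k]th entry is the number of exponents [>= k]; if [beta < alpha] then
   the tuple of [alpha] is not below that of [beta].

   RPH_c -> DL_c: colour [n < m] by the first coordinate in which the [n]th tuple
   exceeds the [m]th.

   WO(omega^c) -> RPH_c: given a colouring of [[a, R]^2], let [x_n(k)] be the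
   length of the longest chain of colour [k] starting with [n]. If [C(n, m) = k]
   then [x_n(k) > x_m(k)], so [x] is a bad sequence of tuples, and it is bounded
   by [f] if no homogeneous set is large. The complement of the upward closure of
   a finite bad sequence is covered by finitely many regions, obtained by fixing
   some coordinates; a region with [d] free coordinates counts for omega^d, and
   appending a tuple replaces at least one region by regions with fewer free
   coordinates. Taking the maximal ordinal over all [f]-bounded bad sequences of
   length [n], for each [n], would give a descending sequence below
   omega^c. *)

Require Import Defs.
From Stdlib Require Import List Lia Arith Cantor Classical ClassicalEpsilon
  FunctionalExtensionality PropExtensionality ProofIrrelevance.
Import ListNotations.

Set Implicit Arguments.
Unset Strict Implicit.
Unset Printing Implicit Defensive.

(** * Substitution *)

(** Colourings that refute [RPH_c] for different [R] need not extend one another, and without weak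
    König's lemma they cannot be threaded into one infinite bad sequence. The maximal ordinal at
    each length replaces compactness: dropping the last tuple of a longer bad sequence gives a
    shorter one of larger ordinal, which is at most the maximum at that length. The maximum ranges
    over a finite set because [f] is bounded on each initial segment; this is a case of bounding,
    which follows from Delta^0_1 comprehension and bounded induction. The second obstacle is the
    lack of recursion. Bounded induction with exponentiation yields finite sets and sequences whose
    codes have an explicit bound, but no iteration. So every notion is defined outright by a bounded
    formula, or through a bounded code of its computation, and natural sums, whose coefficients
    would require counting sets, give way to a comparison of binary codes. For omega^omega, all
    exponents in a descending sequence are bounded by the leading exponent of its first term, so the
    sequence already lies below some omega^c. *)

Lemma substT_comp s1 s2 t :
  substT s1 (substT s2 t) = substT (fun i => substT s1 (s2 i)) t.
Proof. induction t; simpl; congruence. Qed.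

Lemma substT_id t : substT tVar t = t.
Proof. induction t; simpl; congruence. Qed.

Lemma upN_comp s1 s2 :
  (fun i => substT (upN s1) (upN s2 i)) = upN (fun i => substT s1 (s2 i)).
Proof.
  apply functional_extensionality; intros [|i]; simpl; [reflexivity|].
  unfold upN; simpl; rewrite !substT_comp; reflexivity.
Qed.

Lemma upS_comp r1 r2 :
  (fun X => upS r1 (upS r2 X)) = upS (fun X => r1 (r2 X)).
Proof. apply functional_extensionality; intros [|i]; reflexivity. Qed.

Lemma upN_id : upN tVar = tVar.
Proof. apply functional_extensionality; intros [|i]; reflexivity. Qed.

Lemma upS_id : upS (fun X => X) = (fun X => X).
Proof. apply functional_extensionality; intros [|i]; reflexivity. Qed.

Lemma subst_comp s1 r1 s2 r2 p :
  subst s1 r1 (subst s2 r2 p) =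
  subst (fun i => substT s1 (s2 i)) (fun X => r1 (r2 X)) p.
Proof.
  revert s1 r1 s2 r2; induction p; intros; simpl;
    rewrite ?substT_comp; f_equal; auto.
  - rewrite IHp, upN_comp; reflexivity.
  - rewrite IHp, upN_comp; reflexivity.
  - rewrite IHp, upS_comp; reflexivity.
  - rewrite IHp, upS_comp; reflexivity.
Qed.

Lemma subst_id p : subst tVar (fun X => X) p = p.
Proof.
  induction p; simpl; rewrite ?substT_id, ?upN_id, ?upS_id; congruence.
Qed.

Lemma substT_scons_shiftN a t : substT (scons a tVar) (substT shiftN t) = t.
Proof. rewrite substT_comp; apply substT_id. Qed.

Lemma liftN_subst s r p :
  subst (upN s) r (liftN p) = liftN (subst s r p).
Proof. unfold liftN; rewrite !subst_comp; reflexivity. Qed.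

Lemma liftS_subst s r p :
  subst s (upS r) (liftS p) = liftS (subst s r p).
Proof.
  unfold liftS; rewrite !subst_comp; f_equal.
  apply functional_extensionality; intro i; rewrite substT_id; reflexivity.
Qed.

Lemma instN_subst s r t p :
  subst s r (instN t p) = instN (substT s t) (subst (upN s) r p).
Proof.
  unfold instN; rewrite !subst_comp; f_equal.
  apply functional_extensionality; intros [|i]; simpl; [reflexivity|].
  unfold upN; simpl; rewrite substT_scons_shiftN; reflexivity.
Qed.

Lemma instS_subst s r X p :
  subst s r (instS X p) = instS (r X) (subst s (upS r) p).
Proof.
  unfold instS; rewrite !subst_comp; f_equal; apply functional_extensionality.
  - intro i; rewrite substT_id; reflexivity.
  - intros [|i]; reflexivity.
Qed.

Lemma map_liftN_subst s r G :
  map (subst (upN s) r) (map liftN G) = map liftN (map (subst s r) G).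
Proof.
  rewrite !map_map; apply map_ext; intro; apply liftN_subst.
Qed.

Lemma map_liftS_subst s r G :
  map (subst s (upS r)) (map liftS G) = map liftS (map (subst s r) G).
Proof.
  rewrite !map_map; apply map_ext; intro; apply liftS_subst.
Qed.

Lemma substT_bound t : exists n, forall s1 s2,
  (forall i, i < n -> s1 i = s2 i) -> substT s1 t = substT s2 t.
Proof.
  induction t as [i| | |t [n Hn] u [m Hm]|t [n Hn] u [m Hm]|t [n Hn] u [m Hm]];
    [exists (S i); simpl; auto|exists 0; auto|exists 0; auto|..];
    exists (n + m); intros s1 s2 H; simpl;
    (rewrite (Hn s1 s2), (Hm s1 s2); [reflexivity| |];
     intros; apply H; lia).
Qed.

(** Only finitely many variables matter to a formula. The bounds serve twice: as the number of
    quantifiers that close a formula, and as a source of fresh variables. *)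
Lemma subst_bound p : exists n m, forall s1 s2 r1 r2,
  (forall i, i < n -> s1 i = s2 i) -> (forall X, X < m -> r1 X = r2 X) ->
  subst s1 r1 p = subst s2 r2 p.
Proof.
  induction p as
    [t u|t u|t X| |p [n [m H]] q [n' [m' H']]|p [n [m H]] q [n' [m' H']]
    |p [n [m H]] q [n' [m' H']]|p [n [m H]]|p [n [m H]]
    |p [n [m H]]|p [n [m H]]].
  1, 2: destruct (substT_bound t) as [n Hn], (substT_bound u) as [n' Hn'];
    exists (n + n'), 0; intros; simpl;
    f_equal; [apply Hn|apply Hn']; intros; apply H; lia.
  - destruct (substT_bound t) as [n Hn]; exists n, (S X); intros; simpl.
    f_equal; auto.
  - exists 0, 0; reflexivity.
  - exists (n + n'), (m + m'); intros s1 s2 r1 r2 Hs Hr; simpl.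
    f_equal; [apply H|apply H']; intros; (apply Hs || apply Hr); lia.
  - exists (n + n'), (m + m'); intros s1 s2 r1 r2 Hs Hr; simpl.
    f_equal; [apply H|apply H']; intros; (apply Hs || apply Hr); lia.
  - exists (n + n'), (m + m'); intros s1 s2 r1 r2 Hs Hr; simpl.
    f_equal; [apply H|apply H']; intros; (apply Hs || apply Hr); lia.
  - exists n, m; intros s1 s2 r1 r2 Hs Hr; simpl; f_equal; apply H; auto.
    intros [|i] Hi; unfold upN; simpl; [|rewrite Hs by lia]; reflexivity.
  - exists n, m; intros s1 s2 r1 r2 Hs Hr; simpl; f_equal; apply H; auto.
    intros [|i] Hi; unfold upN; simpl; [|rewrite Hs by lia]; reflexivity.
  - exists n, m; intros s1 s2 r1 r2 Hs Hr; simpl; f_equal; apply H; auto.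
    intros [|i] Hi; unfold upS; simpl; [|rewrite Hr by lia]; reflexivity.
  - exists n, m; intros s1 s2 r1 r2 Hs Hr; simpl; f_equal; apply H; auto.
    intros [|i] Hi; unfold upS; simpl; [|rewrite Hr by lia]; reflexivity.
Qed.

Lemma context_bound G : exists n m, forall p, In p G -> forall s1 s2 r1 r2,
  (forall i, i < n -> s1 i = s2 i) -> (forall X, X < m -> r1 X = r2 X) ->
  subst s1 r1 p = subst s2 r2 p.
Proof.
  induction G as [|p G [n [m H]]].
  - exists 0, 0; intros p [].
  - destruct (subst_bound p) as [n' [m' H']].
    exists (n + n'), (m + m'); intros q [<-|Hq] s1 s2 r1 r2 Hs Hr;
      [apply H'|apply (H _ Hq)]; intros; (apply Hs || apply Hr); lia.
Qed.

(** * Derivations are closed under weakening and substitution *)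

Fixpoint allN (n : nat) (p : form) : form :=
  match n with O => p | S n => fAllN (allN n p) end.

Fixpoint allS (n : nat) (p : form) : form :=
  match n with O => p | S n => fAllS (allS n p) end.

Fixpoint iter_upN (n : nat) (s : nat -> term) : nat -> term :=
  match n with O => s | S n => iter_upN n (upN s) end.

Fixpoint iter_upS (n : nat) (r : nat -> nat) : nat -> nat :=
  match n with O => r | S n => iter_upS n (upS r) end.

(** The outermost of [n] quantifiers binds index [n - 1], so eliminating them from the outside
    supplies [s (n - 1)], ..., [s 0] in this order; [s'] collects what has been supplied so far. *)
Fixpoint prepend {A : Type} (n : nat) (s s' : nat -> A) : nat -> A :=
  match n with O => s' | S n => prepend n s (scons (s n) s') end.

Lemma prepend_lt A n (s s' : nat -> A) i : i < n -> prepend n s s' i = s i.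
Proof.
  enough (H : prepend n s s' i = if i <? n then s i else s' (i - n)).
  { intro Hi; rewrite H; destruct (Nat.ltb_spec i n); [reflexivity|lia]. }
  revert s'; induction n as [|n IH]; intro s'; simpl.
  - rewrite Nat.sub_0_r; reflexivity.
  - rewrite IH; destruct (Nat.ltb_spec i n), (Nat.ltb_spec i (S n));
      try lia; try reflexivity.
    + replace i with n by lia; rewrite Nat.sub_diag; reflexivity.
    + replace (i - n) with (S (i - S n)) by lia; reflexivity.
Qed.

Lemma subst_allN n s r p :
  subst s r (allN n p) = allN n (subst (iter_upN n s) r p).
Proof. revert s; induction n; intro s; simpl; congruence. Qed.

Lemma subst_allS n s r p :
  subst s r (allS n p) = allS n (subst s (iter_upS n r) p).
Proof. revert r; induction n; intro r; simpl; congruence. Qed.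

Lemma iter_upN_comp n s1 s2 :
  (fun i => substT (iter_upN n s1) (iter_upN n s2 i)) =
  iter_upN n (fun i => substT s1 (s2 i)).
Proof.
  revert s1 s2; induction n; intros; simpl; [reflexivity|].
  rewrite IHn, upN_comp; reflexivity.
Qed.

Lemma iter_upS_comp n r1 r2 :
  (fun X => iter_upS n r1 (iter_upS n r2 X)) = iter_upS n (fun X => r1 (r2 X)).
Proof.
  revert r1 r2; induction n; intros; simpl; [reflexivity|].
  rewrite IHn, upS_comp; reflexivity.
Qed.

Lemma iter_upN_id n : iter_upN n tVar = tVar.
Proof. induction n; simpl; [reflexivity|]; rewrite upN_id; auto. Qed.

Lemma iter_upS_id n : iter_upS n (fun X => X) = (fun X => X).
Proof. induction n; simpl; [reflexivity|]; rewrite upS_id; auto. Qed.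

Section Derivations.
Context {Ax : form -> Prop}.

Lemma prf_weak G G' p : prf Ax G p -> incl G G' -> prf Ax G' p.
Proof.
  intro H; revert G'; induction H; intros G' Hi.
  - apply pr_ax; assumption.
  - apply pr_hyp; auto.
  - apply pr_raa, IHprf; intros q [<-|Hq]; [left|right]; auto.
  - apply pr_impI, IHprf; intros r [<-|Hq]; [left|right]; auto.
  - eapply pr_impE; auto.
  - apply pr_andI; auto.
  - eapply pr_andE1; auto.
  - eapply pr_andE2; auto.
  - apply pr_orI1; auto.
  - apply pr_orI2; auto.
  - eapply pr_orE; [auto|apply IHprf2|apply IHprf3];
      intros x [<-|Hq]; simpl; auto.
  - apply pr_allNI, IHprf, incl_map; assumption.
  - apply pr_allNE; auto.
  - eapply pr_exNI; auto.
  - eapply pr_exNE; [auto|apply IHprf2].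
    intros x [<-|Hx]; [left; auto|right].
    apply (incl_map liftN Hi); assumption.
  - apply pr_allSI, IHprf, incl_map; assumption.
  - apply pr_allSE; auto.
  - eapply pr_exSI; auto.
  - eapply pr_exSE; [auto|apply IHprf2].
    intros x [<-|Hx]; [left; auto|right].
    apply (incl_map liftS Hi); assumption.
  - apply pr_eqI.
  - eapply pr_eqE; auto.
Qed.

Lemma prf_allN_elim n G p s r s' :
  prf Ax G (allN n (subst (iter_upN n s') r p)) ->
  prf Ax G (subst (prepend n s s') r p).
Proof.
  revert s'; induction n as [|n IH]; intros s' H; simpl in *; [assumption|].
  apply IH.
  apply (pr_allNE (s n)) in H; unfold instN in H.
  rewrite subst_allN, subst_comp, iter_upN_comp in H.
  replace (scons (s n) s')
    with (fun i => substT (scons (s n) tVar) (upN s' i)); [assumption|].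
  apply functional_extensionality; intros [|i]; simpl; [reflexivity|].
  unfold upN; simpl; rewrite substT_scons_shiftN; reflexivity.
Qed.

Lemma prf_allS_elim n G p s r r' :
  prf Ax G (allS n (subst s (iter_upS n r') p)) ->
  prf Ax G (subst s (prepend n r r') p).
Proof.
  revert r'; induction n as [|n IH]; intros r' H; simpl in *; [assumption|].
  apply IH.
  apply (pr_allSE (r n)) in H; unfold instS in H.
  rewrite subst_allS, subst_comp, iter_upS_comp in H.
  replace (fun i => substT tVar (s i)) with s in H
    by (apply functional_extensionality; intro; rewrite substT_id; reflexivity).
  replace (scons (r n) r')
    with (fun X => scons (r n) (fun Y => Y) (upS r' X)); [assumption|].
  apply functional_extensionality; intros [|i]; reflexivity.
Qed.

(** Axioms need not be closed under substitution. But a formula derivable in every context can be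
    generalized over all its variables and then instantiated, first for numbers and then for sets.
    This settles the axiom case of [prf_subst]. *)
Lemma prf_subst_closed p s r :
  (forall G, prf Ax G p) -> forall G, prf Ax G (subst s r p).
Proof.
  intro H.
  assert (HN : forall G, prf Ax G (subst s (fun X => X) p)).
  { intro G; destruct (subst_bound p) as [n [m Hb]].
    rewrite (Hb _ (prepend n s tVar) _ (fun X => X));
      [|intros; symmetry; apply prepend_lt; assumption|reflexivity].
    apply prf_allN_elim; rewrite iter_upN_id, subst_id.
    clear Hb; revert G; induction n as [|n IH]; intro G; [apply H|].
    apply pr_allNI, IH. }
  intro G; destruct (subst_bound (subst s (fun X => X) p)) as [n [m Hb]].
  replace (subst s r p) with (subst tVar r (subst s (fun X => X) p)).
  2:{ rewrite subst_comp; f_equal.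
      apply functional_extensionality; intro; apply substT_id. }
  rewrite (Hb _ tVar _ (prepend m r (fun X => X)));
    [|reflexivity|intros; symmetry; apply prepend_lt; assumption].
  apply prf_allS_elim; rewrite iter_upS_id, subst_id.
  clear Hb; revert G; induction m as [|m IH]; intro G; [apply HN|].
  apply pr_allSI, IH.
Qed.

Lemma prf_subst G p s rho :
  prf Ax G p -> prf Ax (map (subst s rho) G) (subst s rho p).
Proof.
  intro H; revert s rho; induction H; intros s rho; simpl in *.
  - apply prf_subst_closed; intro; apply pr_ax; assumption.
  - apply pr_hyp, in_map; assumption.
  - apply pr_raa, IHprf.
  - apply pr_impI, IHprf.
  - eapply pr_impE; [apply IHprf1|apply IHprf2].
  - apply pr_andI; auto.
  - eapply pr_andE1; apply IHprf.
  - eapply pr_andE2; apply IHprf.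
  - apply pr_orI1; auto.
  - apply pr_orI2; auto.
  - eapply pr_orE; [apply IHprf1|apply IHprf2|apply IHprf3].
  - apply pr_allNI; rewrite <- map_liftN_subst; apply IHprf.
  - rewrite instN_subst; apply pr_allNE, IHprf.
  - apply (@pr_exNI _ _ _ (substT s t)); rewrite <- instN_subst; apply IHprf.
  - eapply pr_exNE; [apply IHprf1|].
    rewrite <- map_liftN_subst, <- liftN_subst; apply IHprf2.
  - apply pr_allSI; rewrite <- map_liftS_subst; apply IHprf.
  - rewrite instS_subst; apply pr_allSE, IHprf.
  - apply (@pr_exSI _ _ _ (rho X)); rewrite <- instS_subst; apply IHprf.
  - eapply pr_exSE; [apply IHprf1|].
    rewrite <- map_liftS_subst, <- liftS_subst; apply IHprf2.
  - apply pr_eqI.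
  - rewrite instN_subst; eapply pr_eqE; [apply IHprf1|].
    rewrite <- instN_subst; apply IHprf2.
Qed.

Lemma prf_exfalso G p : prf Ax G fBot -> prf Ax G p.
Proof. intro H; apply pr_raa; apply (prf_weak H); intros x; simpl; auto. Qed.

Lemma prf_hd G p : prf Ax (p :: G) p.
Proof. apply pr_hyp; left; reflexivity. Qed.

Lemma prf_tl G p q : prf Ax G q -> prf Ax (p :: G) q.
Proof. intro H; apply (prf_weak H), incl_tl, incl_refl. Qed.

Lemma prf_not_imp1 G p q : prf Ax G (fNot (fImp p q)) -> prf Ax G p.
Proof.
  intro H; apply pr_raa; eapply pr_impE; [apply prf_tl, H|].
  apply pr_impI, prf_exfalso; eapply pr_impE; [apply prf_tl, prf_hd|apply prf_hd].
Qed.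

Lemma prf_not_imp2 G p q : prf Ax G (fNot (fImp p q)) -> prf Ax G (fNot q).
Proof.
  intro H; apply pr_impI; eapply pr_impE; [apply prf_tl, H|].
  apply pr_impI, prf_tl, prf_hd.
Qed.

End Derivations.

(** * Completeness *)

Fixpoint term_code (t : term) : nat :=
  match t with
  | tVar i => to_nat (0, i)
  | tZero => to_nat (1, 0)
  | tOne => to_nat (2, 0)
  | tAdd t u => to_nat (3, to_nat (term_code t, term_code u))
  | tMul t u => to_nat (4, to_nat (term_code t, term_code u))
  | tExp t u => to_nat (5, to_nat (term_code t, term_code u))
  end.

Fixpoint form_code (p : form) : nat :=
  match p with
  | fEq t u => to_nat (0, to_nat (term_code t, term_code u))
  | fLt t u => to_nat (1, to_nat (term_code t, term_code u))
  | fMem t X => to_nat (2, to_nat (term_code t, X))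
  | fBot => to_nat (3, 0)
  | fImp p q => to_nat (4, to_nat (form_code p, form_code q))
  | fAnd p q => to_nat (5, to_nat (form_code p, form_code q))
  | fOr p q => to_nat (6, to_nat (form_code p, form_code q))
  | fAllN p => to_nat (7, form_code p)
  | fExN p => to_nat (8, form_code p)
  | fAllS p => to_nat (9, form_code p)
  | fExS p => to_nat (10, form_code p)
  end.

Lemma to_nat_inj_pair a b a' b' :
  to_nat (a, b) = to_nat (a', b') -> a = a' /\ b = b'.
Proof.
  intro H; apply (f_equal of_nat) in H; rewrite !cancel_of_to in H.
  injection H; auto.
Qed.

Ltac inj_codes :=
  repeat match goal with
  | H : to_nat _ = to_nat _ |- _ => apply to_nat_inj_pair in H; destruct H
  end.

Lemma term_code_inj t u : term_code t = term_code u -> t = u.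
Proof.
  revert u; induction t; intros []; cbn [term_code]; intro H;
    inj_codes; try discriminate; f_equal; auto.
Qed.

Lemma form_code_inj p q : form_code p = form_code q -> p = q.
Proof.
  revert q; induction p; intros []; cbn [form_code]; intro H;
    inj_codes; try discriminate; f_equal; auto using term_code_inj.
Qed.

Definition enum_form (n : nat) : form :=
  epsilon (inhabits fBot) (fun p => form_code p = n).

Lemma enum_form_code p : enum_form (form_code p) = p.
Proof.
  apply form_code_inj; unfold enum_form.
  apply (epsilon_spec (inhabits fBot) (fun q => form_code q = form_code p)).
  exists p; reflexivity.
Qed.

Record structure := Structure {
  num : Type;
  nset : Type;
  sZero : num;
  sOne : num;
  sAdd : num -> num -> num;
  sMul : num -> num -> num;
  sExp : num -> num -> num;
  sLt : num -> num -> Prop;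
  sMem : num -> nset -> Prop }.

Fixpoint eval (A : structure) (e : nat -> num A) (t : term) : num A :=
  match t with
  | tVar i => e i
  | tZero => sZero A
  | tOne => sOne A
  | tAdd t u => sAdd (eval e t) (eval e u)
  | tMul t u => sMul (eval e t) (eval e u)
  | tExp t u => sExp (eval e t) (eval e u)
  end.

Fixpoint sat (A : structure) (e : nat -> num A) (r : nat -> nset A)
    (p : form) : Prop :=
  match p with
  | fEq t u => eval e t = eval e u
  | fLt t u => sLt (eval e t) (eval e u)
  | fMem t X => sMem (eval e t) (r X)
  | fBot => False
  | fImp p q => sat e r p -> sat e r q
  | fAnd p q => sat e r p /\ sat e r q
  | fOr p q => sat e r p \/ sat e r q
  | fAllN p => forall x, sat (scons x e) r p
  | fExN p => exists x, sat (scons x e) r p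
  | fAllS p => forall X, sat e (scons X r) p
  | fExS p => exists X, sat e (scons X r) p
  end.

Definition models (Ax : form -> Prop) (A : structure) : Prop :=
  forall p, Ax p -> forall (e : nat -> num A) r, sat e r p.

Section Completeness.
Context {Ax : form -> Prop}.

Definition consistent (G : list form) : Prop := ~ prf Ax G fBot.

(** Take [k] beyond all variables of [G] and [q]. Sending [k] to 0 and shifting all others turns a
    derivation about [k] into the premise of an eigenvariable rule. *)
Lemma fresh_num_var G q : exists k s,
  map (subst s (fun X => X)) G = map liftN G /\
  subst s (fun X => X) (instN (tVar k) q) = q.
Proof.
  destruct (context_bound (q :: G)) as [k [m H]].
  exists k, (fun i => if i =? k then tVar 0 else tVar (S i)).
  assert (HG : forall p, In p G ->
    subst (fun i => if i =? k then tVar 0 else tVar (S i)) (fun X => X) p =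
    liftN p).
  { intros p Hp; apply (H p (or_intror Hp)); [|reflexivity].
    intros i Hi; destruct (Nat.eqb_spec i k); [lia|reflexivity]. }
  split; [apply map_ext_in, HG|].
  unfold instN; rewrite subst_comp; rewrite <- (subst_id q) at 2.
  apply (H q (or_introl eq_refl)); [|reflexivity].
  intros [|i] Hi; simpl; [rewrite Nat.eqb_refl; reflexivity|].
  destruct (Nat.eqb_spec i k); [lia|reflexivity].
Qed.

Lemma fresh_set_var G q : exists k r,
  map (subst tVar r) G = map liftS G /\
  subst tVar r (instS k q) = q.
Proof.
  destruct (context_bound (q :: G)) as [n [k H]].
  exists k, (fun i => if i =? k then 0 else S i).
  assert (HG : forall p, In p G ->
    subst tVar (fun i => if i =? k then 0 else S i) p = liftS p).
  { intros p Hp; apply (H p (or_intror Hp)); [reflexivity|].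
    intros i Hi; destruct (Nat.eqb_spec i k); [lia|reflexivity]. }
  split; [apply map_ext_in, HG|].
  unfold instS; rewrite subst_comp; rewrite <- (subst_id q) at 2.
  apply (H q (or_introl eq_refl)); [reflexivity|].
  intros [|i] Hi; simpl; [rewrite Nat.eqb_refl; reflexivity|].
  destruct (Nat.eqb_spec i k); [lia|reflexivity].
Qed.

Definition henkin (p : form) (G : list form) : Prop :=
  match p with
  | fAllN q => exists k, prf Ax G (fImp (instN (tVar k) q) p)
  | fExN q => exists k, prf Ax G (fImp p (instN (tVar k) q))
  | fAllS q => exists k, prf Ax G (fImp (instS k q) p)
  | fExS q => exists k, prf Ax G (fImp p (instS k q))
  | _ => True
  end.

Lemma inconsistent_imp G p q :
  prf Ax (fImp p q :: G) fBot -> prf Ax G p /\ prf Ax G (fNot q).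
Proof.
  intro H; apply pr_impI in H.
  split; [eapply prf_not_imp1|eapply prf_not_imp2]; exact H.
Qed.

(** If the Henkin implication with a fresh variable were refutable, its premise would be derivable
    and its conclusion refutable. Renaming the fresh variable to an eigenvariable then makes [G]
    inconsistent by [pr_allNI] or [pr_exNE], or by their analogues for sets. *)
Lemma henkin_extension G p : consistent G ->
  exists G', incl G G' /\ consistent G' /\ henkin p G'.
Proof.
  intro HG.
  assert (Hadd : forall q,
    (prf Ax (q :: G) fBot -> False) -> henkin p (q :: G) ->
    exists G', incl G G' /\ consistent G' /\ henkin p G').
  { intros q Hq Hh; exists (q :: G); split; [apply incl_tl, incl_refl|auto]. }
  destruct p as [| | | | | | |q|q|q|q];
    try (exists G; split; [apply incl_refl|split; [assumption|exact I]]).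
  - destruct (fresh_num_var G q) as [k [s [Hs Hq]]].
    apply (Hadd (fImp (instN (tVar k) q) (fAllN q)));
      [|exists k; apply prf_hd].
    intro H; apply inconsistent_imp in H; destruct H as [H1 H2].
    apply HG; eapply pr_impE; [apply H2|].
    apply pr_allNI; rewrite <- Hs, <- Hq.
    apply prf_subst; exact H1.
  - destruct (fresh_num_var G q) as [k [s [Hs Hq]]].
    apply (Hadd (fImp (fExN q) (instN (tVar k) q)));
      [|exists k; apply prf_hd].
    intro H; apply inconsistent_imp in H; destruct H as [H1 H2].
    apply HG; eapply pr_exNE; [apply H1|].
    eapply pr_impE; [|apply prf_hd].
    apply prf_tl; rewrite <- Hs.
    apply (prf_subst s (fun X => X)) in H2; simpl in H2.
    rewrite Hq in H2; exact H2.
  - destruct (fresh_set_var G q) as [k [s [Hs Hq]]].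
    apply (Hadd (fImp (instS k q) (fAllS q))); [|exists k; apply prf_hd].
    intro H; apply inconsistent_imp in H; destruct H as [H1 H2].
    apply HG; eapply pr_impE; [apply H2|].
    apply pr_allSI; rewrite <- Hs, <- Hq.
    apply prf_subst; exact H1.
  - destruct (fresh_set_var G q) as [k [s [Hs Hq]]].
    apply (Hadd (fImp (fExS q) (instS k q))); [|exists k; apply prf_hd].
    intro H; apply inconsistent_imp in H; destruct H as [H1 H2].
    apply HG; eapply pr_exSE; [apply H1|].
    eapply pr_impE; [|apply prf_hd].
    apply prf_tl; rewrite <- Hs.
    apply (prf_subst tVar s) in H2; simpl in H2.
    rewrite Hq in H2; exact H2.
Qed.

Lemma extension G p : consistent G ->
  exists G', incl G G' /\ consistent G' /\ henkin p G' /\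
    (prf Ax G' p \/ prf Ax G' (fNot p)).
Proof.
  intro HG; destruct (classic (consistent (p :: G))) as [Hp|Hp].
  - destruct (henkin_extension p Hp) as [G' [Hi [Hc Hh]]].
    exists G'; repeat split; auto; [eapply incl_tran; [|exact Hi]|].
    + apply incl_tl, incl_refl.
    + left; apply pr_hyp, Hi; left; reflexivity.
  - destruct (henkin_extension p HG) as [G' [Hi [Hc Hh]]].
    exists G'; repeat split; auto; right.
    apply pr_impI; apply NNPP in Hp; apply (prf_weak Hp).
    intros x [<-|Hx]; [left; reflexivity|right; auto].
Qed.

Context {G0 : list form} (G0_consistent : consistent G0).

(** Every formula is some [enum_form n], so the union of the stages decides all formulas and has
    witnesses for all quantified ones. *)
Fixpoint stage (n : nat) : {G : list form | consistent G} :=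
  match n with
  | O => exist _ G0 G0_consistent
  | S n =>
      let (G, HG) := stage n in
      let (G', HG') :=
        constructive_indefinite_description _ (extension (enum_form n) HG) in
      exist _ G' (proj1 (proj2 HG'))
  end.

Definition theory (p : form) : Prop :=
  exists n, prf Ax (proj1_sig (stage n)) p.

Lemma stage_succ n :
  incl (proj1_sig (stage n)) (proj1_sig (stage (S n))) /\
  henkin (enum_form n) (proj1_sig (stage (S n))) /\
  (prf Ax (proj1_sig (stage (S n))) (enum_form n) \/
   prf Ax (proj1_sig (stage (S n))) (fNot (enum_form n))).
Proof.
  simpl; destruct (stage n) as [G HG].
  destruct (constructive_indefinite_description _ _) as [G' HG']; simpl.
  intuition.
Qed.

Lemma stage_mono n m : n <= m ->
  incl (proj1_sig (stage n)) (proj1_sig (stage m)).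
Proof.
  induction 1 as [|m Hm IH]; [apply incl_refl|].
  eapply incl_tran; [apply IH|apply stage_succ].
Qed.

Lemma theory_G0 p : In p G0 -> theory p.
Proof. intro H; exists 0; apply pr_hyp; exact H. Qed.

Lemma theory_rule1 p q :
  (forall G, prf Ax G p -> prf Ax G q) -> theory p -> theory q.
Proof. intros H [n Hn]; exists n; auto. Qed.

Lemma theory_rule2 p q r :
  (forall G, prf Ax G p -> prf Ax G q -> prf Ax G r) ->
  theory p -> theory q -> theory r.
Proof.
  intros H [n Hn] [m Hm]; exists (n + m); apply H.
  - apply (prf_weak Hn), stage_mono; lia.
  - apply (prf_weak Hm), stage_mono; lia.
Qed.

Lemma theory_prf p : (forall G, prf Ax G p) -> theory p.
Proof. intro H; exists 0; apply H. Qed.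

Lemma theory_bot : ~ theory fBot.
Proof. intros [n Hn]; exact (proj2_sig (stage n) Hn). Qed.

(** From right to left, the stage after the code of [p] derives [p] or its negation, and either case
    gives the implication. *)
Lemma theory_imp p q : theory (fImp p q) <-> (theory p -> theory q).
Proof.
  split; [apply theory_rule2; intros; eapply pr_impE; eassumption|].
  intro H; destruct (stage_succ (form_code p)) as [_ [_ Hp]].
  rewrite enum_form_code in Hp; destruct Hp as [Hp|Hp].
  - eapply theory_rule1, H; [|eexists; apply Hp].
    intros; apply pr_impI, prf_tl; assumption.
  - eexists; apply pr_impI, prf_exfalso; eapply pr_impE;
      [apply prf_tl, Hp|apply prf_hd].
Qed.

Lemma theory_not p : theory (fNot p) <-> ~ theory p.
Proof.
  unfold fNot; rewrite theory_imp; split; intros H Hp;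
    [exact (theory_bot (H Hp))|destruct (H Hp)].
Qed.

Lemma theory_and p q : theory (fAnd p q) <-> theory p /\ theory q.
Proof.
  split.
  - intro H; split; revert H; apply theory_rule1; intros;
      [eapply pr_andE1|eapply pr_andE2]; eassumption.
  - intros [Hp Hq]; revert Hp Hq; apply theory_rule2; intro; apply pr_andI.
Qed.

Lemma theory_or p q : theory (fOr p q) <-> theory p \/ theory q.
Proof.
  split.
  - intro H; apply NNPP; intro Hn.
    assert (Hp : theory (fNot p)) by (apply theory_not; tauto).
    assert (Hq : theory (fNot q)) by (apply theory_not; tauto).
    apply theory_bot; pose proof (proj2 (theory_and _ _) (conj Hp Hq)) as Hpq.
    revert H Hpq; apply theory_rule2; intros G H1 H2; eapply pr_orE; [exact H1|..];
      (eapply pr_impE; [apply prf_tl|apply prf_hd]);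
      [eapply pr_andE1|eapply pr_andE2]; exact H2.
  - intros [H|H]; revert H; apply theory_rule1; intros G H;
      [apply pr_orI1|apply pr_orI2]; exact H.
Qed.

Lemma theory_henkin p : exists G, henkin p G /\
  forall q, prf Ax G q -> theory q.
Proof.
  destruct (stage_succ (form_code p)) as [_ [H _]].
  rewrite enum_form_code in H.
  exists (proj1_sig (stage (S (form_code p)))); split; [exact H|].
  intros q Hq; eexists; exact Hq.
Qed.

Lemma theory_allN p :
  theory (fAllN p) <-> forall t, theory (instN t p).
Proof.
  split; [intros H t; revert H; apply theory_rule1; intros G H; apply pr_allNE, H|].
  intro H; destruct (theory_henkin (fAllN p)) as [G [[k Hk] HG]].
  exact (proj1 (theory_imp _ _) (HG _ Hk) (H _)).
Qed.

Lemma theory_exN p :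
  theory (fExN p) <-> exists t, theory (instN t p).
Proof.
  split; [|intros [t H]; revert H; apply theory_rule1; intros G H; exact (pr_exNI H)].
  intro H; destruct (theory_henkin (fExN p)) as [G [[k Hk] HG]].
  exists (tVar k); exact (proj1 (theory_imp _ _) (HG _ Hk) H).
Qed.

Lemma theory_allS p :
  theory (fAllS p) <-> forall X, theory (instS X p).
Proof.
  split; [intros H X; revert H; apply theory_rule1; intros G H; apply pr_allSE, H|].
  intro H; destruct (theory_henkin (fAllS p)) as [G [[k Hk] HG]].
  exact (proj1 (theory_imp _ _) (HG _ Hk) (H _)).
Qed.

Lemma theory_exS p :
  theory (fExS p) <-> exists X, theory (instS X p).
Proof.
  split; [|intros [X H]; revert H; apply theory_rule1; intros G H; exact (pr_exSI H)].
  intro H; destruct (theory_henkin (fExS p)) as [G [[k Hk] HG]].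
  exists k; exact (proj1 (theory_imp _ _) (HG _ Hk) H).
Qed.

Definition eqv (t u : term) : Prop := theory (fEq t u).

Lemma eqv_replace p t u :
  eqv t u -> theory (instN t p) -> theory (instN u p).
Proof. apply theory_rule2; intros G; apply pr_eqE. Qed.

Lemma eqv_refl t : eqv t t.
Proof. apply theory_prf; intro; apply pr_eqI. Qed.

Lemma instN_eq t u v :
  instN t (fEq u v) = fEq (substT (scons t tVar) u) (substT (scons t tVar) v).
Proof. reflexivity. Qed.

Lemma eqv_fun f t u :
  eqv t u -> eqv (substT (scons t tVar) f) (substT (scons u tVar) f).
Proof.
  intro H.
  (* The shift shields the left-hand side from the substitution, so that only [f] on the right is
     rewritten. *)
  pose proof (@eqv_replace
    (fEq (substT shiftN (substT (scons t tVar) f)) f) t u H) as H'.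
  rewrite !instN_eq, !substT_scons_shiftN in H'; apply H', eqv_refl.
Qed.

Lemma eqv_sym t u : eqv t u -> eqv u t.
Proof.
  intro H.
  pose proof (@eqv_replace (fEq (tVar 0) (substT shiftN t)) t u H) as H'.
  rewrite !instN_eq, !substT_scons_shiftN in H'; apply H', eqv_refl.
Qed.

Lemma eqv_trans t u v : eqv t u -> eqv u v -> eqv t v.
Proof.
  intros H1 H2.
  pose proof (@eqv_replace (fEq (substT shiftN t) (tVar 0)) u v H2) as H'.
  rewrite !instN_eq, !substT_scons_shiftN in H'; apply H', H1.
Qed.

(** Equality is interpreted as genuine equality, so the term model must be a true quotient. Provably
    equal terms have the same class as a predicate, hence [epsilon] picks the same representative
    for both. *)
Definition rep (t : term) : term := epsilon (inhabits tZero) (eqv t).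

Lemma rep_eqv t : eqv t (rep t).
Proof.
  apply (epsilon_spec (inhabits tZero) (eqv t)); exists t; apply eqv_refl.
Qed.

Definition cterm : Type := {u : term | exists t, u = rep t}.

Definition cls (t : term) : cterm := exist _ (rep t) (ex_intro _ t eq_refl).

Lemma cls_surj (x : cterm) : exists t, x = cls t.
Proof.
  destruct x as [u [t Ht]]; exists t; apply subset_eq_compat; exact Ht.
Qed.

Lemma cls_eq t u : cls t = cls u <-> eqv t u.
Proof.
  split.
  - intro H; apply (f_equal (@proj1_sig _ _)) in H; simpl in H.
    apply eqv_trans with (rep t); [apply rep_eqv|].
    rewrite H; apply eqv_sym, rep_eqv.
  - intro H; apply subset_eq_compat; unfold rep; f_equal.
    apply functional_extensionality; intro v; apply propositional_extensionality.
    split; intro Hv; eapply eqv_trans; eauto using eqv_sym.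
Qed.

Definition cop (f : term -> term -> term) (x y : cterm) : cterm :=
  cls (f (proj1_sig x) (proj1_sig y)).

Definition term_structure : structure :=
  {| num := cterm;
     nset := nat;
     sZero := cls tZero;
     sOne := cls tOne;
     sAdd := cop tAdd;
     sMul := cop tMul;
     sExp := cop tExp;
     sLt x y := theory (fLt (proj1_sig x) (proj1_sig y));
     sMem x X := theory (fMem (proj1_sig x) X) |}.

Lemma cop_cls f t u :
  (forall s a b, substT s (f a b) = f (substT s a) (substT s b)) ->
  cop f (cls t) (cls u) = cls (f t u).
Proof.
  intro Hf; apply cls_eq, eqv_trans with (f (rep t) u); simpl.
  - pose proof (@eqv_fun (f (substT shiftN (rep t)) (tVar 0)) (rep u) u) as H.
    rewrite !Hf, !substT_scons_shiftN in H; apply H, eqv_sym, rep_eqv.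
  - pose proof (@eqv_fun (f (tVar 0) (substT shiftN u)) (rep t) t) as H.
    rewrite !Hf, !substT_scons_shiftN in H; apply H, eqv_sym, rep_eqv.
Qed.

Lemma eval_term_structure s t :
  eval (A := term_structure) (fun i => cls (s i)) t = cls (substT s t).
Proof.
  induction t; simpl; try reflexivity;
    rewrite IHt1, IHt2; apply cop_cls; reflexivity.
Qed.

Lemma theory_lt_rep t u :
  theory (fLt (rep t) (rep u)) <-> theory (fLt t u).
Proof.
  assert (H1 : forall a b v, eqv a b -> theory (fLt a v) -> theory (fLt b v)).
  { intros a b v H.
    pose proof (@eqv_replace (fLt (tVar 0) (substT shiftN v)) a b H) as H'.
    unfold instN in H'; simpl in H'; rewrite !substT_scons_shiftN in H'.
    exact H'. }
  assert (H2 : forall a b v, eqv a b -> theory (fLt v a) -> theory (fLt v b)).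
  { intros a b v H.
    pose proof (@eqv_replace (fLt (substT shiftN v) (tVar 0)) a b H) as H'.
    unfold instN in H'; simpl in H'; rewrite !substT_scons_shiftN in H'.
    exact H'. }
  split; intro H.
  - eapply H1; [apply eqv_sym, rep_eqv|]; eapply H2;
      [apply eqv_sym, rep_eqv|exact H].
  - eapply H1; [apply rep_eqv|]; eapply H2; [apply rep_eqv|exact H].
Qed.

Lemma theory_mem_rep t X : theory (fMem (rep t) X) <-> theory (fMem t X).
Proof.
  split; apply (@eqv_replace (fMem (tVar 0) X));
    [apply eqv_sym, rep_eqv|apply rep_eqv].
Qed.

Lemma cls_scons t s :
  scons (cls t) (fun i => cls (s i)) = (fun i => cls (scons t s i)).
Proof. apply functional_extensionality; intros [|i]; reflexivity. Qed.

Lemma subst_scons t s r p :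
  subst (scons t s) r p = instN t (subst (upN s) r p).
Proof.
  unfold instN; rewrite subst_comp; f_equal.
  apply functional_extensionality; intros [|i]; simpl; [reflexivity|].
  unfold upN; simpl; rewrite substT_scons_shiftN; reflexivity.
Qed.

Lemma subst_sconsS X s r p :
  subst s (scons X r) p = instS X (subst s (upS r) p).
Proof.
  unfold instS; rewrite subst_comp; f_equal; apply functional_extensionality.
  - intro; rewrite substT_id; reflexivity.
  - intros [|i]; reflexivity.
Qed.

(** The truth lemma. Set variables denote themselves: the set sort has no equality that would force
    a quotient. *)
Lemma sat_term_structure p s (r : nat -> nat) :
  sat (A := term_structure) (fun i => cls (s i)) r p <-> theory (subst s r p).
Proof.
  revert s r; induction p; intros s r;
    cbn [sat subst]; rewrite ?eval_term_structure.
  - apply cls_eq.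
  - apply theory_lt_rep.
  - apply theory_mem_rep.
  - pose proof theory_bot; tauto.
  - rewrite theory_imp, IHp1, IHp2; reflexivity.
  - rewrite theory_and, IHp1, IHp2; reflexivity.
  - rewrite theory_or, IHp1, IHp2; reflexivity.
  - rewrite theory_allN; split.
    + intros H t; rewrite <- subst_scons, <- IHp, <- cls_scons; apply H.
    + intros H x; destruct (cls_surj x) as [t ->].
      rewrite cls_scons, IHp, subst_scons; apply H.
  - rewrite theory_exN; split.
    + intros [x H]; destruct (cls_surj x) as [t ->]; exists t.
      rewrite <- subst_scons, <- IHp, <- cls_scons; apply H.
    + intros [t H]; exists (cls t); rewrite cls_scons, IHp, subst_scons; apply H.
  - rewrite theory_allS; split; intros H X.
    + rewrite <- subst_sconsS, <- IHp; apply H.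
    + rewrite IHp, subst_sconsS; apply H.
  - rewrite theory_exS; split; intros [X H]; exists X.
    + rewrite <- subst_sconsS, <- IHp; apply H.
    + rewrite IHp, subst_sconsS; apply H.
Qed.

(** Representatives turn an arbitrary environment into a substitution, and substitution instances of
    axioms are derivable. *)
Lemma term_structure_models : models Ax term_structure.
Proof.
  intros p Hp e r.
  assert (Hs : exists s, e = (fun i => cls (s i))).
  { exists (fun i => proj1_sig
      (constructive_indefinite_description _ (cls_surj (e i)))).
    apply functional_extensionality; intro i.
    destruct (constructive_indefinite_description _ _); assumption. }
  destruct Hs as [s ->]; apply sat_term_structure.
  apply theory_prf; apply prf_subst_closed; intro; apply pr_ax; exact Hp.
Qed.

End Completeness.

Theorem completeness (Ax : form -> Prop) (p : form) :
  (forall A, models Ax A -> forall (e : nat -> num A) r, sat e r p) ->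
  prf Ax [] p.
Proof.
  intro H; apply NNPP; intro Hp.
  assert (HG : consistent (Ax := Ax) [fNot p]).
  { intro Hb; apply Hp, pr_raa, Hb. }
  pose proof (H _ (@term_structure_models _ _ HG)
    (fun i => cls HG (tVar i)) (fun X => X)) as Hs.
  apply sat_term_structure in Hs; rewrite subst_id in Hs.
  revert Hs; apply theory_not, theory_G0; left; reflexivity.
Qed.

(** * Models and bounded definability *)

(** The field [rca_set] makes the set sort inhabited: without a set there is no environment, and
    [models] would hold vacuously. *)
Record rca_model := RcaModel {
  rca_structure :> structure;
  rca_models : models RCA0star rca_structure;
  rca_set : nset rca_structure }.

Lemma eval_subst A (e : nat -> num A) s t :
  eval e (substT s t) = eval (fun i => eval e (s i)) t.
Proof. induction t; simpl; congruence. Qed.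

Lemma eval_upN A (e : nat -> num A) s x :
  (fun i => eval (scons x e) (upN s i)) = scons x (fun i => eval e (s i)).
Proof.
  apply functional_extensionality; intros [|i]; [reflexivity|].
  unfold upN; simpl; rewrite eval_subst; reflexivity.
Qed.

Lemma scons_upS (B : Type) (r : nat -> B) s X :
  (fun i => scons X r (upS s i)) = scons X (fun i => r (s i)).
Proof. apply functional_extensionality; intros [|i]; reflexivity. Qed.

Lemma sat_subst A (e : nat -> num A) r s rho p :
  sat e r (subst s rho p) <->
  sat (fun i => eval e (s i)) (fun X => r (rho X)) p.
Proof.
  revert e r s rho; induction p; intros; simpl; rewrite ?eval_subst; try tauto;
    try (rewrite ?IHp1, ?IHp2; reflexivity).
  - split; intros H x; specialize (H x);
      rewrite IHp, eval_upN in *; exact H.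
  - split; intros [x H]; exists x;
      rewrite IHp, eval_upN in *; exact H.
  - split; intros H x; specialize (H x);
      rewrite IHp, scons_upS in *; exact H.
  - split; intros [x H]; exists x;
      rewrite IHp, scons_upS in *; exact H.
Qed.

Lemma Sigma00_subst s rho p : Sigma00 p -> Sigma00 (subst s rho p).
Proof.
  intro H; revert s; induction H; intro s; simpl; try (constructor; auto).
  - replace (substT (upN s) (substT shiftN t))
      with (substT shiftN (substT s t)) by (rewrite !substT_comp; reflexivity).
    unfold upN at 1; simpl; constructor; auto.
  - replace (substT (upN s) (substT shiftN t))
      with (substT shiftN (substT s t)) by (rewrite !substT_comp; reflexivity).
    unfold upN at 1; simpl; constructor; auto.
Qed.

Definition mix {B : Type} (e c : nat -> B) (i : nat) : B :=
  if Nat.even i then e (Nat.div2 i) else c (Nat.div2 i).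

Lemma mix_even B (e c : nat -> B) i : mix e c (2 * i) = e i.
Proof. unfold mix; rewrite Nat.even_even, Nat.div2_double; reflexivity. Qed.

Lemma mix_odd B (e c : nat -> B) i : mix e c (S (2 * i)) = c i.
Proof.
  unfold mix; rewrite Nat.even_succ, Nat.odd_even, Nat.div2_succ_double.
  reflexivity.
Qed.

Lemma even_or_odd i : exists j, i = 2 * j \/ i = S (2 * j).
Proof.
  destruct (Nat.Even_or_Odd i) as [[j ->]|[j ->]]; exists j; lia.
Qed.

Section Definability.
Context {A : rca_model}.
Notation M := (num A).
Implicit Types (e c : nat -> M).

(* The even variables of the formula are the variables of the predicate, the
   odd ones its number parameters. *)
Definition isT (t : (nat -> M) -> M) : Prop :=
  exists u c, forall e, t e = eval (mix e c) u.

Definition D0 (P : (nat -> M) -> Prop) : Prop :=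
  exists p c r, Sigma00 p /\ forall e, P e <-> sat (mix e c) r p.

(** To put two formulas over the common parameter list [mix c c'], [left_var] moves parameter [j] to
    place [2 * j] and [right_var] moves it to [2 * j + 1]; both keep the variables of the
    predicate. *)
Definition left_var (i : nat) : term :=
  if Nat.even i then tVar i else tVar (S (2 * (2 * Nat.div2 i))).

Definition right_var (i : nat) : term :=
  if Nat.even i then tVar i else tVar (S (2 * (S (2 * Nat.div2 i)))).

Lemma eval_left_var e c c' :
  (fun i => eval (mix e (mix c c')) (left_var i)) = mix e c.
Proof.
  apply functional_extensionality; intro i; unfold left_var.
  destruct (Nat.even i) eqn:E; cbn [eval].
  - unfold mix; rewrite E; reflexivity.
  - rewrite mix_odd, mix_even; unfold mix; rewrite E; reflexivity.
Qed.

Lemma eval_right_var e c c' :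
  (fun i => eval (mix e (mix c c')) (right_var i)) = mix e c'.
Proof.
  apply functional_extensionality; intro i; unfold right_var.
  destruct (Nat.even i) eqn:E; cbn [eval].
  - unfold mix; rewrite E; reflexivity.
  - rewrite !mix_odd; unfold mix; rewrite E; reflexivity.
Qed.

Lemma mix_even_fun B (e c : nat -> B) : (fun i => mix e c (2 * i)) = e.
Proof. apply functional_extensionality; intro; apply mix_even. Qed.

Lemma mix_odd_fun B (e c : nat -> B) : (fun i => mix e c (S (2 * i))) = c.
Proof. apply functional_extensionality; intro; apply mix_odd. Qed.

Lemma isT_join t u : isT t -> isT u -> exists v w c,
  (forall e, t e = eval (mix e c) v) /\ (forall e, u e = eval (mix e c) w).
Proof.
  intros [v [c Hv]] [w [c' Hw]].
  exists (substT left_var v), (substT right_var w), (mix c c').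
  split; intro e; rewrite eval_subst, ?eval_left_var, ?eval_right_var; auto.
Qed.

Lemma isT_D0_join t P : isT t -> D0 P -> exists v p c r, Sigma00 p /\
  (forall e, t e = eval (mix e c) v) /\ (forall e, P e <-> sat (mix e c) r p).
Proof.
  intros [v [c Hv]] [p [c' [r [Hp Hs]]]].
  exists (substT left_var v), (subst right_var (fun X => X) p), (mix c c'), r.
  split; [apply Sigma00_subst, Hp|split; intro e].
  - rewrite eval_subst, eval_left_var; auto.
  - rewrite sat_subst, eval_right_var; apply Hs.
Qed.

Lemma D0_join P Q : D0 P -> D0 Q -> exists p q c r, Sigma00 p /\ Sigma00 q /\
  (forall e, P e <-> sat (mix e c) r p) /\
  (forall e, Q e <-> sat (mix e c) r q).
Proof.
  intros [p [c [r [Hp Hs]]]] [q [c' [r' [Hq Hs']]]].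
  exists (subst left_var (fun X => 2 * X) p),
    (subst right_var (fun X => S (2 * X)) q), (mix c c'), (mix r r').
  do 2 (split; [apply Sigma00_subst; assumption|]).
  split; intro e; rewrite sat_subst.
  - rewrite eval_left_var, mix_even_fun; apply Hs.
  - rewrite eval_right_var, mix_odd_fun; apply Hs'.
Qed.

Lemma isT_var i : isT (fun e => e i).
Proof.
  exists (tVar (2 * i)), (fun _ => sZero A); intro e; cbn [eval].
  rewrite mix_even; reflexivity.
Qed.

Lemma isT_const (x : M) : isT (fun _ => x).
Proof. exists (tVar 1), (fun _ => x); reflexivity. Qed.

Lemma isT_add t u : isT t -> isT u -> isT (fun e => sAdd (t e) (u e)).
Proof.
  intros Ht Hu; destruct (isT_join Ht Hu) as [v [w [c [H1 H2]]]].
  exists (tAdd v w), c; intro e; simpl; congruence.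
Qed.

Lemma isT_mul t u : isT t -> isT u -> isT (fun e => sMul (t e) (u e)).
Proof.
  intros Ht Hu; destruct (isT_join Ht Hu) as [v [w [c [H1 H2]]]].
  exists (tMul v w), c; intro e; simpl; congruence.
Qed.

Lemma isT_exp t u : isT t -> isT u -> isT (fun e => sExp (t e) (u e)).
Proof.
  intros Ht Hu; destruct (isT_join Ht Hu) as [v [w [c [H1 H2]]]].
  exists (tExp v w), c; intro e; simpl; congruence.
Qed.

Definition pairM (x y : M) : M := sAdd (sMul (sAdd x y) (sAdd x y)) x.

Lemma isT_pair t u : isT t -> isT u -> isT (fun e => pairM (t e) (u e)).
Proof. intros; unfold pairM; auto using isT_add, isT_mul. Qed.

Lemma isT_reindex t (s : nat -> nat) :
  isT t -> isT (fun e => t (fun i => e (s i))).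
Proof.
  intros [v [c Hv]].
  exists (substT (fun i => if Nat.even i then tVar (2 * s (Nat.div2 i))
                           else tVar i) v), c.
  intro e; rewrite Hv, eval_subst; f_equal.
  apply functional_extensionality; intro i.
  destruct (Nat.even i) eqn:E; cbn [eval]; rewrite ?mix_even;
    unfold mix; rewrite E; reflexivity.
Qed.

Lemma D0_ext P Q : D0 P -> (forall e, Q e <-> P e) -> D0 Q.
Proof.
  intros [p [c [r [Hp H]]]] HQ; exists p, c, r; split; [exact Hp|].
  intro e; rewrite HQ; apply H.
Qed.

Lemma D0_eq t u : isT t -> isT u -> D0 (fun e => t e = u e).
Proof.
  intros Ht Hu; destruct (isT_join Ht Hu) as [v [w [c [H1 H2]]]].
  exists (fEq v w), c, (fun _ => rca_set A); split; [constructor|].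
  intro e; simpl; rewrite <- H1, <- H2; reflexivity.
Qed.

Lemma D0_lt t u : isT t -> isT u -> D0 (fun e => sLt (t e) (u e)).
Proof.
  intros Ht Hu; destruct (isT_join Ht Hu) as [v [w [c [H1 H2]]]].
  exists (fLt v w), c, (fun _ => rca_set A); split; [constructor|].
  intro e; simpl; rewrite <- H1, <- H2; reflexivity.
Qed.

Lemma D0_mem t X : isT t -> D0 (fun e => sMem (t e) X).
Proof.
  intros [v [c H]].
  exists (fMem v 0), c, (fun _ => X); split; [constructor|].
  intro e; simpl; rewrite <- H; reflexivity.
Qed.

Lemma D0_False : D0 (fun _ => False).
Proof.
  exists fBot, (fun _ => sZero A), (fun _ => rca_set A); split; [constructor|].
  reflexivity.
Qed.

Lemma D0_imp P Q : D0 P -> D0 Q -> D0 (fun e => P e -> Q e).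
Proof.
  intros HP HQ; destruct (D0_join HP HQ) as [p [q [c [r [Hp [Hq [H1 H2]]]]]]].
  exists (fImp p q), c, r; split; [constructor; assumption|].
  intro e; simpl; rewrite <- H1, <- H2; reflexivity.
Qed.

Lemma D0_and P Q : D0 P -> D0 Q -> D0 (fun e => P e /\ Q e).
Proof.
  intros HP HQ; destruct (D0_join HP HQ) as [p [q [c [r [Hp [Hq [H1 H2]]]]]]].
  exists (fAnd p q), c, r; split; [constructor; assumption|].
  intro e; simpl; rewrite <- H1, <- H2; reflexivity.
Qed.

Lemma D0_or P Q : D0 P -> D0 Q -> D0 (fun e => P e \/ Q e).
Proof.
  intros HP HQ; destruct (D0_join HP HQ) as [p [q [c [r [Hp [Hq [H1 H2]]]]]]].
  exists (fOr p q), c, r; split; [constructor; assumption|].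
  intro e; simpl; rewrite <- H1, <- H2; reflexivity.
Qed.

Lemma D0_iff P Q : D0 P -> D0 Q -> D0 (fun e => P e <-> Q e).
Proof. intros HP HQ; apply D0_and; apply D0_imp; assumption. Qed.

(** A new quantifier shifts all indices by one, whereas in the interleaved numbering the even
    variables must move up by two and the parameters must stay. This renaming reconciles the two. *)
Definition quant_var (i : nat) : term :=
  match i with
  | O => tVar 0
  | S j => if Nat.even i then tVar j else tVar (S i)
  end.

Lemma eval_quant_var x e c :
  (fun i => eval (scons x (mix e c)) (quant_var i)) = mix (scons x e) c.
Proof.
  apply functional_extensionality; intro i.
  destruct (even_or_odd i) as [[|j] [-> | ->]]; try reflexivity.
  - replace (2 * S j) with (S (S (2 * j))) by lia; unfold quant_var.
    replace (Nat.even (S (S (2 * j)))) with true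
      by (symmetry; apply Nat.even_even).
    cbn [eval scons].
    replace (S (S (2 * j))) with (2 * S j) by lia; rewrite !mix_even.
    reflexivity.
  - unfold quant_var; rewrite Nat.even_succ, Nat.odd_even; cbn [eval scons].
    rewrite !mix_odd; reflexivity.
Qed.

Lemma D0_all t (Q : (nat -> M) -> M -> Prop) :
  isT t -> D0 (fun e => Q (fun i => e (S i)) (e 0)) ->
  D0 (fun e => forall x, sLt x (t e) -> Q e x).
Proof.
  intros Ht HQ; destruct (isT_D0_join Ht HQ) as [v [p [c [r [Hp [H1 H2]]]]]].
  exists (fAllN (fImp (fLt (tVar 0) (substT shiftN v))
                      (subst quant_var (fun X => X) p))), c, r.
  split; [constructor; apply Sigma00_subst, Hp|].
  intro e; simpl; split; intros H x; specialize (H x);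
    rewrite sat_subst, eval_quant_var, <- H2, eval_subst, H1 in *; exact H.
Qed.

Lemma D0_ex t (Q : (nat -> M) -> M -> Prop) :
  isT t -> D0 (fun e => Q (fun i => e (S i)) (e 0)) ->
  D0 (fun e => exists x, sLt x (t e) /\ Q e x).
Proof.
  intros Ht HQ; destruct (isT_D0_join Ht HQ) as [v [p [c [r [Hp [H1 H2]]]]]].
  exists (fExN (fAnd (fLt (tVar 0) (substT shiftN v))
                      (subst quant_var (fun X => X) p))), c, r.
  split; [constructor; apply Sigma00_subst, Hp|].
  intro e; simpl; split; intros [x H]; exists x;
    rewrite sat_subst, eval_quant_var, <- H2, eval_subst, H1 in *; exact H.
Qed.

(** Quantifying over terms rather than over variables lets a definable relation be applied to
    compound arguments without substituting into its formula. *)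
Definition D0_1 (P : M -> Prop) : Prop :=
  forall t, isT t -> D0 (fun e => P (t e)).
Definition D0_2 (P : M -> M -> Prop) : Prop :=
  forall t u, isT t -> isT u -> D0 (fun e => P (t e) (u e)).
Definition D0_3 (P : M -> M -> M -> Prop) : Prop :=
  forall t u v, isT t -> isT u -> isT v -> D0 (fun e => P (t e) (u e) (v e)).
Definition D0_4 (P : M -> M -> M -> M -> Prop) : Prop :=
  forall t u v w, isT t -> isT u -> isT v -> isT w ->
    D0 (fun e => P (t e) (u e) (v e) (w e)).

End Definability.

Create HintDb d0.

Ltac isT :=
  cbn beta;
  lazymatch goal with
  | H : isT ?t |- isT ?t => exact H
  | |- isT (fun e => e ?i) => exact (isT_var i)
  | |- isT (fun e => sAdd (@?t e) (@?u e)) => apply (@isT_add _ t u); isT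
  | |- isT (fun e => sMul (@?t e) (@?u e)) => apply (@isT_mul _ t u); isT
  | |- isT (fun e => sExp (@?t e) (@?u e)) => apply (@isT_exp _ t u); isT
  | |- isT (fun e => pairM (@?t e) (@?u e)) => apply (@isT_pair _ t u); isT
  | |- isT (fun _ => ?x) => exact (isT_const x)
  | |- isT (fun e => ?t (fun i => e (@?s i))) => apply (@isT_reindex _ t s); isT
  | |- isT (fun e => ?t e) => change (isT t); isT
  end.

(** The tactic follows the syntax of a predicate, and recognizes bounded quantifiers only in the
    shapes [forall x, x < t -> _] and [exists x, x < t /\ _]. Hence the many proofs that first pass
    through [D0_ext] to a predicate with explicit bounds. *)
Ltac d0 :=
  cbn beta;
  lazymatch goal with
  | |- D0_1 _ => let t := fresh "t" in intro t; intros; d0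
  | |- D0_2 _ => let t := fresh "t" in let u := fresh "u" in intros t u; intros; d0
  | |- D0_3 _ => let t := fresh "t" in let u := fresh "u" in
      let v := fresh "v" in intros t u v; intros; d0
  | |- D0_4 _ => let t := fresh "t" in let u := fresh "u" in
      let v := fresh "v" in let w := fresh "w" in intros t u v w; intros; d0
  | |- D0 (fun e => @?t e = @?u e) => apply (@D0_eq _ t u); isT
  | |- D0 (fun e => sLt (@?t e) (@?u e)) => apply (@D0_lt _ t u); isT
  | |- D0 (fun e => sMem (@?t e) ?X) => apply (@D0_mem _ t X); isT
  | |- D0 (fun e => False) => exact D0_False
  | |- D0 (fun e => ~ @?P e) => apply (@D0_imp _ P _); [d0|exact D0_False]
  | |- D0 (fun e => @?P e /\ @?Q e) => apply (@D0_and _ P Q); d0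
  | |- D0 (fun e => @?P e \/ @?Q e) => apply (@D0_or _ P Q); d0
  | |- D0 (fun e => @?P e <-> @?Q e) => apply (@D0_iff _ P Q); d0
  | |- D0 (fun e => forall x, sLt x (@?t e) -> @?Q e x) =>
      apply (@D0_all _ t Q); [isT|d0]
  | |- D0 (fun e => exists x, sLt x (@?t e) /\ @?Q e x) =>
      apply (@D0_ex _ t Q); [isT|d0]
  | |- D0 (fun e => @?P e -> @?Q e) => apply (@D0_imp _ P Q); d0
  | |- _ => d0_app
  end
with d0_app :=
  match goal with
  | |- D0 (fun e => ?R (@?a e) (@?b e) (@?c e) (@?d e)) =>
      let H := fresh in
      assert (H : D0_4 R) by (first [assumption|solve [auto with d0 nocore]]);
      apply (H a b c d); isT
  | |- D0 (fun e => ?R (@?a e) (@?b e) (@?c e)) =>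
      let H := fresh in
      assert (H : D0_3 R) by (first [assumption|solve [auto with d0 nocore]]);
      apply (H a b c); isT
  | |- D0 (fun e => ?R (@?a e) (@?b e)) =>
      let H := fresh in
      assert (H : D0_2 R) by (first [assumption|solve [auto with d0 nocore]]);
      apply (H a b); isT
  | |- D0 (fun e => ?R (@?a e)) =>
      let H := fresh in
      assert (H : D0_1 R) by (first [assumption|solve [auto with d0 nocore]]);
      apply (H a); isT
  end.

(** * Arithmetic in a model *)

Declare Scope m_scope.
Delimit Scope m_scope with M.
Notation "0" := (sZero _) : m_scope.
Notation "1" := (sOne _) : m_scope.
Notation "x + y" := (sAdd x y) : m_scope.
Notation "x * y" := (sMul x y) : m_scope.
Notation "x ^ y" := (sExp x y) : m_scope.
Notation "x < y" := (sLt x y) : m_scope.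
Notation "x <= y" := (sLt x y \/ x = y) : m_scope.

Section Arithmetic.
Context {A : rca_model}.
Notation M := (num A).
Implicit Types x y z u v w n k : M.
Local Open Scope m_scope.

Lemma induct (P : M -> Prop) :
  D0_1 P -> P 0 -> (forall x, P x -> P (x + 1)) -> forall x, P x.
Proof.
  intros HP H0 HS.
  destruct (HP _ (isT_var 0%nat)) as [p [c [r [Hp H]]]].
  (* Besides the induction variable, the even variables get the default value 0. *)
  pose (e := fun i => mix (fun _ => (0 : M)) c (S i)).
  assert (He : forall x, scons x e = mix (scons x (fun _ => 0)) c).
  { intro x; apply functional_extensionality; intros [|i]; [reflexivity|].
    cbn [scons]; unfold e, mix.
    destruct (Nat.even (S i)) eqn:E; [|reflexivity].
    destruct i; [discriminate|reflexivity]. }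
  assert (Hx : forall x, sat (scons x e) r p <-> P x).
  { intro x; rewrite He; symmetry; apply (H (scons x (fun _ => 0))). }
  pose proof (rca_models (ax_induction Hp) e r) as Hax.
  assert (H1 : forall x, sat (scons x e) r p); [|intro x; apply Hx, H1].
  simpl in Hax; apply Hax; split.
  - unfold instN; rewrite sat_subst.
    replace (fun i => _) with (scons 0 e); [apply Hx, H0|].
    apply functional_extensionality; intros [|i]; reflexivity.
  - intros x H1; rewrite sat_subst.
    replace (fun i => _) with (scons (x + 1) e); [apply Hx, HS, Hx, H1|].
    apply functional_extensionality; intros [|i]; reflexivity.
Qed.

Lemma comprehension (P : M -> Prop) (R Q : M -> M -> Prop) :
  D0_2 R -> D0_2 Q ->
  (forall x, P x <-> exists y, R x y) -> (forall x, P x <-> forall y, Q x y) ->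
  exists X, forall x, sMem x X <-> P x.
Proof.
  intros HR HQ HPR HPQ.
  destruct (D0_join (HR _ _ (isT_var 1%nat) (isT_var 0%nat))
    (HQ _ _ (isT_var 1%nat) (isT_var 0%nat)))
    as [p [q [c [r [Hp [Hq [H1 H2]]]]]]].
  (* Interleaving puts the witness at index 0 and the element at index 2, whereas the axiom expects
     them at 0 and 1; the rest lies behind these two binders. *)
  pose (s := fun i => match i with
    | O => tVar 0 | 2%nat => tVar 1 | _ => tVar (S (S i)) end).
  pose (e := mix (fun _ => (0 : M)) c).
  assert (He : forall x y, (fun i => eval (scons y (scons x e)) (s i)) =
    mix (scons y (scons x (fun _ => 0))) c).
  { intros x y; apply functional_extensionality.
    intros [|[|[|i]]]; try reflexivity; cbn [scons eval s]; unfold e, mix.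
    destruct (Nat.even (S (S (S i)))) eqn:E; [|reflexivity].
    destruct i; [discriminate|reflexivity]. }
  pose proof (rca_models (ax_comprehension
    (S01_ex (Sigma00_subst s (fun X => X) Hp))
    (P01_all (Sigma00_subst s (fun X => X) Hq))) e r) as Hax.
  cbn [comprehension_ax fIff sat] in Hax.
  assert (HR' : forall x, sat (scons x e) r
    (fExN (subst s (fun X => X) p)) <-> P x).
  { intro x; rewrite HPR; cbn [sat]; split; intros [y Hy]; exists y;
      rewrite sat_subst, He in *; apply (H1 (scons y (scons x (fun _ => 0)))) in Hy;
      exact Hy. }
  assert (HQ' : forall x, sat (scons x e) r
    (fAllN (subst s (fun X => X) q)) <-> P x).
  { intro x; rewrite HPQ; cbn [sat]; split; intros Hy y; specialize (Hy y);
      rewrite sat_subst, He in *; apply (H2 (scons y (scons x (fun _ => 0)))) in Hy;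
      exact Hy. }
  destruct Hax as [X HX].
  - intro x; split; intro H.
    + exact (proj2 (HQ' x) (proj1 (HR' x) H)).
    + exact (proj2 (HR' x) (proj1 (HQ' x) H)).
  - exists X; intro x; rewrite <- HR'; specialize (HX x).
    unfold liftS in HX; rewrite sat_subst in HX; exact HX.
Qed.

Lemma add0 x : x + 0 = x.
Proof. exact (rca_models ax_add0 (fun _ => x) (fun _ => rca_set A)). Qed.

Lemma addS x y : x + (y + 1) = x + y + 1.
Proof.
  exact (rca_models ax_addS (scons x (fun _ => y)) (fun _ => rca_set A)).
Qed.

Lemma mul0 x : x * 0 = 0.
Proof. exact (rca_models ax_mul0 (fun _ => x) (fun _ => rca_set A)). Qed.

Lemma mulS x y : x * (y + 1) = x * y + x.
Proof.
  exact (rca_models ax_mulS (scons x (fun _ => y)) (fun _ => rca_set A)).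
Qed.

Lemma exp0 x : x ^ 0 = 1.
Proof. exact (rca_models ax_exp0 (fun _ => x) (fun _ => rca_set A)). Qed.

Lemma expS x y : x ^ (y + 1) = x * x ^ y.
Proof.
  exact (rca_models ax_expS (scons x (fun _ => y)) (fun _ => rca_set A)).
Qed.

Lemma succ_neq0 x : x + 1 <> 0.
Proof. exact (rca_models ax_succ_ne0 (fun _ => x) (fun _ => rca_set A)). Qed.

Lemma succ_inj x y : x + 1 = y + 1 -> x = y.
Proof.
  exact (rca_models ax_succ_inj (scons x (fun _ => y)) (fun _ => rca_set A)).
Qed.

Lemma lt0 x : ~ x < 0.
Proof. exact (rca_models ax_lt0 (fun _ => x) (fun _ => rca_set A)). Qed.

Lemma ltS x y : x < y + 1 <-> x <= y.
Proof.
  exact (rca_models ax_ltS (scons x (fun _ => y)) (fun _ => rca_set A)).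
Qed.

Lemma add0l x : 0 + x = x.
Proof.
  revert x; apply induct; [d0|apply add0|].
  intros x IH; rewrite addS, IH; reflexivity.
Qed.

Lemma addSl x y : x + 1 + y = x + y + 1.
Proof.
  revert y; apply induct; [d0|rewrite !add0; reflexivity|].
  intros y IH; rewrite !addS, IH; reflexivity.
Qed.

Lemma addC x y : x + y = y + x.
Proof.
  revert y; apply induct; [d0|rewrite add0, add0l; reflexivity|].
  intros y IH; rewrite addS, addSl, IH; reflexivity.
Qed.

Lemma addA x y z : x + (y + z) = x + y + z.
Proof.
  revert z; apply induct; [d0|rewrite !add0; reflexivity|].
  intros z IH; rewrite !addS, IH; reflexivity.
Qed.

Lemma mul0l x : 0 * x = 0.
Proof.
  revert x; apply induct; [d0|apply mul0|].
  intros x IH; rewrite mulS, IH, add0; reflexivity.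
Qed.

Lemma mulSl x y : (x + 1) * y = x * y + y.
Proof.
  revert y; apply induct; [d0|rewrite !mul0, add0; reflexivity|].
  intros y IH; rewrite !mulS, IH, !addS; f_equal.
  rewrite <- !addA; f_equal; apply addC.
Qed.

Lemma mulC x y : x * y = y * x.
Proof.
  revert y; apply induct; [d0|rewrite mul0, mul0l; reflexivity|].
  intros y IH; rewrite mulS, mulSl, IH; reflexivity.
Qed.

Lemma mulDr x y z : x * (y + z) = x * y + x * z.
Proof.
  revert z; apply induct; [d0|rewrite mul0, !add0; reflexivity|].
  intros z IH; rewrite addS, !mulS, IH, addA; reflexivity.
Qed.

Lemma mulDl x y z : (x + y) * z = x * z + y * z.
Proof. rewrite mulC, mulDr, (mulC z x), (mulC z y); reflexivity. Qed.

Lemma mulA x y z : x * (y * z) = x * y * z.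
Proof.
  revert z; apply induct; [d0|rewrite !mul0; reflexivity|].
  intros z IH; rewrite !mulS, mulDr, IH; reflexivity.
Qed.

Lemma mul1l x : 1 * x = x.
Proof. rewrite <- (add0l 1), mulSl, mul0l, add0l; reflexivity. Qed.

Lemma m_semiring : @semi_ring_theory M 0 1 (@sAdd A) (@sMul A) eq.
Proof.
  constructor; intros;
    auto using add0l, addC, addA, mul1l, mul0l, mulC, mulA, mulDl.
Qed.

Add Ring m_ring : m_semiring.

Lemma addI x y z : x + z = y + z -> x = y.
Proof.
  revert z; apply (@induct (fun z => x + z = y + z -> x = y)); [d0| |].
  - rewrite !add0; auto.
  - intros z IH; rewrite !addS; intro H; apply IH, succ_inj, H.
Qed.

Lemma zero_or_succ x : x = 0 \/ exists y, y < x /\ x = y + 1.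
Proof.
  revert x; apply induct; [d0|auto|].
  intros x _; right; exists x; split; [apply ltS; auto|reflexivity].
Qed.

Lemma lt_add x d : x < x + d + 1.
Proof.
  revert d; apply induct; [d0| |].
  - rewrite add0; apply ltS; auto.
  - intros d IH; rewrite addS; apply ltS; auto.
Qed.

Lemma lt_iff x y : x < y <-> exists d, y = x + d + 1.
Proof.
  split; [|intros [d ->]; apply lt_add].
  (* The bound on [d] keeps the induction formula bounded. Extra bounds of this kind recur
     throughout. *)
  intro H; assert (H' : x < y -> exists d, d < y /\ y = x + d + 1).
  { clear H; revert y.
    apply (@induct (fun y => x < y -> exists d, d < y /\ y = x + d + 1));
      [d0|intro H; destruct (lt0 H)|].
    intros y IH H; apply ltS in H; destruct H as [H| ->].
    - destruct (IH H) as [d [Hd ->]]; exists (d + 1).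
      split; [|ring].
      replace (x + d + 1 + 1) with (d + 1 + x + 1) by ring; apply lt_add.
    - exists 0; split; [|ring].
      replace (y + 1) with (0 + y + 1) by ring; apply lt_add. }
  destruct (H' H) as [d [_ Hd]]; exists d; exact Hd.
Qed.

Lemma le_iff x y : x <= y <-> exists d, y = x + d.
Proof.
  rewrite <- ltS, lt_iff; split; intros [d Hd]; exists d;
    [apply succ_inj, Hd|rewrite Hd; reflexivity].
Qed.

Lemma lt_trichotomy x y : x < y \/ x = y \/ y < x.
Proof.
  revert y; apply induct; [d0| |].
  - destruct (zero_or_succ x) as [->|[z [_ ->]]]; [auto|right; right].
    replace (z + 1) with (0 + z + 1) by ring; apply lt_add.
  - intros y [H|[->|H]].
    + left; apply ltS; auto.
    + left; apply ltS; auto.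
    + apply lt_iff in H; destruct H as [d ->].
      destruct (zero_or_succ d) as [->|[z [_ ->]]].
      * right; left; ring.
      * right; right; replace (y + (z + 1) + 1) with (y + 1 + z + 1) by ring.
        apply lt_add.
Qed.

Lemma lt_irrefl x : ~ x < x.
Proof.
  rewrite lt_iff; intros [d Hd]; apply (@succ_neq0 d).
  apply (@addI _ _ x); rewrite add0l; rewrite Hd at 2; ring.
Qed.

End Arithmetic.

From HB Require Import structures.
From mathcomp Require Import ssreflect ssrfun ssrbool eqtype choice ssrnat.
From mathcomp Require Import order ssralg ssrnum lra.

(** * The ordered ring of differences, to which [lra] applies *)

Section Differences.
Context {A : rca_model}.
Notation M := (num A).
Implicit Types x y z u v : M.
Local Open Scope m_scope.

Add Ring m_ring : (@m_semiring A).

(** As a predicate of [u] and [v], this is the equivalence class of the pair, that is, the formal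
    difference of [x] and [y]. *)
Definition diff_rel x y u v : Prop := x + v = u + y.

Definition diff : Type :=
  {D : M -> M -> Prop | exists x y, D = diff_rel x y}.

Definition mkd x y : diff :=
  exist _ (diff_rel x y) (ex_intro _ x (ex_intro _ y Logic.eq_refl)).

Lemma mkd_eq x y u v : mkd x y = mkd u v <-> x + v = u + y.
Proof.
  split.
  - intro H; apply (f_equal (@proj1_sig _ _)) in H.
    apply (f_equal (fun D => D x y)) in H; cbn in H; unfold diff_rel in H.
    symmetry; rewrite <- H; reflexivity.
  - intro H; apply subset_eq_compat.
    apply functional_extensionality; intro a.
    apply functional_extensionality; intro b.
    apply propositional_extensionality; unfold diff_rel; split; intro E.
    + apply (@addI _ _ _ y); transitivity (u + y + b); [ring|].
      rewrite <- H; transitivity (x + b + v); [ring|rewrite E; ring].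
    + apply (@addI _ _ _ v); transitivity (x + v + b); [ring|].
      rewrite H; transitivity (u + b + y); [ring|rewrite E; ring].
Qed.

Lemma diff_surj (a : diff) : exists p : M * M, a = mkd (fst p) (snd p).
Proof.
  destruct a as [D [x [y H]]]; exists (x, y); apply subset_eq_compat, H.
Qed.

Definition reprd (a : diff) : M * M :=
  proj1_sig (constructive_indefinite_description _ (diff_surj a)).

Lemma reprdK a : mkd (fst (reprd a)) (snd (reprd a)) = a.
Proof.
  unfold reprd; destruct (constructive_indefinite_description _ _); auto.
Qed.

Lemma reprd_mkd x y : x + snd (reprd (mkd x y)) = fst (reprd (mkd x y)) + y.
Proof. apply mkd_eq; rewrite reprdK; reflexivity. Qed.

Lemma diff_ind (P : diff -> Prop) : (forall x y, P (mkd x y)) -> forall a, P a.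
Proof. intros H a; rewrite <- (reprdK a); apply H. Qed.

Definition addd (a b : diff) : diff :=
  mkd (fst (reprd a) + fst (reprd b)) (snd (reprd a) + snd (reprd b)).
Definition oppd (a : diff) : diff := mkd (snd (reprd a)) (fst (reprd a)).
Definition muld (a b : diff) : diff :=
  mkd (fst (reprd a) * fst (reprd b) + snd (reprd a) * snd (reprd b))
      (fst (reprd a) * snd (reprd b) + snd (reprd a) * fst (reprd b)).
Definition led (a b : diff) : Prop :=
  fst (reprd a) + snd (reprd b) <= fst (reprd b) + snd (reprd a).

Lemma addd_mk x y u v : addd (mkd x y) (mkd u v) = mkd (x + u) (y + v).
Proof.
  apply mkd_eq.
  pose proof (reprd_mkd x y) as H; pose proof (reprd_mkd u v) as H'.
  revert H H'; generalize (reprd (mkd x y)) (reprd (mkd u v)).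
  intros [a b] [c d]; simpl; intros H H'.
  transitivity ((a + y) + (c + v)); [ring|]; rewrite <- H, <- H'; ring.
Qed.

Lemma oppd_mk x y : oppd (mkd x y) = mkd y x.
Proof.
  apply mkd_eq; pose proof (reprd_mkd x y) as H; rewrite addC H; apply addC.
Qed.

Lemma muld_mk x y u v :
  muld (mkd x y) (mkd u v) = mkd (x * u + y * v) (x * v + y * u).
Proof.
  apply mkd_eq.
  pose proof (reprd_mkd x y) as H; pose proof (reprd_mkd u v) as H'.
  revert H H'; generalize (reprd (mkd x y)) (reprd (mkd u v)).
  intros [a b] [c d]; simpl; intros H H'.
  apply (@addI _ _ _ (y * c + x * d)).
  transitivity ((a + y) * c + (x + b) * d + x * v + y * u); [ring|].
  transitivity ((x + b) * c + (a + y) * d + x * v + y * u);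
    [rewrite H; ring|].
  transitivity (b * c + a * d + x * (c + v) + y * (u + d)); [ring|].
  rewrite <- H'.
  transitivity (b * c + a * d + x * (u + d) + y * (c + v));
    [rewrite H'|]; ring.
Qed.

Lemma led_mk x y u v : led (mkd x y) (mkd u v) <-> x + v <= u + y.
Proof.
  unfold led.
  pose proof (reprd_mkd x y) as H; pose proof (reprd_mkd u v) as H'.
  revert H H'; generalize (reprd (mkd x y)) (reprd (mkd u v)).
  intros [a b] [c d]; simpl; intros H H'.
  rewrite !le_iff; split; intros [e E]; exists e.
  - apply (@addI _ _ _ (a + d)).
    transitivity ((a + d + e) + (x + v)); [|ring].
    rewrite <- E; transitivity ((u + d) + (a + y)); [ring|].
    rewrite -H H'; ring.
  - apply (@addI _ _ _ (x + v)).
    transitivity ((x + v + e) + (a + d)); [|ring].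
    rewrite <- E; transitivity ((c + v) + (x + b)); [ring|].
    rewrite -H' H; ring.
Qed.

Definition decide (P : Prop) : bool :=
  if excluded_middle_informative P then true else false.

Lemma decideP P : reflect P (decide P).
Proof.
  by rewrite /decide; case: excluded_middle_informative => ?; constructor.
Qed.

Definition find_diff (P : pred diff) (_ : nat) : option diff :=
  match excluded_middle_informative (exists a, P a) with
  | left H => Some (proj1_sig (constructive_indefinite_description _ H))
  | right _ => None
  end.

Fact find_diff_correct (P : pred diff) n a : find_diff P n = Some a -> P a.
Proof.
  rewrite /find_diff; case: excluded_middle_informative => // H [<-].
  by case: constructive_indefinite_description.
Qed.

Fact find_diff_complete (P : pred diff) :
  (exists a, P a) -> exists n, find_diff P n.
Proof.
  by move=> H; exists 0%N; rewrite /find_diff; case: excluded_middle_informative.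
Qed.

Fact find_diff_ext (P Q : pred diff) : P =1 Q -> find_diff P =1 find_diff Q.
Proof. by move=> H n; have -> : P = Q by apply: functional_extensionality. Qed.

HB.instance Definition _ := hasDecEq.Build diff (fun a b => decideP (a = b)).
HB.instance Definition _ :=
  hasChoice.Build diff find_diff_correct find_diff_complete find_diff_ext.

Fact adddA : associative addd.
Proof.
  elim/diff_ind => x y; elim/diff_ind => u v; elim/diff_ind => z w.
  by rewrite !addd_mk; apply/mkd_eq; ring.
Qed.

Fact adddC : commutative addd.
Proof.
  elim/diff_ind => x y; elim/diff_ind => u v.
  by rewrite !addd_mk; apply/mkd_eq; ring.
Qed.

Fact add0d : left_id (mkd 0 0) addd.
Proof. by elim/diff_ind => x y; rewrite !addd_mk; apply/mkd_eq; ring. Qed.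

Fact addNd : left_inverse (mkd 0 0) oppd addd.
Proof.
  by elim/diff_ind => x y; rewrite oppd_mk !addd_mk; apply/mkd_eq; ring.
Qed.

HB.instance Definition _ := GRing.isZmodule.Build diff adddA adddC add0d addNd.

Fact muldA : associative muld.
Proof.
  elim/diff_ind => x y; elim/diff_ind => u v; elim/diff_ind => z w.
  by rewrite !muld_mk; apply/mkd_eq; ring.
Qed.

Fact muldC : commutative muld.
Proof.
  elim/diff_ind => x y; elim/diff_ind => u v.
  by rewrite !muld_mk; apply/mkd_eq; ring.
Qed.

Fact mul1d : left_id (mkd 1 0) muld.
Proof. by elim/diff_ind => x y; rewrite !muld_mk; apply/mkd_eq; ring. Qed.

Fact muldDl : left_distributive muld addd.
Proof.
  elim/diff_ind => x y; elim/diff_ind => u v; elim/diff_ind => z w.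
  by rewrite !(muld_mk, addd_mk); apply/mkd_eq; ring.
Qed.

Fact oned_neq0 : mkd 1 0 != mkd 0 0.
Proof.
  apply/eqP => /mkd_eq; rewrite !add0 => H.
  by apply: (@succ_neq0 A 0); rewrite add0l.
Qed.

HB.instance Definition _ :=
  GRing.Zmodule_isComNzRing.Build diff muldA muldC mul1d muldDl oned_neq0.

Definition unitd (a : diff) : bool := decide (exists b, b * a = 1)%R.

Definition invd (a : diff) : diff :=
  match excluded_middle_informative (exists b, b * a = 1)%R with
  | left H => proj1_sig (constructive_indefinite_description _ H)
  | right _ => a
  end.

Fact mulVd : {in unitd, left_inverse 1%R invd *%R}.
Proof.
  move=> a /decideP Ha; rewrite /invd.
  case: excluded_middle_informative => // H.
  by case: constructive_indefinite_description.
Qed.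

Fact unitdP a b : (b * a = 1)%R -> unitd a.
Proof. by move=> H; apply/decideP; exists b. Qed.

Fact invd_out : {in [predC unitd], invd =1 id}.
Proof.
  move=> a /decideP Ha; rewrite /invd.
  by case: excluded_middle_informative.
Qed.

HB.instance Definition _ :=
  GRing.ComNzRing_hasMulInverse.Build diff mulVd unitdP invd_out.

(** A nonzero difference is, up to sign, of the form [d + 1], and the product [(d + 1) * (f + 1)] is
    a successor, hence not 0. *)
Fact muld_eq0 (a b : diff) : (a * b = 0)%R -> (a == 0)%R || (b == 0)%R.
Proof.
  elim/diff_ind: a => x y; elim/diff_ind: b => u v.
  rewrite [(_ * _)%R]muld_mk => /mkd_eq; rewrite add0 add0l => H.
  have neq (d f : M) : (d + 1) * (f + 1) <> 0.
  { have -> : (d + 1) * (f + 1) = d * f + d + f + 1 by ring.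
    exact: succ_neq0. }
  have [/lt_iff[d Hd]|[->|/lt_iff[d Hd]]] := lt_trichotomy x y.
  2: by apply/orP; left; apply/eqP/mkd_eq; ring.
  all: have [/lt_iff[f Hf]|[->|/lt_iff[f Hf]]] := lt_trichotomy u v.
  all: try by apply/orP; right; apply/eqP/mkd_eq; ring.
  all: subst; case: (@neq d f).
  - apply: (@addI _ _ _ (x * (u + f + 1) + (x + d + 1) * u)).
    by rewrite add0l -{2}H; ring.
  - apply: (@addI _ _ _ (x * (v + f + 1) + (x + d + 1) * v)).
    by rewrite add0l {2}H; ring.
  - apply: (@addI _ _ _ ((y + d + 1) * u + y * (u + f + 1))).
    by rewrite add0l {2}H; ring.
  - apply: (@addI _ _ _ ((y + d + 1) * v + y * (v + f + 1))).
    by rewrite add0l -{2}H; ring.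
Qed.

HB.instance Definition _ := GRing.ComUnitRing_isIntegral.Build diff muld_eq0.

Lemma diff_zeroE : 0%R = mkd 0 0 :> diff.
Proof. by []. Qed.

Lemma led0 x y : led 0%R (mkd x y) <-> y <= x.
Proof. by rewrite diff_zeroE led_mk add0l add0. Qed.

Lemma ledr0 x y : led (mkd x y) 0%R <-> x <= y.
Proof. by rewrite diff_zeroE led_mk add0l add0. Qed.

Definition rle (a b : diff) : bool := decide (led a b).
Definition rlt (a b : diff) : bool := (b != a) && rle a b.
Definition normd (a : diff) : diff := if rle 0%R a then a else (- a)%R.

Fact led_add (a b : diff) : rle 0%R a -> rle 0%R b -> rle 0%R (a + b)%R.
Proof.
  elim/diff_ind: a => x y; elim/diff_ind: b => u v.
  move=> /decideP/led0/le_iff[d ->] /decideP/led0/le_iff[f ->].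
  apply/decideP; rewrite [(_ + _)%R]addd_mk; apply/led0/le_iff.
  by exists (d + f); ring.
Qed.

Fact led_mul (a b : diff) : rle 0%R a -> rle 0%R b -> rle 0%R (a * b)%R.
Proof.
  elim/diff_ind: a => x y; elim/diff_ind: b => u v.
  move=> /decideP/led0/le_iff[d ->] /decideP/led0/le_iff[f ->].
  apply/decideP; rewrite [(_ * _)%R]muld_mk; apply/led0/le_iff.
  by exists (d * f); ring.
Qed.

Lemma le_antisym x y : x <= y -> y <= x -> x = y.
Proof.
  move=> /le_iff[d ->] [/lt_iff[f Hf]|->//].
  case: (@succ_neq0 A (d + f)); apply: (@addI _ _ _ x).
  by rewrite add0l {2}Hf; ring.
Qed.

Fact led_anti (a : diff) : rle 0%R a -> rle a 0%R -> a = 0%R.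
Proof.
  elim/diff_ind: a => x y /decideP/led0 H1 /decideP/ledr0 H2.
  by apply/mkd_eq; rewrite add0 add0l; apply: le_antisym.
Qed.

Fact subd_ge0 (a b : diff) : rle 0%R (b - a)%R = rle a b.
Proof.
  elim/diff_ind: a => x y; elim/diff_ind: b => u v.
  have H : led 0%R (mkd u v - mkd x y)%R <-> led (mkd x y) (mkd u v).
  { rewrite [(- _)%R]oppd_mk [(_ + _)%R]addd_mk led0 led_mk.
    by rewrite (addC x v). }
  by apply/decideP/decideP => /H.
Qed.

Fact led_total (a : diff) : rle 0%R a || rle a 0%R.
Proof.
  elim/diff_ind: a => x y; apply/orP.
  have [H|[H|H]] := lt_trichotomy x y.
  - by right; apply/decideP/ledr0; left.
  - by right; apply/decideP/ledr0; right.
  - by left; apply/decideP/led0; left.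
Qed.

Fact normdN (a : diff) : normd (- a)%R = normd a.
Proof.
  have oppE : rle 0%R (- a)%R = rle a 0%R by rewrite -(subd_ge0 a) GRing.sub0r.
  rewrite /normd oppE GRing.opprK.
  case Ha: (rle a 0%R); case Hb: (rle 0%R a) => //.
  - by rewrite (led_anti Hb Ha) GRing.oppr0.
  - by have := led_total a; rewrite Ha Hb.
Qed.

Fact ged0_norm (a : diff) : rle 0%R a -> normd a = a.
Proof. by rewrite /normd => ->. Qed.

HB.instance Definition _ := Num.IntegralDomain_isLeReal.Build diff
  led_add led_mul led_anti subd_ge0 led_total normdN ged0_norm
  (fun a b : diff => Logic.eq_refl (rlt a b)).

Definition emb x : diff := mkd x 0.

Lemma emb_add x y : emb (x + y) = (emb x + emb y)%R.
Proof. by rewrite [RHS]addd_mk add0. Qed.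

Lemma emb_mul x y : emb (x * y) = (emb x * emb y)%R.
Proof. by rewrite [RHS]muld_mk; apply/mkd_eq; ring. Qed.

Lemma emb0 : emb 0 = 0%R.
Proof. by []. Qed.

Lemma emb1 : emb 1 = 1%R.
Proof. by []. Qed.

Lemma emb_eq x y : x = y <-> emb x = emb y.
Proof. by split=> [->//|/mkd_eq]; rewrite !add0. Qed.

Lemma emb_le x y : x <= y <-> (emb x <= emb y)%R.
Proof.
  have H : led (emb x) (emb y) <-> x <= y by rewrite led_mk !add0.
  by rewrite -H; split=> /decideP.
Qed.

Lemma emb_ge0 x : (0 <= emb x)%R.
Proof. by apply/(emb_le 0)/le_iff; exists x; rewrite add0l. Qed.

Lemma emb_lt x y : x < y <-> (emb x + 1 <= emb y)%R.
Proof.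
  rewrite -emb1 -emb_add -emb_le lt_iff le_iff.
  by split=> -[d ->]; exists d; ring.
Qed.

Lemma emb_nle x y : ~ (x <= y) <-> (emb y + 1 <= emb x)%R.
Proof.
  rewrite -emb_lt; split=> [H|/emb_lt H /emb_le]; last by move: H; lra.
  by have [?|[?|//]] := lt_trichotomy x y; case: H; auto.
Qed.

Lemma emb_nlt x y : ~ (x < y) <-> (emb y <= emb x)%R.
Proof.
  rewrite -emb_le; split=> [H|/emb_le H /emb_lt]; last by move: H; lra.
  by have [?|[->|?]] := lt_trichotomy x y; auto.
Qed.

End Differences.

Ltac emb_nonneg :=
  repeat match goal with
  | |- context [@emb ?A ?x] =>
      lazymatch goal with
      | H : is_true (0 <= @emb A x)%R |- _ => fail
      | _ => pose proof (@emb_ge0 A x)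
      end
  | _ : context [@emb ?A ?x] |- _ =>
      lazymatch goal with
      | H : is_true (0 <= @emb A x)%R |- _ => fail
      | _ => pose proof (@emb_ge0 A x)
      end
  end.

(* [emb_lt] turns [x < y] into [emb x + 1 <= emb y], which makes the
   discreteness of the model available to [lra]. *)
Ltac m_lra :=
  intros;
  repeat match goal with
  | H : _ /\ _ |- _ => destruct H
  | H : @sLt _ _ _ \/ @eq (num _) _ _ |- _ => apply emb_le in H
  | H : @sLt _ _ _ |- _ => apply emb_lt in H
  | H : @eq (num _) _ _ |- _ => apply emb_eq in H
  | H : ~ (@sLt _ _ _ \/ @eq (num _) _ _) |- _ => apply emb_nle in H
  | H : ~ @sLt _ _ _ |- _ => apply emb_nlt in H
  end;
  repeat match goal with |- _ /\ _ => split end;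
  lazymatch goal with
  | |- @sLt _ _ _ \/ @eq (num _) _ _ => apply emb_le
  | |- @sLt _ _ _ => apply emb_lt
  | |- @eq (num _) _ _ => apply emb_eq
  | |- ~ (@sLt _ _ _ \/ @eq (num _) _ _) => apply emb_nle
  | |- ~ @sLt _ _ _ => apply emb_nlt
  | |- _ => exfalso
  end;
  repeat match goal with
  | H : context [emb (sAdd ?x ?y)] |- _ => rewrite (emb_add x y) in H
  | H : context [emb (sMul ?x ?y)] |- _ => rewrite (emb_mul x y) in H
  | H : context [@emb ?A (sZero _)] |- _ => rewrite (@emb0 A) in H
  | H : context [@emb ?A (sOne _)] |- _ => rewrite (@emb1 A) in H
  | |- context [emb (sAdd ?x ?y)] => rewrite (emb_add x y)
  | |- context [emb (sMul ?x ?y)] => rewrite (emb_mul x y)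
  | |- context [@emb ?A (sZero _)] => rewrite (@emb0 A)
  | |- context [@emb ?A (sOne _)] => rewrite (@emb1 A)
  end;
  emb_nonneg; lra.

(** * Finite sets of numbers *)

Notation "2" := (sAdd (sOne _) (sOne _)) : m_scope.

Section Coding.
Context {A : rca_model}.
Notation M := (num A).
Implicit Types a b c d i j k l m n p q r s t u v w x y z : M.
Local Open Scope m_scope.

Add Ring m_ring2 : (@m_semiring A).

Lemma ge0 x : 0 <= x.
Proof. by apply/emb_le; exact: emb_ge0. Qed.

Lemma le_or_lt x y : x <= y \/ y < x.
Proof. by have [|[|]] := lt_trichotomy x y; auto. Qed.

Lemma mul_le x y z : x <= y -> x * z <= y * z.
Proof. by move=> /le_iff[d ->]; apply/le_iff; exists (d * z); ring. Qed.

Lemma least_number (P : M -> Prop) : D0_1 P -> (exists x, P x) ->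
  exists x, P x /\ forall y, y < x -> ~ P y.
Proof.
  move=> HP [x Px]; apply: NNPP => H.
  have Hx : x < x + 1 by m_lra.
  suff Hb : forall b, forall y, y < b -> ~ P y by exact: (Hb _ _ Hx Px).
  apply: induct; first by d0.
  - by move=> y /lt0.
  - move=> b IH y /ltS[/IH//|->] Pb; by apply: H; exists b.
Qed.

(** The least strict upper bound is a successor, since some element lies below it. Its predecessor
    satisfies [P], as otherwise it would itself be a strict upper bound. *)
Lemma greatest_number (P : M -> Prop) b : D0_1 P -> (exists x, P x) ->
  (forall x, P x -> x < b) -> exists x, P x /\ forall y, P y -> y <= x.
Proof.
  move=> HP [x Px] Hb.
  have [||z [Hz Hmin]] := @least_number
    (fun z => forall x, x < b -> P x -> x < z); first by d0.
  - by exists b => y _ /Hb.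
  - have [z0|[z' [_ zE]]] := zero_or_succ z.
    + by case: (@lt0 A x); rewrite -z0; apply: Hz; auto.
    + exists z'; split; last by move=> y Py; apply/ltS; rewrite -zE; auto.
      apply: NNPP => Pz'; apply: (Hmin z'); first by m_lra.
      move=> y yb Py.
      have yz : y <= z' by apply/ltS; rewrite -zE; auto.
      by case: yz => // yE; case: Pz'; rewrite -yE.
Qed.

Lemma pow2_succ x : 2 ^ (x + 1) = 2 ^ x + 2 ^ x.
Proof. by rewrite expS; ring. Qed.

Lemma pow2_pos x : 0 < 2 ^ x.
Proof.
  move: x; apply: induct; first by d0.
  - by rewrite exp0; m_lra.
  - by move=> x IH; rewrite pow2_succ; m_lra.
Qed.

Lemma pow2_add x y : 2 ^ (x + y) = 2 ^ x * 2 ^ y.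
Proof.
  move: y; apply: induct; first by d0.
  - by rewrite add0 exp0; ring.
  - by move=> y IH; rewrite addS !pow2_succ IH; ring.
Qed.

Lemma pow2_le x y : x <= y -> 2 ^ x <= 2 ^ y.
Proof.
  move=> /le_iff[d ->]; rewrite pow2_add.
  have := @mul_le 1 (2 ^ d) (2 ^ x); rewrite mul1l (mulC (2 ^ d)); apply.
  by have := pow2_pos d; m_lra.
Qed.

Lemma pow2_lt x y : x < y -> 2 ^ x + 2 ^ x <= 2 ^ y.
Proof. by rewrite -pow2_succ => H; apply: pow2_le; m_lra. Qed.

Lemma lt_pow2 x : x < 2 ^ x.
Proof.
  move: x; apply: induct; first by d0.
  - exact: pow2_pos.
  - by move=> x IH; rewrite pow2_succ; m_lra.
Qed.

Lemma pow2_lt_inv x y : 2 ^ x < 2 ^ y -> x < y.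
Proof.
  move=> H; have [/pow2_le|//] := le_or_lt y x; m_lra.
Qed.

Definition bit x s : Prop :=
  exists q r, r < 2 ^ x /\ s = q * 2 ^ (x + 1) + 2 ^ x + r.

Lemma bit_le x s : bit x s -> 2 ^ x <= s.
Proof. by move=> [q [r [Hr ->]]]; have := ge0 (q * 2 ^ (x + 1)); m_lra. Qed.

Lemma bit_lt x s : bit x s -> x < s.
Proof. by move=> /bit_le; have := lt_pow2 x; m_lra. Qed.

Lemma D0_bit : D0_2 bit.
Proof.
  move=> t u Ht Hu.
  apply: (@D0_ext _ (fun e => exists q, q < u e + 1 /\ exists r, r < u e + 1 /\
    (r < 2 ^ t e /\ u e = q * 2 ^ (t e + 1) + 2 ^ t e + r))); first by d0.
  move=> e; split; last by move=> [q [_ [r [_ H]]]]; exists q, r.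
  move=> [q [r [H E]]]; exists q; split.
  - have := @mul_le 1 (2 ^ (t e + 1)) q; have := pow2_pos (t e + 1).
    rewrite E (mulC q) mul1l => Hp H1.
    have {H1} : q <= 2 ^ (t e + 1) * q by apply: H1; m_lra.
    by m_lra.
  - by exists r; do !split=> //; have := ge0 (q * 2 ^ (t e + 1)); m_lra.
Qed.

Hint Resolve D0_bit : d0.

Lemma bit0 x : ~ bit x 0.
Proof. by move=> /bit_le; have := pow2_pos x; m_lra. Qed.

(** For [x < b], the number [2 ^ b] is a multiple of [2 ^ (x + 1)], so that adding it changes only
    the quotient in the definition of [bit]. *)
Lemma bit_top b s x : s < 2 ^ b -> bit x (2 ^ b + s) <-> x = b \/ bit x s.
Proof.
  move=> Hs; have [bx|[bx|xb]] := lt_trichotomy b x.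
  - have := pow2_lt bx => H; split=> [/bit_le|]; first by m_lra.
    by case=> [E|/bit_le]; m_lra.
  - by subst x; split=> [|_]; [left|exists 0, s; split=> //; ring].
  - have /lt_iff[d bE] := xb.
    have bE' : 2 ^ b = 2 ^ d * 2 ^ (x + 1).
    { rewrite bE -pow2_add; congr (2 ^ _); ring. }
    split.
    + move=> [q [r [Hr E]]]; right.
      have [/le_iff[f qE]|Hq] := le_or_lt (2 ^ d) q.
      * exists f, r; split=> //; move: E; rewrite qE mulDl -bE'; m_lra.
      * have : q + 1 <= 2 ^ d by m_lra.
        move=> /(@mul_le _ _ (2 ^ (x + 1))); rewrite -bE' mulDl mul1l.
        by have := pow2_succ x; have := ge0 s; m_lra.
    + case=> [E|[q [r [Hr E]]]]; first by m_lra.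
      by exists (q + 2 ^ d), r; split=> //; rewrite mulDl -bE' E; ring.
Qed.

Lemma bit_lt_pow2 b s x : s < 2 ^ b -> bit x s -> x < b.
Proof. by move=> Hs /bit_le Hx; apply: pow2_lt_inv; m_lra. Qed.

Lemma lt_pow2_split b s : s < 2 ^ (b + 1) ->
  s < 2 ^ b \/ exists s', s' < 2 ^ b /\ s = 2 ^ b + s'.
Proof.
  rewrite pow2_succ => H; have [/le_iff[s' E]|] := le_or_lt (2 ^ b) s; auto.
  by right; exists s'; split=> //; m_lra.
Qed.

(** The induction strips the top digit; with [s] and [t] below [2 ^ b] its formula is bounded. The
    comparison of ordinals rests on this: removing elements from a set lowers its code. *)
Lemma bits_le_below b : forall s, s < 2 ^ b -> forall t, t < 2 ^ b ->
  (forall x, x < b -> bit x s -> bit x t) -> s <= t.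
Proof.
  move: b; apply: induct; first by d0.
  - by rewrite exp0 => s Hs t Ht _; m_lra.
  - move=> b IH s Hs t Ht H.
    have bb : b < b + 1 by m_lra.
    have [Hs'|[s' [Hs' sE]]] := lt_pow2_split Hs;
    have [Ht'|[t' [Ht' tE]]] := lt_pow2_split Ht.
    + by apply: IH => // x xb; apply: H; m_lra.
    + by m_lra.
    + have /(bit_lt_pow2 Ht') : bit b t.
      { by apply: H => //; rewrite sE; apply/bit_top; auto. }
      by m_lra.
    + have : s' <= t'; last by m_lra.
      apply: IH => // x xb xs.
      have : bit x t.
      { by apply: H; [m_lra|rewrite sE; apply/bit_top; auto]. }
      by rewrite tE => /(bit_top _ Ht')[E|//]; m_lra.
Qed.

Lemma bits_le s t : (forall x, bit x s -> bit x t) -> s <= t.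
Proof.
  move=> H; apply: (@bits_le_below (s + t)); last by move=> x _; apply: H.
  - by have := lt_pow2 (s + t); have := ge0 t; m_lra.
  - by have := lt_pow2 (s + t); have := ge0 s; m_lra.
Qed.

Lemma bits_eq s t : (forall x, bit x s <-> bit x t) -> s = t.
Proof. by move=> H; apply: le_antisym; apply: bits_le => x /H. Qed.

Lemma bits_lt s t x :
  (forall x, bit x s -> bit x t) -> bit x t -> ~ bit x s -> s < t.
Proof. by move=> /bits_le[//|->]. Qed.

(** The code is built digit by digit, and the bound [2 ^ b] keeps the induction bounded. This is
    where exponentiation is essential; all finite objects below arise in this way. *)
Lemma bounded_comprehension (P : M -> Prop) b : D0_1 P ->
  exists s, s < 2 ^ b /\ forall x, bit x s <-> x < b /\ P x.
Proof.
  move=> HP; have [s [Hs H]] : exists s, s < 2 ^ b /\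
      forall x, x < b -> (bit x s <-> P x); last first.
  { exists s; split=> // x; split=> [xs|[xb]]; last by move/H: xb => ->.
    have xb := bit_lt_pow2 Hs xs; split=> //.
    by apply/H. }
  move: b; apply: induct; first by d0.
  - by exists 0; split=> [|x /lt0//]; rewrite exp0; m_lra.
  - move=> b [s [Hs H]]; have [Pb|nPb] := classic (P b).
    + exists (2 ^ b + s); split; first by rewrite pow2_succ; m_lra.
      move=> x /ltS xb; rewrite (bit_top _ Hs).
      case: xb => [xb|->]; last by tauto.
      by rewrite H //; split; auto => -[E|//]; m_lra.
    + exists s; split; first by rewrite pow2_succ; m_lra.
      move=> x /ltS[/H//|->]; split=> [|//] /(bit_lt_pow2 Hs); m_lra.
Qed.

Lemma bits_bound s b : (forall x, bit x s -> x < b) -> s < 2 ^ b.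
Proof.
  move=> H; have [|t [Ht HB]] := @bounded_comprehension (fun x => bit x s) b.
  { by d0. }
  suff -> : s = t by [].
  by apply: bits_eq => x; rewrite HB; split=> [Hx|[]//]; split; auto.
Qed.

End Coding.
#[export] Hint Resolve D0_bit : d0.

(** * Finite sequences, functions and bounding *)

Section Sequences.
Context {A : rca_model}.
Notation M := (num A).
Implicit Types a b c d i j k l m n p q r s t u v w x y z : M.
Implicit Types F X : nset A.
Local Open Scope m_scope.

Add Ring m_ring3 : (@m_semiring A).

(** For [S = x + y], the code lies between [S * S] and [S * S + S], and these intervals are disjoint
    for different [S]. *)
Lemma pair_inj x y u v : pairM x y = pairM u v -> x = u /\ y = v.
Proof.
  have H : forall x y u v, x + y < u + v -> pairM x y = pairM u v -> False.
  { move=> {}x {}y {}u {}v /lt_iff[d dE]; rewrite /pairM dE.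
    have := ge0 ((x + y) * d); have := ge0 (d * d); have := ge0 y; m_lra. }
  move=> E; have [/H|[S|/H]] := lt_trichotomy (x + y) (u + v); try by case.
  have xu : x = u by move: E; rewrite /pairM S; m_lra.
  by split=> //; move: S; m_lra.
Qed.

Lemma sq_ge x : x <= x * x.
Proof.
  have [->|[y [_ ->]]] := zero_or_succ x; first by m_lra.
  by have := ge0 (y * y); m_lra.
Qed.

Lemma pair_ge x y : x + y <= pairM x y.
Proof. by rewrite /pairM; have := sq_ge (x + y); have := ge0 x; m_lra. Qed.

Lemma pair_gel x y : x <= pairM x y.
Proof. by have := pair_ge x y; m_lra. Qed.

Lemma pair_ger x y : y <= pairM x y.
Proof. by have := pair_ge x y; m_lra. Qed.

Lemma pair_le x y u v : x <= u -> y <= v -> pairM x y <= pairM u v.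
Proof.
  move=> /le_iff[d ->] /le_iff[f ->]; rewrite /pairM.
  have := ge0 ((x + y) * (d + f)); have := ge0 ((d + f) * (d + f)); m_lra.
Qed.

Lemma pair_lt x y u v : x < u -> y <= v -> pairM x y < pairM u v.
Proof.
  move=> xu yv; have : x + 1 <= u by m_lra.
  move=> /pair_le /(_ yv).
  by rewrite /pairM; have := ge0 x; have := ge0 y; m_lra.
Qed.

Definition ex_unique (P : M -> Prop) : Prop :=
  (exists x, P x) /\ (forall x y, P x -> P y -> x = y).

Definition fin_seqM l s : Prop :=
  (forall z, bit z s -> exists k x, k < l /\ z = pairM k x) /\
  (forall k, k < l -> ex_unique (fun x => bit (pairM k x) s)).

Lemma app_lt k x s : bit (pairM k x) s -> k < s /\ x < s.
Proof.
  by move=> /bit_lt; have := pair_gel k x; have := pair_ger k x; m_lra.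
Qed.

Lemma fin_seq_dom l s k x : fin_seqM l s -> bit (pairM k x) s -> k < l.
Proof. by move=> [H _] /H[k' [x' [kl /pair_inj[-> _]]]]. Qed.

Lemma fin_seq_fun l s k x y :
  fin_seqM l s -> bit (pairM k x) s -> bit (pairM k y) s -> x = y.
Proof.
  by move=> H Hx; have [_ U] := proj2 H k (fin_seq_dom H Hx); apply: U.
Qed.

Lemma fin_seq_total l s k : fin_seqM l s -> k < l ->
  exists x, bit (pairM k x) s.
Proof. by move=> [_ H] /H[]. Qed.

Lemma D0_fin_seq : D0_2 fin_seqM.
Proof.
  move=> t u Ht Hu; apply: (@D0_ext _ (fun e =>
    (forall z, z < u e -> bit z (u e) -> exists k, k < z + 1 /\
       exists x, x < z + 1 /\ (k < t e /\ z = pairM k x)) /\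
    (forall k, k < t e -> (exists x, x < u e /\ bit (pairM k x) (u e)) /\
       (forall x, x < u e -> forall y, y < u e ->
          bit (pairM k x) (u e) -> bit (pairM k y) (u e) -> x = y))));
    first by d0.
  move=> e; split=> -[H1 H2]; split.
  - move=> z _ /H1[k [x [Hk ->]]]; exists k.
    split; first by have := pair_gel k x; m_lra.
    by exists x; split=> //; have := pair_ger k x; m_lra.
  - move=> k /H2[[x Hx] U]; split; last by move=> y _ z _; apply: U.
    by exists x; split=> //; have := app_lt Hx; m_lra.
  - by move=> z Hz; have [k [_ [x [_ H]]]] := H1 z (bit_lt Hz) Hz; exists k, x.
  - move=> k /H2[[x [_ Hx]] U]; split; first by exists x.
    move=> y z Hy Hz; apply: U => //.
    + by have := app_lt Hy; m_lra.
    + by have := app_lt Hz; m_lra.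
Qed.

Hint Resolve D0_fin_seq : d0.

Lemma fin_set_of_pairs (R : M -> M -> Prop) l b : D0_2 R ->
  exists s, s < 2 ^ pairM l b /\
    (forall z, bit z s -> exists k x, k < l /\ z = pairM k x) /\
    forall k x, bit (pairM k x) s <-> k < l /\ x < b /\ R k x.
Proof.
  move=> HR.
  have [|s [Hs H]] := @bounded_comprehension _
    (fun z => exists k, k < l /\ exists x, x < b /\ (z = pairM k x /\ R k x))
    (pairM l b); first by d0.
  exists s; split=> //; split.
  - by move=> z /H[_ [k [Hk [x [_ [-> _]]]]]]; exists k, x.
  - move=> k x; rewrite H; split.
    + by move=> [_ [k' [Hk [x' [Hx [/pair_inj[-> ->] HR']]]]]].
    + move=> [Hk [Hx HR']]; split; first by apply: pair_lt; m_lra.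
      by exists k; split=> //; exists x.
Qed.

Lemma fin_seq_intro (R : M -> M -> Prop) l b : D0_2 R ->
  (forall k, k < l -> exists x, x < b /\ R k x) ->
  (forall k x y, k < l -> R k x -> R k y -> x = y) ->
  exists s, s < 2 ^ pairM l b /\ fin_seqM l s /\
    forall k x, bit (pairM k x) s <-> k < l /\ R k x.
Proof.
  move=> HR Htot Hun; have [s [Hs [H1 H2]]] := fin_set_of_pairs l b HR.
  have H3 : forall k x, bit (pairM k x) s <-> k < l /\ R k x.
  { move=> k x; rewrite H2; split=> [[? []]//|[Hk Hx]].
    have [y [yb Hy]] := Htot k Hk.
    by split=> //; split=> //; rewrite (Hun k x y). }
  exists s; split=> //; split=> //; split=> // k Hk; split.
  - by have [x [Hx HRx]] := Htot k Hk; exists x; apply/H3.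
  - by move=> x y /H3[_ Hx] /H3[_ Hy]; apply: (Hun k).
Qed.

(* Were the least witnesses unbounded below [n], there would be arbitrarily
   late indices at which they exceed all previous ones; the set of these
   indices is Delta^0_1, so it has a greatest element below [n]. *)
Lemma bounding (R : M -> M -> Prop) n : D0_2 R ->
  (forall i, i < n -> exists j, R i j) ->
  exists b, forall i, i < n -> exists j, j < b /\ R i j.
Proof.
  move=> HR Htot.
  pose least i y := R i y /\ forall y', y' < y -> ~ R i y'.
  have HD : D0_2 least by rewrite /least; d0.
  have leastE : forall i, i < n -> exists y, least i y.
  { move=> i /Htot; apply: least_number; d0. }
  have least_fun : forall i y z, least i y -> least i z -> y = z.
  { move=> i y z [Ry Hy] [Rz Hz].
    by have [/Hz//|[//|/Hy//]] := lt_trichotomy y z. }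
  pose record i y := forall i', i' < i -> exists y', y' < y /\ R i' y'.
  have HDr : D0_2 record by rewrite /record; d0.
  have [||||X HX] := @comprehension _
    (fun i => exists y, i < n /\ (least i y /\ record i y))
    (fun i y => i < n /\ (least i y /\ record i y))
    (fun i y => i < n /\ (least i y -> record i y)).
  1, 2: by d0.
  1: by [].
  { move=> i; split.
    - move=> [y [Hi [Hy Hr]]] z; split=> // Hz.
      by rewrite (least_fun i z y).
    - move=> H; have Hi := proj1 (H 0).
      have [y Hy] := leastE i Hi; exists y; do !split=> //; try apply Hy.
      by apply: (proj2 (H y)). }
  have [n0|npos] := le_or_lt n 0.
  { by exists 0 => i Hi; m_lra. }
  have [|||m [Hm Hmax]] := @greatest_number _ (fun i => sMem i X) n; first by d0.
  { exists 0; apply/HX; have [y Hy] := leastE 0 npos; exists y.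
    by split=> //; split=> // i /lt0. }
  { by move=> i /HX[y []]. }
  have /HX[y [Hmn [Hy Hr]]] := Hm.
  exists (y + 1); apply: NNPP => Hn.
  have [||i [Hi Himin]] := @least_number _
    (fun i => i < n /\ forall j, j < y + 1 -> ~ R i j); first by d0.
  { apply: NNPP => Hn'; apply: Hn => i Hi; apply: NNPP => Hn.
    by apply: Hn'; exists i; split=> // j Hj HRj; apply: Hn; exists j. }
  case: Hi => Hi HRi.
  have [z Hz] := leastE i Hi.
  have Hyz : y < z.
  { have [zy|//] := le_or_lt z y; case: (HRi z); first by m_lra.
    exact: (proj1 Hz). }
  have iX : sMem i X.
  { apply/HX; exists z; do !split=> //; try apply Hz.
    move=> i' Hi'; apply: NNPP => Hn'; apply: (Himin i' Hi').
    split; first by m_lra.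
    by move=> j Hj HRj; apply: Hn'; exists j; split=> //; m_lra. }
  case: (Hmax _ iX) => [im|im].
  - have [j [Hj HRj]] := Hr i im.
    by apply: (HRi j) => //; m_lra.
  - by case: (HRi y); [m_lra|rewrite im; case: Hy].
Qed.

Definition is_funM F : Prop :=
  (forall z, sMem z F -> exists x y, z = pairM x y) /\
  (forall x, ex_unique (fun y => sMem (pairM x y) F)).

Lemma fun_unique F x y z : is_funM F ->
  sMem (pairM x y) F -> sMem (pairM x z) F -> y = z.
Proof. by move=> [_ H]; case: (H x) => _; apply. Qed.

Lemma fun_total F x : is_funM F -> exists y, sMem (pairM x y) F.
Proof. by move=> [_ H]; case: (H x). Qed.

Lemma fun_bound F n : is_funM F ->
  exists b, forall i y, i < n -> sMem (pairM i y) F -> y < b.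
Proof.
  move=> HF.
  have [||b Hb] := @bounding (fun i y => sMem (pairM i y) F) n; first by d0.
  - by move=> i _; apply: fun_total.
  - exists b => i y /Hb[z [zb Hz]] Hy.
    by rewrite (fun_unique HF Hy Hz).
Qed.

(** Choice for Sigma^0_1 relations, with [y] the unbounded witness. Taking the least code of a pair
    of [s] and [y] makes the choice unique, so that the graph is Delta^0_1: the condition may be
    asked of some least code or of every one. *)
Lemma function_choice (R : M -> M -> M -> Prop) : D0_3 R ->
  (forall n, exists s y, R n s y) ->
  exists F, is_funM F /\ forall n s, sMem (pairM n s) F -> exists y, R n s y.
Proof.
  move=> HR Htot.
  pose W n w := exists s, s < w + 1 /\ exists y, y < w + 1 /\
    (w = pairM s y /\ R n s y).
  have HW : D0_2 W by rewrite /W; d0.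
  pose least n w := W n w /\ forall w', w' < w -> ~ W n w'.
  have HD : D0_2 least by rewrite /least; d0.
  have leastE : forall n, exists w, least n w.
  { move=> n; apply: least_number; first by d0.
    have [s [y HR']] := Htot n; exists (pairM s y), s.
    split; first by have := pair_gel s y; m_lra.
    by exists y; split=> //; have := pair_ger s y; m_lra. }
  have least_fun : forall n w w', least n w -> least n w' -> w = w'.
  { move=> n y z [Ry Hy] [Rz Hz].
    by have [/Hz//|[//|/Hy//]] := lt_trichotomy y z. }
  have least_pair : forall n w, least n w ->
    exists s y, w = pairM s y /\ R n s y.
  { by move=> n w [[s [_ [y [_ H]]]] _]; exists s, y. }
  have [||||F HF] := @comprehension _
    (fun z => exists n s y, z = pairM n s /\ least n (pairM s y))
    (fun z w => exists n, n < z + 1 /\ exists s, s < z + 1 /\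
       (z = pairM n s /\ (least n w /\ exists y, y < w + 1 /\ w = pairM s y)))
    (fun z w => exists n, n < z + 1 /\ exists s, s < z + 1 /\
       (z = pairM n s /\ (least n w -> exists y, y < w + 1 /\ w = pairM s y))).
  1, 2: by d0.
  { move=> z; split.
    - move=> [n [s [y [-> H]]]]; exists (pairM s y), n.
      split; first by have := pair_gel n s; m_lra.
      exists s; split; first by have := pair_ger n s; m_lra.
      by do !split=> //; try apply H; exists y; split=> //;
        have := pair_ger s y; m_lra.
    - by move=> [w [n [_ [s [_ [-> [Hl [y [_ E]]]]]]]]]; subst w; exists n, s, y. }
  { move=> z; split.
    - move=> [n [s [y [-> H]]]] w; exists n.
      split; first by have := pair_gel n s; m_lra.
      exists s; split; first by have := pair_ger n s; m_lra.
      split=> // Hw; exists y; rewrite (least_fun _ _ _ Hw H).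
      by split=> //; have := pair_ger s y; m_lra.
    - move=> H; have [n [_ [s [_ [zE _]]]]] := H 0.
      have [w Hw] := leastE n.
      have [n' [_ [s' [_ [zE' Hl]]]]] := H w.
      move: zE'; rewrite zE => /pair_inj[nE sE]; subst n' s'.
      by have [y [_ wE]] := Hl Hw; exists n, s, y; rewrite -wE. }
  have HF' : forall n s, sMem (pairM n s) F <-> exists y, least n (pairM s y).
  { move=> n s; rewrite HF; split.
    - by move=> [n' [s' [y [/pair_inj[-> ->] H]]]]; exists y.
    - by move=> [y H]; exists n, s, y. }
  exists F; split; last first.
  { move=> n s /HF'[y /least_pair[s' [y' [/pair_inj[-> _] H]]]]; by exists y'. }
  split; first by move=> z /HF[n [s [y [-> _]]]]; exists n, s.
  move=> n; split.
  - have [w Hw] := leastE n; have [s [y [wE _]]] := least_pair _ _ Hw.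
    by exists s; apply/HF'; exists y; rewrite -wE.
  - move=> s s' /HF'[y H] /HF'[y' H'].
    by have /pair_inj[] := least_fun _ _ _ H H'.
Qed.

End Sequences.
#[export] Hint Resolve D0_fin_seq : d0.

(** * The principles in a model *)

Section Principles.
Context {A : rca_model}.
Notation M := (num A).
Implicit Types a b c d i j k l m n p q r s t u v w x y z h C D H R : M.
Implicit Types F X : nset A.
Local Open Scope m_scope.

(** These definitions copy the formulas clause by clause, so that satisfaction in the model unfolds
    to them by mere conversion. *)
Definition tuple_leM c s t : Prop :=
  forall k x y, k < c -> bit (pairM k x) s -> bit (pairM k y) t -> x <= y.

Definition DLM c : Prop :=
  forall F, is_funM F -> (forall i s, sMem (pairM i s) F -> fin_seqM c s) ->
    exists i j s t, i < j /\ sMem (pairM i s) F /\ sMem (pairM j t) F /\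
      tuple_leM c s t.

Definition coloringM a R c C : Prop :=
  (forall z, bit z C -> exists n m k,
     a <= n /\ n < m /\ m <= R /\ k < c /\ z = pairM (pairM n m) k) /\
  (forall n m, a <= n -> n < m -> m <= R ->
     ex_unique (fun k => bit (pairM (pairM n m) k) C)).

Definition increasing_enumM H l h : Prop :=
  fin_seqM l h /\
  (forall i j x y, i < j -> bit (pairM i x) h -> bit (pairM j y) h -> x < y) /\
  (forall x, bit x H <-> exists i, bit (pairM i x) h).

Definition weakly_homogeneousM C l h : Prop :=
  forall i x y z, bit (pairM i x) h -> bit (pairM (i + 1) y) h ->
    bit (pairM (i + 2) z) h ->
    exists k, bit (pairM (pairM x y) k) C /\ bit (pairM (pairM y z) k) C.

Definition WPHM F c : Prop :=
  forall a, exists R, forall C, coloringM a R c C ->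
    exists H l h,
      (forall x, bit x H -> a <= x /\ x <= R) /\
      increasing_enumM H l h /\
      weakly_homogeneousM C l h /\
      0 < l /\
      (exists x y, bit (pairM 0 x) h /\ sMem (pairM x y) F /\ y < l).

Definition RPHM c : Prop := forall F, is_funM F -> WPHM F c.

Definition below_omega_omegaM s : Prop :=
  exists l, fin_seqM l s /\
    (forall i x y, bit (pairM i x) s -> bit (pairM (i + 1) y) s -> y <= x).

Definition below_omega_powM c s : Prop :=
  below_omega_omegaM s /\ (forall i x, bit (pairM i x) s -> x < c).

Definition cnf_ltM s t : Prop :=
  exists i,
    (forall j, j < i -> exists x, bit (pairM j x) s /\ bit (pairM j x) t) /\
    (exists y, bit (pairM i y) t /\
       (~ (exists x, bit (pairM i x) s) \/
        (exists x, bit (pairM i x) s /\ x < y))).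

Definition no_descending_sequenceM (D : M -> Prop) : Prop :=
  ~ exists F, is_funM F /\ (forall i s, sMem (pairM i s) F -> D s) /\
      (forall i s t, sMem (pairM i s) F -> sMem (pairM (i + 1) t) F ->
         cnf_ltM t s).

Definition WO_powM c : Prop := no_descending_sequenceM (below_omega_powM c).

Definition WO_omegaM : Prop := no_descending_sequenceM below_omega_omegaM.

End Principles.

Notation app s k x := (bit (pairM k x) s) (only parsing).

(** * The order on Cantor normal forms *)

Section CantorNormalForms.
Context {A : rca_model}.
Notation M := (num A).
Implicit Types a b c d i j k l m n p q r s t u v w x y z h : M.
Implicit Types F X : nset A.
Local Open Scope m_scope.

Definition defined s i : Prop := exists x, app s i x.

Lemma D0_defined : D0_2 defined.
Proof.
  move=> t u Ht Hu; apply: (@D0_ext _ (fun e =>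
    exists x, x < t e /\ app (t e) (u e) x)); first by d0.
  move=> e; split=> [[x Hx]|[x [_ Hx]]]; exists x => //.
  by split=> //; have := app_lt Hx; m_lra.
Qed.

Definition agree s t i : Prop := exists x, app s i x /\ app t i x.

Lemma D0_agree : D0_3 agree.
Proof.
  move=> t u v Ht Hu Hv; apply: (@D0_ext _ (fun e =>
    exists x, x < t e /\ (app (t e) (v e) x /\ app (u e) (v e) x)));
    first by d0.
  move=> e; split=> [[x [Hx Hx']]|[x [_ Hx]]]; exists x => //.
  by split=> //; have := app_lt Hx; m_lra.
Qed.

Hint Resolve D0_defined D0_agree : d0.

Lemma D0_cnf_lt : D0_2 (@cnf_ltM A).
Proof.
  move=> t u Ht Hu; apply: (@D0_ext _ (fun e =>
    exists i, i < u e /\ ((forall j, j < i -> agree (t e) (u e) j) /\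
      exists y, y < u e /\ (app (u e) i y /\ (~ defined (t e) i \/
         exists x, x < t e /\ (app (t e) i x /\ x < y)))))); first by d0.
  move=> e; split.
  - move=> [i [Hi [y [Hy H]]]]; have Hyu := app_lt Hy.
    exists i; split; first by m_lra.
    split=> //; exists y; split; first by m_lra.
    split=> //; case: H => [H|[x [Hx xy]]]; [by left|right].
    by exists x; split=> //; have := app_lt Hx; m_lra.
  - move=> [i [_ [Hi [y [_ [Hy H]]]]]]; exists i; split=> //; exists y.
    split=> //; case: H => [H|[x [_ [Hx xy]]]]; [by left|right].
    by exists x.
Qed.

Hint Resolve D0_cnf_lt : d0.

Lemma defined_lt s i : defined s i -> i < s.
Proof. by move=> [x /app_lt[]]. Qed.

Lemma defined_le l s i j : fin_seqM l s -> defined s j -> i <= j -> defined s i.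
Proof.
  move=> Hs [x Hx] ij; apply: (fin_seq_total Hs).
  by have := fin_seq_dom Hs Hx; m_lra.
Qed.

Lemma cnf_fin_seq s : below_omega_omegaM s -> exists l, fin_seqM l s.
Proof. by move=> [l [Hl _]]; exists l. Qed.

Lemma cnf_decreasing s i j x y : below_omega_omegaM s ->
  i <= j -> app s i x -> app s j y -> y <= x.
Proof.
  move=> [l [Hl Hs]] /le_iff[d ->] Hx.
  suff H : forall d y, y < s -> app s (i + d) y -> y <= x.
  { by move=> Hy; apply: (H d) => //; case: (app_lt Hy). }
  apply: induct; first by d0.
  - move=> {}y _; rewrite add0 => Hy; rewrite (fin_seq_fun Hl Hx Hy); m_lra.
  - move=> {}d IH {}y _; rewrite addS => Hy.
    have [z Hz] : defined s (i + d).
    { by apply: (defined_le Hl (j := i + d + 1)); [exists y|m_lra]. }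
    have := Hs _ _ _ Hz Hy; have := IH z (proj2 (app_lt Hz)) Hz; m_lra.
Qed.

(** The smaller of the two positions of first difference is the one for the composite. *)
Lemma cnf_lt_trans s t u l : fin_seqM l t ->
  cnf_ltM s t -> cnf_ltM t u -> cnf_ltM s u.
Proof.
  move=> Ht [i [Hi [y [Hy H]]]] [j [Hj [y' [Hy' H']]]].
  have [ij|[ij|ji]] := lt_trichotomy i j.
  - exists i; split.
    + move=> k ki; have [x [Hx Hx']] := Hi k ki.
      have [z [Hz Hz']] := Hj k (ltac:(m_lra)).
      by exists x; split=> //; rewrite (fin_seq_fun Ht Hx' Hz).
    + exists y; split=> //; have [z [Hz Hz']] := Hj i ij.
      by rewrite (fin_seq_fun Ht Hy Hz).
  - subst j; exists i; split.
    + move=> k ki; have [x [Hx Hx']] := Hi k ki; have [z [Hz Hz']] := Hj k ki.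
      by exists x; split=> //; rewrite (fin_seq_fun Ht Hx' Hz).
    + exists y'; split=> //; case: H => [H|[x [Hx xy]]]; [by left|right].
      exists x; split=> //; case: H' => [[]|[z [Hz zy]]]; first by exists y.
      by have := fin_seq_fun Ht Hy Hz; m_lra.
  - exists j; split.
    + move=> k kj; have [x [Hx Hx']] := Hi k (ltac:(m_lra)).
      have [z [Hz Hz']] := Hj k kj.
      by exists x; split=> //; rewrite (fin_seq_fun Ht Hx' Hz).
    + exists y'; split=> //; right; have [x [Hx Hx']] := Hi j ji.
      exists x; split=> //; case: H' => [[]|[z [Hz zy]]]; first by exists x.
      by have := fin_seq_fun Ht Hx' Hz; m_lra.
Qed.

(** Consider the least position defined in one of the two at which they do not agree. Below it they
    agree, because domains are initial segments; without such a position the codes have the same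
    digits. *)
Lemma cnf_lt_total s t l m : fin_seqM l s -> fin_seqM m t ->
  cnf_ltM s t \/ s = t \/ cnf_ltM t s.
Proof.
  move=> Hs Ht.
  have [Hd|Hn] := classic (exists i, (defined s i \/ defined t i) /\
    ~ agree s t i).
  - have [|i [[Hi Hni] Hmin]] := least_number _ Hd; first by d0.
    have Hag : forall j, j < i -> agree s t j.
    { move=> j ji; apply: NNPP => Hj; apply: (Hmin j ji); split=> //.
      case: Hi => H; [left; apply: (defined_le Hs H)|right; apply: (defined_le Ht H)];
        m_lra. }
    have Hag' : forall j, j < i -> agree t s j.
    { by move=> j /Hag[x [Hx Hx']]; exists x. }
    have [[x Hx]|Hns] := classic (defined s i);
    have [[y Hy]|Hnt] := classic (defined t i).
    + have [xy|[xy|yx]] := lt_trichotomy x y.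
      * left; exists i; split=> //; exists y; split=> //; right.
        by exists x.
      * by case: Hni; exists x; split=> //; rewrite xy.
      * right; right; exists i; split=> //; exists x; split=> //; right.
        by exists y.
    + by right; right; exists i; split=> //; exists x; split=> //; left.
    + by left; exists i; split=> //; exists y; split=> //; left.
    + by case: Hi.
  - have Hag : forall i, defined s i \/ defined t i -> agree s t i.
    { by move=> i Hi; apply: NNPP => H; apply: Hn; exists i. }
    right; left; apply: bits_eq => z; split=> Hz.
    + have [k [x [_ E]]] := proj1 Hs z Hz; subst z.
      have [|y [Hy Hy']] := Hag k; first by left; exists x.
      by rewrite (fin_seq_fun Hs Hz Hy).
    + have [k [x [_ E]]] := proj1 Ht z Hz; subst z.
      have [|y [Hy Hy']] := Hag k; first by right; exists x.
      by rewrite (fin_seq_fun Ht Hz Hy').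
Qed.

Lemma descending F (D : M -> Prop) i j s t : is_funM F ->
  (forall s, D s -> exists l, fin_seqM l s) ->
  (forall i s, sMem (pairM i s) F -> D s) ->
  (forall i s t, sMem (pairM i s) F -> sMem (pairM (i + 1) t) F ->
     cnf_ltM t s) ->
  i < j -> sMem (pairM i s) F -> sMem (pairM j t) F -> cnf_ltM t s.
Proof.
  move=> HF HD HFD Hdesc /lt_iff[d ->] Hs.
  (* A bound on the terms up to the last index makes the quantifier over [t], and with it the
     induction, bounded. *)
  have [b Hb] := fun_bound (i + d + 1 + 1) HF.
  suff H : forall e, e <= d -> forall t, t < b ->
      sMem (pairM (i + e + 1) t) F -> cnf_ltM t s.
  { move=> Ht; apply: (H d) => //; first by right.
    by apply: (Hb _ _ _ Ht); m_lra. }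
  apply: induct; first by d0.
  - by move=> _ {}t _; rewrite add0 => Ht; apply: (Hdesc _ _ _ Hs Ht).
  - move=> e IH He {}t _ Ht.
    have [u Hu] := fun_total (i + e + 1) HF.
    have [l Hl] := HD _ (HFD _ _ Hu).
    apply: (cnf_lt_trans Hl).
    + by apply: (Hdesc _ _ _ Hu); move: Ht; rewrite addS.
    + have Hub : u < b by apply: (Hb _ _ _ Hu); m_lra.
      by apply: (IH _ _ Hub Hu); m_lra.
Qed.

End CantorNormalForms.
#[export] Hint Resolve D0_defined D0_agree D0_cnf_lt : d0.

(** * From Dickson's lemma to well-orderedness, and from Paris-Harrington to Dickson *)

Section EasyImplications.
Context {A : rca_model}.
Notation M := (num A).
Implicit Types a b c d i j k l m n p q r s t u v w x y z h C H : M.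
Implicit Types F X : nset A.
Local Open Scope m_scope.

(* The number of exponents [>= k] in [s]; as they come first, this is the
   first position without one. *)
Definition num_ge s k v : Prop :=
  (forall j, j < v -> exists x, app s j x /\ k <= x) /\
  ~ exists x, app s v x /\ k <= x.

Lemma D0_num_ge : D0_3 num_ge.
Proof.
  move=> s k v Hs Hk Hv; apply: (@D0_ext _ (fun e =>
    (forall j, j < v e -> exists x, x < s e /\ (app (s e) j x /\ k e <= x)) /\
    ~ exists x, x < s e /\ (app (s e) (v e) x /\ k e <= x))); first by d0.
  have E : forall e j, (exists x, app (s e) j x /\ k e <= x) <->
      (exists x, x < s e /\ (app (s e) j x /\ k e <= x)).
  { move=> e j; split=> [[x [Hx kx]]|[x [_ H]]]; exists x => //.
    by split=> //; have := app_lt Hx; m_lra. }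
  move=> e; rewrite /num_ge E.
  by split=> -[H1 H2]; split=> // j /H1 /E.
Qed.

Hint Resolve D0_num_ge : d0.

Lemma num_ge_unique s k v w : num_ge s k v -> num_ge s k w -> v = w.
Proof.
  move=> [H1 H2] [H3 H4].
  by have [/H3//|[//|/H1//]] := lt_trichotomy v w.
Qed.

Lemma num_ge_exists l s k : fin_seqM l s -> exists v, v < s + 1 /\ num_ge s k v.
Proof.
  move=> Hs.
  have [||v [Hv Hmin]] := @least_number _
    (fun v => ~ exists x, x < s /\ (app s v x /\ k <= x)); first by d0.
  { exists s => -[x [_ [Hx _]]]; have := app_lt Hx; m_lra. }
  have Hge : num_ge s k v.
  { split; last by move=> [x [Hx kx]]; apply: Hv; exists x; split=> //;
      case: (app_lt Hx).
    by move=> j /Hmin /NNPP[x [_ H]]; exists x. }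
  exists v; split=> //; have [v0|[v' [Hv' vE]]] := zero_or_succ v.
  - by have := ge0 s; m_lra.
  - by have [x [Hx _]] := proj1 Hge v' Hv'; have := app_lt Hx; m_lra.
Qed.

Definition countsM c s w : Prop :=
  fin_seqM c w /\ forall k, k < c -> forall v, v < w -> app w k v -> num_ge s k v.

Lemma D0_counts c : D0_2 (countsM c).
Proof. by rewrite /countsM; d0. Qed.

Lemma counts_exists c l s : fin_seqM l s -> exists w, countsM c s w.
Proof.
  move=> Hs; have [|||w [_ [Hw HwE]]] := @fin_seq_intro _ (num_ge s) c (s + 1).
  - by d0.
  - by move=> k _; apply: num_ge_exists Hs.
  - by move=> k x y _; apply: num_ge_unique.
  - by exists w; split=> // k _ v _ /HwE[].
Qed.

(** At the first difference [i], let [k] be the exponent of [t]. Positions up to [i] in [t] carry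
    exponents [>= k], so entry [k] of [v] exceeds [i]. Were [v] below [w], then [s] would also carry
    an exponent [>= k] at [i], whereas there it has ended or has a smaller one. *)
Lemma counts_cnf_lt c s t v w : below_omega_omegaM s -> below_omega_powM c t ->
  cnf_ltM s t -> countsM c t v -> countsM c s w -> ~ tuple_leM c v w.
Proof.
  move=> Hs [Ht Htc] [i [Hi [k [Hk H]]]] [Hv HvE] [Hw HwE] Hle.
  have kc := Htc _ _ Hk.
  have [x Hx] := fin_seq_total Hv kc; have [y Hy] := fin_seq_total Hw kc.
  have xy := Hle _ _ _ kc Hx Hy.
  have [_ Hx2] := HvE _ kc _ (proj2 (app_lt Hx)) Hx.
  have [Hy1 _] := HwE _ kc _ (proj2 (app_lt Hy)) Hy.
  have [l Hl] := cnf_fin_seq Ht; have [l' Hl'] := cnf_fin_seq Hs.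
  have ix : i < x.
  { have [xi|//] := le_or_lt x i; case: Hx2.
    have [z Hz] := defined_le Hl (ex_intro _ k Hk) xi.
    by exists z; split=> //; apply: (cnf_decreasing Ht xi Hz Hk). }
  have [|z [Hz kz]] := Hy1 i; first by m_lra.
  case: H => [[]|[z' [Hz' zk]]]; first by exists z.
  by have := fin_seq_fun Hl' Hz Hz'; m_lra.
Qed.

Theorem DL_WO c : DLM c -> WO_powM c.
Proof.
  move=> HDL [F [HF [HFc Hdesc]]].
  have Hseq : forall s, below_omega_powM c s -> exists l, fin_seqM l s.
  { by move=> s [[l [Hl _]] _]; exists l. }
  have HDc := @D0_counts c.
  have [||F' [HF' HFE]] := @function_choice _
    (fun i w s => sMem (pairM i s) F /\ countsM c s w); first by d0.
  { move=> i; have [s Hs] := fun_total i HF.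
    have [l Hl] := Hseq _ (HFc _ _ Hs).
    by have [w Hw] := counts_exists c Hl; exists w, s. }
  have [||i [j [v [w [ij [Hv [Hw Hle]]]]]]] := HDL F' => //.
  { by move=> i w /HFE[s [_ []]]. }
  have [t [Ht Hvt]] := HFE _ _ Hv; have [s [Hs Hws]] := HFE _ _ Hw.
  have Hlt := descending HF Hseq HFc Hdesc ij Ht Hs.
  have Hs' : below_omega_omegaM s by case: (HFc _ _ Hs).
  exact: (counts_cnf_lt Hs' (HFc _ _ Ht) Hlt Hvt Hws Hle).
Qed.

Lemma WO_omega_WO_pow c : @WO_omegaM A -> WO_powM c.
Proof.
  move=> H [F [HF [HFc Hd]]]; apply: H; exists F; split=> //; split=> //.
  by move=> i s /HFc[].
Qed.

Lemma WO_pow_omega : (forall c, WO_powM c) -> @WO_omegaM A.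
Proof.
  move=> H [F [HF [HFc Hdesc]]].
  have [s0 Hs0] := fun_total 0 HF.
  (* The code of the first term exceeds all its exponents. Later terms are smaller, so their leading
     exponents, and hence all others, stay below [s0] too. *)
  apply: (H s0); exists F; split=> //; split=> // n s Hs.
  split; first by apply: HFc Hs.
  have Hseq := @cnf_fin_seq A.
  move=> i x Hx; have [E|[m [_ E]]] := zero_or_succ n.
  { have E' : s = s0 by apply: (fun_unique HF _ Hs0); rewrite -E.
    by rewrite -E'; case: (app_lt Hx). }
  have n0 : 0 < n by have := ge0 m; m_lra.
  have [j [Hj [y [Hy Hxy]]]] := descending HF Hseq HFc Hdesc n0 Hs0 Hs.
  have [l Hl] := Hseq _ (HFc _ _ Hs0); have [l' Hl'] := Hseq _ (HFc _ _ Hs).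
  have [z Hz] : defined s 0.
  { by apply: (defined_le Hl' (ex_intro _ x Hx)); apply: ge0. }
  have xz := cnf_decreasing (HFc _ _ Hs) (ge0 i) Hz Hx.
  have [j0|jpos] := zero_or_succ j.
  - subst j; case: Hxy => [[]|[z' [Hz' zy]]]; first by exists z.
    have := fin_seq_fun Hl' Hz Hz'; have := app_lt Hy; m_lra.
  - have [|z' [Hz' Hz0]] := Hj 0.
    { by case: jpos => k [_ ->]; have := ge0 k; m_lra. }
    have := fin_seq_fun Hl' Hz Hz'; have := app_lt Hz0; m_lra.
Qed.

(* Colour [n < m] by the first coordinate in which the [n]th tuple exceeds the
   [m]th: along a weakly homogeneous set that coordinate decreases strictly,
   hence the length of the set is bounded by the code of its first tuple. *)
Theorem RPH_DL c : RPHM c -> DLM c.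
Proof.
  move=> HRPH F HF HFc; apply: NNPP => Hbad.
  have [c0|cpos] := le_or_lt c 0.
  { have [s Hs] := fun_total 0 HF; have [t Ht] := fun_total 1 HF.
    apply: Hbad; exists 0, 1, s, t; do !split=> //; first by m_lra.
    by move=> k x y kc; have := ge0 k; m_lra. }
  (* The sequence of tuples itself serves as the function of the principle: its value at [n] is the
     code of the tuple, which exceeds every entry. *)
  have [R HR] := HRPH F HF 0.
  (* The bound on the tuples up to [R] makes the colouring definable by a bounded formula, so that
     it has a code. *)
  have [b Hb] := fun_bound (R + 1) HF.
  pose G n m k := exists s, s < b /\ (sMem (pairM n s) F /\
    exists t, t < b /\ (sMem (pairM m t) F /\ exists x, x < s /\
      (app s k x /\ exists y, y < t /\ (app t k y /\ y < x)))).
  have HG : D0_3 G by rewrite /G; d0.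
  pose col n m k := G n m k /\ forall k', k' < k -> ~ G n m k'.
  have Hcol : D0_3 col by rewrite /col; d0.
  have [|C [_ HC]] := @bounded_comprehension _
    (fun z => exists n, n < z + 1 /\ exists m, m < z + 1 /\
      exists k, k < z + 1 /\ (n < m /\ (m <= R /\ (k < c /\
        (z = pairM (pairM n m) k /\ col n m k)))))
    (pairM (pairM (R + 1) (R + 1)) c); first by d0.
  have HCE : forall n m k, bit (pairM (pairM n m) k) C <->
      n < m /\ m <= R /\ k < c /\ col n m k.
  { move=> n m k; rewrite HC; split.
    - move=> [_ [n' [_ [m' [_ [k' [_ [H1 [H2 [H3 [E H4]]]]]]]]]]].
      by have [/pair_inj[-> ->] ->] := pair_inj E.
    - move=> [H1 [H2 [H3 H4]]]; split.
      + by apply: pair_lt; [apply: pair_lt; m_lra|m_lra].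
      + have := pair_gel (pairM n m) k; have := pair_ger (pairM n m) k.
        have := pair_gel n m; have := pair_ger n m => ? ? ? ?.
        by exists n; split; [m_lra|exists m; split; [m_lra|
          exists k; split; [m_lra|]]]. }
  have col_fun : forall n m k k', col n m k -> col n m k' -> k = k'.
  { move=> n m k k' [H1 H2] [H3 H4].
    by have [/H4//|[//|/H2//]] := lt_trichotomy k k'. }
  have HCcol : coloringM 0 R c C.
  { split.
    - move=> z Hz; have := Hz; rewrite HC => -[_ [n [_ [m [_ [k [_ H]]]]]]].
      by exists n, m, k; have := ge0 n; tauto.
    - move=> n m _ nm mR; split; last by
        move=> k k' /HCE[_ [_ [_ H]]] /HCE[_ [_ [_ H']]]; apply: col_fun H H'.
      have [s Hs] := fun_total n HF; have [t Ht] := fun_total m HF.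
      have [||k [Hk Hmin]] := @least_number _ (G n m); first by d0.
      { apply: NNPP => Hn; apply: Hbad; exists n, m, s, t; do !split=> //.
        move=> k x y kc Hx Hy; have [//|yx] := le_or_lt x y.
        case: Hn; exists k, s; split; first by apply: (Hb _ _ _ Hs); m_lra.
        split=> //; exists t; split; first by apply: (Hb _ _ _ Ht); m_lra.
        split=> //; exists x; split; first by case: (app_lt Hx).
        by split=> //; exists y; split=> //; case: (app_lt Hy). }
      exists k; apply/HCE; do !split=> //.
      move: Hk => [s' [_ [Hs' [t' [_ [_ [x [_ [Hx _]]]]]]]]].
      exact: (fin_seq_dom (HFc _ _ Hs') Hx). }
  have [H [l [h [HH [[Hh [Hinc HHh]] [Hwh [lpos [x0 [s0 [Hx0 [Hs0 sl]]]]]]]]]]] :=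
    HR C HCcol.
  (* As [c] is positive, the first tuple has an entry and its code is positive. Hence [l] is at
     least 2, and the first two elements determine the common colour. *)
  have [v00 Hv00] := fin_seq_total (HFc _ _ Hs0) cpos.
  have [x1 Hx1] : exists x, app h 1 x.
  { by apply: (fin_seq_total Hh); have := app_lt Hv00; have := ge0 v00; m_lra. }
  have HhR : forall i x, app h i x -> x <= R.
  { by move=> i x Hx; apply: (proj2 (HH x _)); apply/HHh; exists i. }
  have x01 : x0 < x1 by apply: (Hinc _ _ _ _ _ Hx0 Hx1); m_lra.
  have [[k Hk] _] := proj2 HCcol x0 x1 (ge0 _) x01 (HhR _ _ Hx1).
  have Hmono : forall i, i + 1 < l -> forall x, x < h -> forall y, y < h ->
      app h i x -> app h (i + 1) y -> bit (pairM (pairM x y) k) C.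
  { apply: induct; first by d0.
    - move=> _ x _ y _; rewrite add0l => Hx Hy.
      by rewrite (fin_seq_fun Hh Hx Hx0) (fin_seq_fun Hh Hy Hx1).
    - move=> i IH il y yh z zh Hy Hz.
      have [x Hx] : defined h i.
      { by apply: (defined_le Hh (ex_intro _ y Hy)); m_lra. }
      have Hz' : app h (i + 2) z by rewrite addA.
      have [k' [H1 H2]] := Hwh _ _ _ _ Hx Hy Hz'.
      have H3 : bit (pairM (pairM x y) k) C.
      { by apply: IH => //; [m_lra|case: (app_lt Hx)]. }
      suff -> : k = k' by [].
      by move/HCE: H1 => [_ [_ [_ H1]]]; move/HCE: H3 => [_ [_ [_ H3]]];
        apply: col_fun H3 H1. }
  have [v0 Hv0] : exists v, app s0 k v.
  { by apply: (fin_seq_total (HFc _ _ Hs0)); move/HCE: Hk => [_ [_ []]]. }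
  have Hdec : forall i, i < l -> forall x, x < h -> app h i x ->
      forall s, s < b -> sMem (pairM x s) F -> forall v, v < s ->
      app s k v -> v + i <= v0.
  { apply: induct; first by d0.
    - move=> _ x _ Hx s _ Hs v _ Hv.
      have xE := fin_seq_fun Hh Hx Hx0; subst x.
      have sE := fun_unique HF Hs Hs0; subst s.
      by rewrite (fin_seq_fun (HFc _ _ Hs0) Hv Hv0) add0; right.
    - move=> i IH il y yh Hy t tb Ht w wt Hw.
      have [x Hx] : defined h i.
      { by apply: (defined_le Hh (ex_intro _ y Hy)); m_lra. }
      have xh := proj2 (app_lt Hx).
      have /HCE[_ [_ [_ [[s [sb [Hs [t' [_ [Ht' [v [vs [Hv [w' [_ [Hw' wv]]]]]]]]]]]] _]]]]
        := Hmono _ il _ xh _ yh Hx Hy.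
      have tE := fun_unique HF Ht' Ht; subst t'.
      have wE := fin_seq_fun (HFc _ _ Ht) Hw' Hw; subst w'.
      by have := IH (ltac:(m_lra)) x xh Hx s sb Hs v vs Hv; m_lra. }
  have [l0|[i [_ lE]]] := zero_or_succ l; first by m_lra.
  have il : i < l by m_lra.
  have [x Hx] := fin_seq_total Hh il.
  have xR := HhR _ _ Hx.
  have [s Hs] := fun_total x HF.
  have [v Hv] : exists v, app s k v.
  { by apply: (fin_seq_total (HFc _ _ Hs)); move/HCE: Hk => [_ [_ []]]. }
  have sb : s < b by apply: (Hb _ _ _ Hs); m_lra.
  (* At the last index this gives [l - 1 <= v0], whereas [v0 < s0 < l]. *)
  have := Hdec i il x (proj2 (app_lt Hx)) Hx s sb Hs v (proj2 (app_lt Hv)) Hv.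
  by have := app_lt Hv0; have := ge0 v; m_lra.
Qed.

End EasyImplications.

(** * From well-foundedness to the Paris-Harrington principle *)

Section Cardinality.
Context {A : rca_model}.
Notation M := (num A).
Implicit Types a b c d i j k l m n p q r s t u v w x y z h g : M.
Local Open Scope m_scope.

Definition fixes p k : Prop := exists v, bit (pairM k v) p.

Lemma D0_fixes : D0_2 fixes.
Proof. exact: D0_defined. Qed.

Hint Resolve D0_fixes : d0.

(** Entry [k] of [h] is the number of fixed coordinates below [k]: the code of the computation
    stands in for a recursive definition of the count. *)
Definition counter p n h : Prop :=
  fin_seqM (n + 1) h /\ app h 0 0 /\
  forall k, k < n -> forall y, y < h -> app h k y ->
    (fixes p k -> app h (k + 1) (y + 1)) /\
    (~ fixes p k -> app h (k + 1) y).

Lemma D0_counter : D0_3 counter.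
Proof. by rewrite /counter; d0. Qed.

Hint Resolve D0_counter : d0.

Lemma counter_step p n h k y : counter p n h -> k < n -> app h k y ->
  exists z, app h (k + 1) z /\
    ((fixes p k /\ z = y + 1) \/ (~ fixes p k /\ z = y)).
Proof.
  move=> [_ [_ H]] kn Hy; have [H1 H2] := H k kn y (proj2 (app_lt Hy)) Hy.
  by have [Hk|Hk] := classic (fixes p k);
    [exists (y + 1)|exists y]; split; auto.
Qed.

Lemma counter_le p n h : counter p n h ->
  forall k, k < n + 1 -> forall y, y < h -> app h k y -> y <= k.
Proof.
  move=> Hh; apply: induct; first by d0.
  - move=> _ y _ Hy; have := fin_seq_fun (proj1 Hh) Hy (proj1 (proj2 Hh)).
    by m_lra.
  - move=> k IH kn z _ Hz; have kn' : k < n by m_lra.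
    have [y Hy] : defined h k.
    { by apply: (defined_le (proj1 Hh) (ex_intro _ z Hz)); m_lra. }
    have := IH (ltac:(m_lra)) y (proj2 (app_lt Hy)) Hy.
    have [z' [Hz' zE]] := counter_step Hh kn' Hy.
    by rewrite (fin_seq_fun (proj1 Hh) Hz Hz'); case: zE => -[_ ->]; m_lra.
Qed.

(** Partial counts do not exceed their index, which bounds the code of the sequence in advance; only
    so is the induction on [n] bounded. *)
Lemma counter_exists p n :
  exists h, h < 2 ^ pairM (n + 1) (n + 1) /\ counter p n h.
Proof.
  move: n; apply: induct; first by d0.
  - have [|||h [Hh [Hs HE]]] := @fin_seq_intro _ (fun k x => x = 0)
      (0 + 1) (0 + 1); first by d0.
    + by move=> k _; exists 0; split=> //; m_lra.
    + by move=> k x y _ -> ->.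
    + exists h; split=> //; split=> //; split; last by move=> k /lt0.
      by apply/HE; split=> //; m_lra.
  - move=> n [h [_ Hh]]; have Hs := proj1 Hh.
    have [y Hy] := @fin_seq_total _ _ _ n Hs (ltac:(m_lra)).
    have yn := counter_le Hh (ltac:(m_lra)) (proj2 (app_lt Hy)) Hy.
    have [y' [y'E Hy']] : exists y', y' <= y + 1 /\
      ((fixes p n -> y' = y + 1) /\ (~ fixes p n -> y' = y)).
    { have [Hf|Hf] := classic (fixes p n); [exists (y + 1)|exists y];
        by split; [m_lra|]. }
    have [|||g [Hg [Hgs HE]]] := @fin_seq_intro _
      (fun k x => app h k x \/ (k = n + 1 /\ x = y')) (n + 1 + 1) (n + 1 + 1);
      first by d0.
    + move=> k /ltS[kn|->]; last by exists y'; split; [m_lra|right].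
      have [x Hx] := fin_seq_total Hs kn.
      have := counter_le Hh kn (proj2 (app_lt Hx)) Hx.
      by exists x; split; [m_lra|left].
    + move=> k x z _ [Hx|[kE ->]] [Hz|[kE' ->]] //.
      * exact: (fin_seq_fun Hs Hx Hz).
      * by have := fin_seq_dom Hs Hx; m_lra.
      * by have := fin_seq_dom Hs Hz; m_lra.
    + have HE' : forall k x, k < n + 1 -> app g k x <-> app h k x.
      { move=> k x kn; rewrite HE; split=> [[_ [//|[kE _]]]|Hx]; first by m_lra.
        by split; [m_lra|left]. }
      exists g; split=> //; split=> //; split.
      { by apply/HE'; [have := ge0 n; m_lra|apply Hh]. }
      move=> k kn x _ /(HE' k _ kn) Hx; case/ltS: (kn) => [kn'|kE].
      * have [H1 H2] := proj2 (proj2 Hh) k kn' x (proj2 (app_lt Hx)) Hx.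
        by split=> Hf; (apply/HE'; first by m_lra); auto.
      * subst k; rewrite (fin_seq_fun Hs Hx Hy).
        by split=> Hf; apply/HE; (split; first by m_lra); right;
          split=> //; symmetry; apply Hy'.
Qed.

(** One induction gives both comparisons: the inequality becomes strict once a coordinate [m] fixed
    by [q] alone has been passed. With [m = n] the condition on [m] is vacuous and only the weak
    inequality remains. *)
Lemma counter_mono p q n h g m : counter p n h -> counter q n g ->
  (forall k, k < n -> fixes p k -> fixes q k) ->
  (m < n -> fixes q m /\ ~ fixes p m) ->
  forall k, k < n + 1 -> forall y, y < h -> forall z, z < g ->
  app h k y -> app g k z -> y <= z /\ (m < k -> y < z).
Proof.
  move=> Hh Hg Hpq Hm; apply: induct; first by d0.
  - move=> _ y _ z _ Hy Hz.
    have := fin_seq_fun (proj1 Hh) Hy (proj1 (proj2 Hh)).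
    have := fin_seq_fun (proj1 Hg) Hz (proj1 (proj2 Hg)) => -> ->.
    by split=> [|/lt0//]; right.
  - move=> k IH kn y' _ z' _ Hy' Hz'; have kn' : k < n by m_lra.
    have [y Hy] : defined h k.
    { by apply: (defined_le (proj1 Hh) (ex_intro _ y' Hy')); m_lra. }
    have [z Hz] : defined g k.
    { by apply: (defined_le (proj1 Hg) (ex_intro _ z' Hz')); m_lra. }
    have [yz yz'] := IH (ltac:(m_lra)) y (proj2 (app_lt Hy)) z
      (proj2 (app_lt Hz)) Hy Hz.
    have [y'' [Hy'' yE]] := counter_step Hh kn' Hy.
    have [z'' [Hz'' zE]] := counter_step Hg kn' Hz.
    rewrite (fin_seq_fun (proj1 Hh) Hy' Hy'') (fin_seq_fun (proj1 Hg) Hz' Hz'').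
    case: yE => -[fp ->]; case: zE => -[fq ->].
    + by split=> [|/ltS[/yz'|mk]]; [m_lra|m_lra|case: Hm; rewrite mk].
    + by case: fq; apply: Hpq.
    + by split=> [|_]; m_lra.
    + by split=> [//|/ltS[/yz'//|mk]]; case: Hm; rewrite mk.
Qed.

Definition card c p d : Prop :=
  exists h, h < 2 ^ pairM (c + 1) (c + 1) /\ (counter p c h /\ app h c d).

Lemma D0_card : D0_3 card.
Proof. by rewrite /card; d0. Qed.

Lemma card_exists c p : exists d, d <= c /\ card c p d.
Proof.
  have [h [Hh Hp]] := counter_exists p c.
  have cc : c < c + 1 by m_lra.
  have [d Hd] := fin_seq_total (proj1 Hp) cc.
  exists d; split; last by exists h.
  exact: (counter_le Hp cc (proj2 (app_lt Hd)) Hd).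
Qed.

Lemma card_unique c p d e : card c p d -> card c p e -> d = e.
Proof.
  move=> [h [_ [Hh Hd]]] [g [_ [Hg He]]].
  have cc : c < c + 1 by m_lra.
  have H := counter_mono Hh Hg (m := c) (fun _ _ H => H)
    (fun H => False_ind _ (lt_irrefl H)) cc (proj2 (app_lt Hd))
    (proj2 (app_lt He)) Hd He.
  have H' := counter_mono Hg Hh (m := c) (fun _ _ H => H)
    (fun H => False_ind _ (lt_irrefl H)) cc (proj2 (app_lt He))
    (proj2 (app_lt Hd)) He Hd.
  by apply: le_antisym; [apply H|apply H'].
Qed.

Lemma card_lt c p q m d e : card c p d -> card c q e ->
  (forall k, k < c -> fixes p k -> fixes q k) ->
  m < c -> fixes q m -> ~ fixes p m -> d < e.
Proof.
  move=> [h [_ [Hh Hd]]] [g [_ [Hg He]]] Hpq mc Hqm Hpm.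
  have cc : c < c + 1 by m_lra.
  by apply: (proj2 (counter_mono Hh Hg Hpq (fun _ => conj Hqm Hpm) cc
    (proj2 (app_lt Hd)) (proj2 (app_lt He)) Hd He)).
Qed.

End Cardinality.
#[export] Hint Resolve D0_fixes D0_card : d0.

(** * Regions as minimal hitting sets *)

Section MinimalHittingSets.
Context {A : rca_model}.
Notation M := (num A).
Implicit Types a b c d i j k l m n p q r s t u v w x y z h g X : M.
Local Open Scope m_scope.

Definition subbits q p : Prop := forall z, bit z q -> bit z p.

Lemma D0_subbits : D0_2 subbits.
Proof.
  move=> t u Ht Hu; apply: (@D0_ext _ (fun e =>
    forall z, z < t e -> bit z (t e) -> bit z (u e))); first by d0.
  move=> e; split=> H z; first by move=> _ /H.
  by move=> Hz; apply: H => //; apply: bit_lt.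
Qed.

Hint Resolve D0_subbits : d0.

Lemma subbits_trans p q r : subbits p q -> subbits q r -> subbits p r.
Proof. by move=> H1 H2 z /H1 /H2. Qed.

Lemma subbits_lt p q : subbits p q -> p <> q -> p < q.
Proof. by move=> /bits_le[]. Qed.

Lemma remove_bit p z : exists q, forall y, bit y q <-> bit y p /\ y <> z.
Proof.
  have [|q [_ Hq]] := @bounded_comprehension _ (fun y => bit y p /\ y <> z) p;
    first by d0.
  exists q => y; rewrite Hq; split=> [[]//|H]; split=> //.
  by apply: bit_lt; case: H.
Qed.

(** This is minimality under inclusion; the bound [q < p] expresses properness, since a proper
    subset has a smaller code. *)
Definition minimal (T : M -> Prop) p : Prop :=
  T p /\ forall q, q < p -> subbits q p -> ~ T q.

(** Among the subsets of [p] in [T], the one with the least code is minimal under inclusion. *)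
Lemma minimal_exists (T : M -> Prop) p : D0_1 T -> T p ->
  exists q, subbits q p /\ minimal T q.
Proof.
  move=> HT Tp; have [||q [[Tq qp] Hmin]] := @least_number _
    (fun q => T q /\ subbits q p); first by d0.
  - by exists p; split=> // z.
  - exists q; split=> //; split=> // r rq Hr Tr; apply: (Hmin r rq).
    by split=> //; apply: subbits_trans Hr qp.
Qed.

Lemma minimal_le (T : M -> Prop) p q :
  minimal T p -> T q -> subbits q p -> q = p.
Proof.
  move=> [_ H] Tq qp; apply: NNPP => neq.
  exact: (H q (subbits_lt qp neq) qp Tq).
Qed.

Lemma minimal_mono (T T' : M -> Prop) p :
  (forall q, T' q -> T q) -> minimal T p -> T' p -> minimal T' p.
Proof. by move=> H [_ Hp] T'p; split=> // q qp Hq /H; apply: Hp. Qed.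

(** Shrink [q] to a [T]-minimal [p]. If [p] is a proper subset, it must fail [T'], as otherwise [q]
    would not be [T']-minimal. So every new region comes from a removed one. *)
Lemma minimal_new (T T' : M -> Prop) q : D0_1 T ->
  (forall q, T' q -> T q) -> minimal T' q ->
  minimal T q \/ exists p, minimal T p /\ ~ T' p /\ subbits p q /\ p <> q.
Proof.
  move=> HT HTT Hq; have [p [pq Hp]] := minimal_exists HT (HTT _ (proj1 Hq)).
  have [pE|neq] := classic (p = q); first by left; rewrite -pE.
  right; exists p; do !split=> //; try apply Hp.
  by move=> T'p; apply: neq; apply: (minimal_le Hq).
Qed.

(* [X] codes a matrix with [c] columns whose entry [(i, k)] is the [v] with
   [entry X i k v]. A set [p] of pairs [(k, v)] hits row [i] if one of them has
   [v] below the entry [(i, k)]: then no tuple extending [p] dominates row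
   [i]. The minimal [p] hitting the first [n] rows are the regions covering the
   complement of their upward closure; defining them in this way avoids a
   recursion on [n]. *)
Definition entry X i k v : Prop := bit (pairM (pairM i k) v) X.

Lemma D0_entry : D0_4 entry.
Proof. by rewrite /entry; d0. Qed.

Lemma entry_lt X i k v : entry X i k v -> i < X /\ k < X /\ v < X.
Proof.
  move=> /app_lt[]; have := pair_gel i k; have := pair_ger i k; m_lra.
Qed.

Hint Resolve D0_entry : d0.

Definition hit c X i p : Prop :=
  exists k v w, k < c /\ bit (pairM k v) p /\ entry X i k w /\ v < w.

Lemma D0_hit c : D0_3 (hit c).
Proof.
  move=> X i p HX Hi Hp; apply: (@D0_ext _ (fun e =>
    exists k, k < X e /\ exists v, v < X e /\ exists w, w < X e /\ (k < c /\
      (bit (pairM k v) (p e) /\ (entry (X e) (i e) k w /\ v < w)))));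
    first by d0.
  move=> e; split.
  - move=> [k [v [w [kc [Hv [Hw vw]]]]]]; have := entry_lt Hw => ?.
    exists k; split; first by m_lra.
    exists v; split; first by m_lra.
    by exists w; split; first by m_lra.
  - by move=> [k [_ [v [_ [w [_ H]]]]]]; exists k, v, w.
Qed.

Definition hits c n X p : Prop :=
  (forall z, bit z p -> exists k v, k < c /\ z = pairM k v) /\
  forall i, i < n -> hit c X i p.

Lemma D0_hits c : D0_3 (hits c).
Proof.
  have Hhit := @D0_hit c.
  move=> n X p Hn HX Hp; apply: (@D0_ext _ (fun e =>
    (forall z, z < p e -> bit z (p e) -> exists k, k < z + 1 /\
       exists v, v < z + 1 /\ (k < c /\ z = pairM k v)) /\
    (forall i, i < n e -> hit c (X e) i (p e)))); first by d0.
  move=> e; split=> -[H1 H2]; split=> // z.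
  - move=> _ /H1[k [v [kc ->]]]; exists k.
    split; first by have := pair_gel k v; m_lra.
    by exists v; split=> //; have := pair_ger k v; m_lra.
  - by move=> Hz; have [k [_ [v [_ H]]]] := H1 z (bit_lt Hz) Hz; exists k, v.
Qed.

Lemma hits_mono c n X p : hits c (n + 1) X p -> hits c n X p.
Proof. by move=> [H1 H2]; split=> // i Hi; apply: H2; m_lra. Qed.

(** Removing [z] from a minimal set leaves some row unhit, and that row was hit by [z] alone. *)
Lemma necessary c n X p z : minimal (hits c n X) p -> bit z p ->
  exists i, i < n /\ forall k v w, k < c -> bit (pairM k v) p ->
    entry X i k w -> v < w -> pairM k v = z.
Proof.
  move=> [[H1 H2] Hmin] Hz; have [q Hq] := remove_bit p z.
  have qp : subbits q p by move=> y /Hq[].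
  have qlt : q < p.
  { by apply: subbits_lt => // E; move: Hz; rewrite -E => /Hq[]. }
  apply: NNPP => Hn; apply: (Hmin q qlt qp); split; first by move=> y /qp /H1.
  move=> i Hi; apply: NNPP => Hni; apply: Hn; exists i; split=> //.
  move=> k v w kc Hv Hw vw; apply: NNPP => neq; apply: Hni.
  by exists k, v, w; do !split=> //; apply/Hq.
Qed.

Lemma minimal_useful c n X p z : minimal (hits c n X) p -> bit z p ->
  exists i k v w, i < n /\ k < c /\ z = pairM k v /\ entry X i k w /\ v < w /\
  forall k' v' w', k' < c -> bit (pairM k' v') p ->
    entry X i k' w' -> v' < w' -> pairM k' v' = z.
Proof.
  move=> Hp Hz; have [i [Hi H]] := necessary Hp Hz.
  have [k [v [w [kc [Hv [Hw vw]]]]]] := proj2 (proj1 Hp) i Hi.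
  by exists i, k, v, w; do !split=> //; rewrite (H k v w).
Qed.

Lemma minimal_fun c n X p k v v' : minimal (hits c n X) p ->
  bit (pairM k v) p -> bit (pairM k v') p -> v = v'.
Proof.
  move=> Hp.
  suff H : forall v v', v < v' -> bit (pairM k v) p -> bit (pairM k v') p ->
      False.
  { move=> Hv Hv'; have [|[//|]] := lt_trichotomy v v'.
    - by move=> /H /(_ Hv Hv').
    - by move=> /H /(_ Hv' Hv). }
  move=> {}v {}v' vv' Hv Hv'.
  have [i [k' [u [w [Hi [kc [/pair_inj[kE uE] [Hw [uw H]]]]]]]]] :=
    minimal_useful Hp Hv'.
  subst k' u; have /pair_inj[_ vE] := H k v w kc Hv Hw (ltac:(m_lra)).
  by m_lra.
Qed.

Lemma minimal_bound c n X p : minimal (hits c n X) p -> p < 2 ^ pairM c X.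
Proof.
  move=> Hp; apply: bits_bound => z Hz.
  have [i [k [v [w [_ [kc [-> [Hw [vw _]]]]]]]]] := minimal_useful Hp Hz.
  by apply: pair_lt => //; have := entry_lt Hw; m_lra.
Qed.

Lemma minimal_fixes c n X p q k v : minimal (hits c n X) q ->
  subbits p q -> bit (pairM k v) q -> ~ bit (pairM k v) p -> ~ fixes p k.
Proof.
  move=> Hq pq Hv Hnv [v' Hv']; apply: Hnv.
  by rewrite (minimal_fun Hq Hv (pq _ Hv')).
Qed.

Definition minimalM c n X p : Prop := minimal (hits c n X) p.

Lemma D0_minimal c : D0_3 (minimalM c).
Proof. by have := @D0_hits c => ?; rewrite /minimalM /minimal; d0. Qed.

Lemma hits_ext c n X X' :
  (forall i k v, i < n -> k < c -> entry X i k v <-> entry X' i k v) ->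
  hits c n X = hits c n X'.
Proof.
  move=> H; apply: functional_extensionality => p.
  apply: propositional_extensionality; split=> -[H1 H2]; split=> // i Hi;
    have [k [v [w [kc [Hv [Hw vw]]]]]] := H2 i Hi;
    by exists k, v, w; do !split=> //; move/H: Hw; apply.
Qed.

End MinimalHittingSets.
#[export] Hint Resolve D0_subbits D0_entry D0_hits D0_minimal : d0.

(** * The ordinal of a finite bad sequence *)

Section Ordinals.
Context {A : rca_model}.
Notation M := (num A).
Implicit Types a b c d i j k l m n p q r s t u v w x y z h g X N : M.
Local Open Scope m_scope.

(* Ordering sets of regions by their binary codes turns the natural sum of the
   [omega ^ (c - card p)] into a Cantor normal form without any counting: the
   coefficients are replaced by codes, as removing an element from a set
   decreases its code. *)
Definition level c n X k p : Prop :=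
  minimalM c n X p /\ exists d, d + k <= c /\ card c p d.

Definition level_code c n X k N : Prop :=
  forall p, bit p N <-> level c n X k p.

(** Let [N_x] be the code of level [x], the set of regions with at least [x] free coordinates; it
    decreases in [x]. Position [j] carries the largest [x < c] with [j < N_x]. So exactly [N_x]
    positions have an exponent [>= x], and the coefficient of omega^x is [N_x - N_(x+1)], where
    [N_c] is read as 0. *)
Definition exponent c n X j x : Prop :=
  x < c /\ (exists N, level_code c n X x N /\ j < N) /\
  forall k, x < k -> k < c -> exists N, level_code c n X k N /\ N <= j.

Definition ordinal c n X s : Prop :=
  (exists l, fin_seqM l s) /\
  forall j x, app s j x <-> exponent c n X j x.

Lemma D0_level c : D0_4 (level c).
Proof.
  move=> n X k p Hn HX Hk Hp; apply: (@D0_ext _ (fun e =>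
    minimalM c (n e) (X e) (p e) /\ exists d, d < c + 1 /\
      (d + k e <= c /\ card c (p e) d))); first by d0.
  move=> e; split=> -[H1 [d H]]; split=> //; exists d; last by case: H.
  by split=> //; case: H => H _; have := ge0 (k e); m_lra.
Qed.

Hint Resolve D0_level : d0.

Lemma level_bound c n X k p : level c n X k p -> p < 2 ^ pairM c X.
Proof. by move=> [/minimal_bound]. Qed.

Lemma level_code_bound c n X k N :
  level_code c n X k N -> N < 2 ^ 2 ^ pairM c X.
Proof. by move=> H; apply: bits_bound => p /H /level_bound. Qed.

Lemma D0_level_code c : D0_4 (level_code c).
Proof.
  move=> n X k N Hn HX Hk HN; apply: (@D0_ext _ (fun e =>
    forall p, p < 2 ^ pairM c (X e) + N e ->
      (bit p (N e) <-> level c (n e) (X e) (k e) p))); first by d0.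
  move=> e; split=> H p; first by move=> _; apply: H.
  by split=> Hp; apply/H => //;
    [have := bit_lt Hp; have := pow2_pos (pairM c (X e))
    |have := level_bound Hp; have := ge0 (N e)]; m_lra.
Qed.

Hint Resolve D0_level_code : d0.

Lemma level_code_exists c n X k : exists N, level_code c n X k N.
Proof.
  have [|N [_ HN]] := @bounded_comprehension _ (level c n X k) (2 ^ pairM c X).
  { by d0. }
  exists N => p; rewrite HN; split=> [[]//|H]; split=> //.
  exact: level_bound H.
Qed.

Lemma level_code_unique c n X k N N' :
  level_code c n X k N -> level_code c n X k N' -> N = N'.
Proof. by move=> H H'; apply: bits_eq => p; rewrite H H'. Qed.

Lemma level_code_le c n X k k' N N' : k <= k' ->
  level_code c n X k N -> level_code c n X k' N' -> N' <= N.
Proof.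
  move=> kk H H'; apply: bits_le => p /H'[Hp [d [Hd Hd']]].
  by apply/H; split=> //; exists d; split=> //; m_lra.
Qed.

Lemma D0_exponent c : D0_4 (exponent c).
Proof.
  move=> n X j x Hn HX Hj Hx; apply: (@D0_ext _ (fun e =>
    x e < c /\ (exists N, N < 2 ^ 2 ^ pairM c (X e) /\
      (level_code c (n e) (X e) (x e) N /\ j e < N)) /\
    forall k, k < c -> x e < k -> exists N, N < 2 ^ 2 ^ pairM c (X e) /\
      (level_code c (n e) (X e) k N /\ N <= j e))); first by d0.
  move=> e; split.
  - move=> [H1 [[N [HN H2]] H3]]; split=> //; split.
    + by exists N; split=> //; apply: level_code_bound HN.
    + move=> k kc xk; have [N' [HN' H4]] := H3 k xk kc.
      by exists N'; split=> //; apply: level_code_bound HN'.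
  - move=> [H1 [[N [_ H2]] H3]]; split=> //; split; first by exists N.
    by move=> k xk kc; have [N' [_ H4]] := H3 k kc xk; exists N'.
Qed.

Hint Resolve D0_exponent : d0.

Lemma exponent_bound c n X j x : exponent c n X j x -> j < 2 ^ 2 ^ pairM c X.
Proof. by move=> [_ [[N [/level_code_bound HN jN]] _]]; m_lra. Qed.

Lemma D0_ordinal c : D0_3 (ordinal c).
Proof.
  move=> n X s Hn HX Hs; apply: (@D0_ext _ (fun e =>
    (exists l, l < s e + 1 /\ fin_seqM l (s e)) /\
    (forall j, j < s e + 2 ^ 2 ^ pairM c (X e) -> forall x, x < s e + c ->
       (app (s e) j x <-> exponent c (n e) (X e) j x)))); first by d0.
  move=> e; split=> -[[l Hl] H]; split.
  - exists l; split=> //.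
    have [->|[l' [_ lE]]] := zero_or_succ l; first by have := ge0 (s e); m_lra.
    have := defined_lt (fin_seq_total Hl (ltac:(m_lra) : l' < l)); m_lra.
  - by move=> j _ x _; apply: H.
  - by exists l; case: Hl.
  - move=> j x; split=> Hx; apply/H => //.
    + by have := app_lt Hx; have := ge0 (2 ^ 2 ^ pairM c (X e)); m_lra.
    + by have := app_lt Hx; have := ge0 c; m_lra.
    + by have := exponent_bound Hx; have := ge0 (s e); m_lra.
    + by case: Hx => Hx _; have := ge0 (s e); m_lra.
Qed.

Lemma exponent_exists c n X k N j : k < c -> level_code c n X k N -> j < N ->
  exists x, k <= x /\ exponent c n X j x.
Proof.
  move=> kc HN jN.
  have [|||x [[xc [N' [_ [HN' jN']]]] Hmax]] := @greatest_number _
    (fun x => x < c /\ exists N, N < 2 ^ 2 ^ pairM c X /\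
       (level_code c n X x N /\ j < N)) c; first by d0.
  - exists k; split=> //; exists N; split=> //; exact: level_code_bound HN.
  - by move=> x [].
  - have le_x : forall y N, y < c -> level_code c n X y N -> j < N -> y <= x.
    { move=> y N0 yc HN0 jN0; apply: Hmax; split=> //; exists N0; split=> //.
      exact: level_code_bound HN0. }
    exists x; split; first exact: le_x HN jN.
    split=> //; split; first by exists N'.
    move=> y xy yc; have [N0 HN0] := level_code_exists c n X y.
    exists N0; split=> //; have [//|jN0] := le_or_lt N0 j.
    by have := le_x y N0 yc HN0 jN0; m_lra.
Qed.

Lemma exponent_lt c n X j x k N :
  exponent c n X j x -> x < k -> k < c -> level_code c n X k N -> N <= j.
Proof.
  move=> [_ [_ H]] xk kc HN; have [N' [HN' H']] := H k xk kc.
  by rewrite (level_code_unique HN HN').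
Qed.

Lemma exponent_unique c n X j x y :
  exponent c n X j x -> exponent c n X j y -> x = y.
Proof.
  suff H : forall x y, x < y -> exponent c n X j x -> exponent c n X j y ->
      False.
  { move=> Hx Hy; have [|[//|]] := lt_trichotomy x y.
    - by move=> /H /(_ Hx Hy).
    - by move=> /H /(_ Hy Hx). }
  move=> {}x {}y xy Hx [yc [[N [HN jN]] _]].
  by have := exponent_lt Hx xy yc HN; m_lra.
Qed.

Lemma ordinal_exists c n X : 0 < c -> exists s, ordinal c n X s.
Proof.
  move=> c0; have [N0 HN0] := level_code_exists c n X 0.
  have [|||s [_ [Hs HE]]] := @fin_seq_intro _ (exponent c n X) N0 c;
    first by d0.
  - move=> j jN; have [x [_ Hx]] := exponent_exists c0 HN0 jN.
    by exists x; split=> //; case: Hx.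
  - by move=> j x y _; apply: exponent_unique.
  - exists s; split; first by exists N0.
    move=> j x; rewrite HE; split=> [[]//|Hx]; split=> //.
    have [_ [[N [HN jN]] _]] := Hx.
    by have := level_code_le (ge0 x) HN0 HN; m_lra.
Qed.

Lemma ordinal_below c n X s : ordinal c n X s -> below_omega_powM c s.
Proof.
  move=> [[l Hl] H]; split; last by move=> i x /H[].
  exists l; split=> // i x y /H Hx /H Hy.
  have [//|xy] := le_or_lt y x.
  have [yc [[N [HN iN]] _]] := Hy.
  by have := exponent_lt Hx xy yc HN; m_lra.
Qed.

Lemma ordinal_bound c n X s : ordinal c n X s ->
  s < 2 ^ pairM (2 ^ 2 ^ pairM c X) c.
Proof.
  move=> [[l Hl] H]; apply: bits_bound => z Hz.
  have [k [x [_ zE]]] := proj1 Hl z Hz; subst z.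
  have /H Hx := Hz; apply: pair_lt; first exact: exponent_bound Hx.
  by case: Hx; m_lra.
Qed.

Lemma card_pos c p k d : k < c -> fixes p k -> card c p d -> 0 < d.
Proof.
  move=> kc Hk Hd; have [e [_ He]] := card_exists c (0 : M).
  have no_bit : forall k, ~ fixes (0 : M) k by move=> k' [v /bit0].
  have := card_lt He Hd (fun k _ H => False_ind _ (no_bit k H)) kc Hk (no_bit k).
  by have := ge0 e; m_lra.
Qed.

Lemma card_new c n X p q d e : minimal (hits c n X) q -> subbits p q ->
  p <> q -> card c p d -> card c q e -> d < e.
Proof.
  move=> Hq pq neq Hd He.
  have [z [Hzq Hzp]] : exists z, bit z q /\ ~ bit z p.
  { apply: NNPP => Hn; apply: neq; apply: bits_eq => z; split; first exact: pq.
    by move=> Hz; apply: NNPP => Hz'; apply: Hn; exists z. }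
  have [k [v [kc zE]]] := proj1 (proj1 Hq) z Hzq; subst z.
  apply: (card_lt Hd He _ kc).
  - by move=> k' _ [v' /pq Hv']; exists v'.
  - by exists v.
  - exact: (minimal_fixes Hq pq Hzq Hzp).
Qed.

(** Read as a set of pairs, row [n] hits every earlier row by badness, but cannot hit itself. A
    minimal subset of it hitting the earlier rows is therefore a region that disappears. *)
Lemma row_removes c n X :
  (forall k, k < c -> ex_unique (entry X n k)) ->
  (forall i, i < n -> exists k v w,
     k < c /\ entry X i k v /\ entry X n k w /\ w < v) ->
  exists p, minimal (hits c n X) p /\ ~ hits c (n + 1) X p.
Proof.
  move=> Hrow Hbad.
  have [|y [_ Hy]] := @bounded_comprehension _ (fun z => exists k, k < z + 1 /\
    exists v, v < z + 1 /\ (k < c /\ (z = pairM k v /\ entry X n k v)))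
    (pairM c X); first by d0.
  have HyE : forall z, bit z y -> exists k v, k < c /\ z = pairM k v /\
    entry X n k v.
  { by move=> z /Hy[_ [k [_ [v [_ H]]]]]; exists k, v. }
  have [||p [py Hp]] := @minimal_exists _ (hits c n X) y; first by d0.
  { split; first by move=> z /HyE[k [v [kc [-> _]]]]; exists k, v.
    move=> i Hi; have [k [v [w [kc [Hv [Hw wv]]]]]] := Hbad i Hi.
    exists k, w, v; do !split=> //; apply/Hy; split.
    - by apply: pair_lt => //; have := entry_lt Hw; m_lra.
    - exists k; split; first by have := pair_gel k w; m_lra.
      by exists w; split=> //; have := pair_ger k w; m_lra. }
  exists p; split=> // -[_ Hhit].
  have [|k [v [w [kc [Hv [Hw vw]]]]]] := Hhit n; first by m_lra.
  have [k' [v' [_ [/pair_inj[kE vE] Hv']]]] := HyE _ (py _ Hv); subst k' v'.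
  by have := proj2 (Hrow k kc) v w Hv' Hw; m_lra.
Qed.

(** Let [d] be the least number of fixed coordinates of a removed region and [c = d + k]. A new
    region properly extends a removed one and so fixes more than [d] coordinates. Hence levels above
    [k] are unchanged, while level [k] only loses elements and its code drops from [N] to [N']. The
    normal forms agree below position [N'], where [s] still has an exponent [>= k] and [t] no longer
    does. *)
Theorem ordinal_step c n X s t : 0 < n ->
  (exists p, minimal (hits c n X) p /\ ~ hits c (n + 1) X p) ->
  ordinal c n X s -> ordinal c (n + 1) X t -> cnf_ltM t s.
Proof.
  move=> n0 Hex [[l Hl] Hs] [[l' Hl'] Ht].
  have Hmono : forall p, hits c (n + 1) X p -> hits c n X p.
  { by move=> p; apply: hits_mono. }
  have HT : D0_1 (hits c n X) by d0.
  (* the least number of coordinates fixed by a removed set *)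
  have [||d [[p [Hp [HTp Hd]]] Hmin]] := @least_number _ (fun d => exists p,
    p < 2 ^ pairM c X /\ ((minimalM c n X p /\ ~ hits c (n + 1) X p) /\
      card c p d)); first by d0.
  { move: Hex => [p [Hp HTp]]; have [d [_ Hd]] := card_exists c p.
    by exists d, p; split=> //; apply: minimal_bound Hp. }
  have {}Hmin : forall q e, minimalM c n X q -> ~ hits c (n + 1) X q ->
      card c q e -> d <= e.
  { move=> q e Hq HTq He; have [//|ed] := le_or_lt d e.
    case: (Hmin e ed); exists q; split=> //; exact: minimal_bound Hq. }
  case: HTp => HpT HTp.
  have dc : d <= c.
  { by have [d' [d'c Hd']] := card_exists c p; rewrite (card_unique Hd Hd'). }
  (* With a row to hit, a region is nonempty. This makes [k < c], so that the change happens at a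
     level that the normal form records. *)
  have d0 : 0 < d.
  { have [k [v [_ [kc [Hv _]]]]] := proj2 (proj1 HpT) 0 n0.
    by apply: (card_pos kc _ Hd); exists v. }
  have [k cE] : exists k, c = d + k by apply/le_iff.
  have kc : k < c by m_lra.
  have level_sub : forall m q, k <= m -> level c (n + 1) X m q ->
      level c n X m q.
  { move=> m q km [Hq [e [ec He]]].
    have [Hq'|[r [Hr [HTr [rq neq]]]]] := minimal_new HT Hmono Hq.
    - by split=> //; exists e.
    - have [f [_ Hf]] := card_exists c r.
      have := card_new Hq rq neq Hf He; have := Hmin r f Hr HTr Hf.
      by m_lra. }
  have level_eq : forall m N, k < m -> level_code c n X m N <->
      level_code c (n + 1) X m N.
  { move=> m N km.
    have E : forall q, level c n X m q <-> level c (n + 1) X m q.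
    { move=> q; split; last by apply: level_sub; m_lra.
      move=> [Hq [e [ec He]]]; split; last by exists e.
      apply: (minimal_mono Hmono Hq); apply: NNPP => HTq.
      by have := Hmin q e Hq HTq He; m_lra. }
    by rewrite /level_code; split=> H q; rewrite H E. }
  have [N HN] := level_code_exists c n X k.
  have [N' HN'] := level_code_exists c (n + 1) X k.
  have NN : N' < N.
  { apply: (@bits_lt _ _ _ p).
    - by move=> q /HN' Hq; apply/HN; apply: level_sub Hq; right.
    - by apply/HN; split=> //; exists d; split=> //; m_lra.
    - by move=> /HN'[[HT'p _] _]. }
  exists N'; split.
  - move=> j jN; have [x [kx Hx]] := exponent_exists kc HN (ltac:(m_lra) : j < N).
    exists x; split; last by apply/Hs.
    apply/Ht; have [xc [[Nx [HNx jNx]] Hx3]] := Hx.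
    split=> //; split.
    + case: kx => [kx|kE]; first by exists Nx; split=> //; apply/level_eq.
      by subst x; exists N'.
    + move=> m xm mc; have [Nm [HNm Nmj]] := Hx3 m xm mc.
      by exists Nm; split=> //; apply/level_eq => //; m_lra.
  - have [y [ky Hy]] := exponent_exists kc HN NN.
    exists y; split; first by apply/Hs.
    have [[x Hx]|Hn] := classic (exists x, app t N' x); [right|by left].
    exists x; split=> //; have [yx|//] := le_or_lt y x.
    have /Ht[xc [[Nx [HNx jNx]] _]] := Hx.
    by have := level_code_le (ltac:(m_lra) : k <= x) HN' HNx; m_lra.
Qed.

End Ordinals.
#[export] Hint Resolve D0_level D0_level_code D0_exponent D0_ordinal : d0.

(** * From colourings to bounded bad sequences *)

Section BadMatrices.
Context {A : rca_model}.
Notation M := (num A).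
Implicit Types a b c d i j k l m n p q r s t u v w x y z h g C H R X : M.
Implicit Types F : nset A.
Local Open Scope m_scope.

(** [X] codes a bad sequence of [n] tuples, the [i]th bounded by [f] at [a + i]. This is all that is
    kept of a colouring without large homogeneous sets. *)
Definition admissible c F a n X : Prop :=
  (forall i, i < n -> forall k, k < c -> ex_unique (entry X i k)) /\
  (forall i k v y, i < n -> k < c -> entry X i k v ->
     sMem (pairM (a + i) y) F -> v <= y) /\
  (forall i j, i < j -> j < n -> exists k v w,
     k < c /\ entry X i k v /\ entry X j k w /\ w < v).

Lemma D0_admissible c F a : is_funM F -> D0_2 (admissible c F a).
Proof.
  move=> HF n X Hn HX; apply: (@D0_ext _ (fun e =>
    (forall i, i < n e -> forall k, k < c ->
       (exists v, v < X e /\ entry (X e) i k v) /\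
       forall v, v < X e -> forall w, w < X e ->
         entry (X e) i k v -> entry (X e) i k w -> v = w) /\
    (* The value of [F] has no bound available here, so being at most that value is restated as: no
       [y < v] is the value. *)
    (forall i, i < n e -> forall k, k < c -> forall v, v < X e ->
       entry (X e) i k v -> forall y, y < v -> ~ sMem (pairM (a + i) y) F) /\
    (forall j, j < n e -> forall i, i < j -> exists k, k < c /\
       exists v, v < X e /\ exists w, w < X e /\
         (entry (X e) i k v /\ (entry (X e) j k w /\ w < v)))));
    first by d0.
  move=> e; split=> -[H1 [H2 H3]]; do !split.
  - by have [[v Hv] _] := H1 _ H _ H0; exists v; split=> //; have := entry_lt Hv; m_lra.
  - by have [_ Hu] := H1 _ H _ H0; auto.
  - move=> i Hi k Hk v _ Hv y yv Hy; have := H2 _ _ _ _ Hi Hk Hv Hy; m_lra.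
  - move=> j Hj i Hi; have [k [v [w [kc [Hv [Hw vw]]]]]] := H3 _ _ Hi Hj.
    exists k; split=> //; exists v; split; first by have := entry_lt Hv; m_lra.
    by exists w; split=> //; have := entry_lt Hw; m_lra.
  - by have [[v [_ Hv]] _] := H1 _ H _ H0; exists v.
  - move=> v w Hv Hw; have [_ Hu] := H1 _ H _ H0; apply: Hu => //.
    + by have := entry_lt Hv; m_lra.
    + by have := entry_lt Hw; m_lra.
  - move=> i k v y Hi Hk Hv Hy; have [//|yv] := le_or_lt v y.
    by case: (H2 i Hi k Hk v _ Hv y yv Hy); have := entry_lt Hv; m_lra.
  - move=> i j Hi Hj.
    by have [k [kc [v [_ [w [_ H]]]]]] := H3 j Hj i Hi; exists k, v, w.
Qed.

Lemma admissible_prev c F a n X :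
  admissible c F a (n + 1) X -> admissible c F a n X.
Proof.
  move=> [H1 [H2 H3]]; split; [|split].
  - by move=> i Hi; apply: H1; m_lra.
  - by move=> i k v y Hi; apply: H2; m_lra.
  - by move=> i j Hi Hj; apply: H3 => //; m_lra.
Qed.

(** Discarding the digits that are not entries bounds the code of the matrix without affecting
    [hits], on which alone its ordinal depends. So finitely many matrices account for all ordinals
    of a given length. *)
Lemma admissible_truncate c F a n b X : is_funM F -> admissible c F a n X ->
  (forall i y, i < n -> sMem (pairM (a + i) y) F -> y < b) ->
  exists X', X' < 2 ^ pairM (pairM n c) b /\ admissible c F a n X' /\
    hits c n X' = hits c n X.
Proof.
  move=> HF [H1 [H2 H3]] Hb.
  have [|X' [HX' HE]] := @bounded_comprehension _ (fun z =>
    exists i, i < z + 1 /\ exists k, k < z + 1 /\ exists v, v < z + 1 /\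
      (z = pairM (pairM i k) v /\ (i < n /\ (k < c /\ entry X i k v))))
    (pairM (pairM n c) b); first by d0.
  have E : forall i k v, i < n -> k < c -> entry X' i k v <-> entry X i k v.
  { move=> i k v Hi kc; rewrite [entry X' _ _ _]HE; split.
    - move=> [_ [i' [_ [k' [_ [v' [_ [zE [_ [_ H]]]]]]]]]].
      by have [/pair_inj[-> ->] ->] := pair_inj zE.
    - move=> Hv; have [y Hy] := fun_total (a + i) HF.
      have vy := H2 _ _ _ _ Hi kc Hv Hy; have yb := Hb _ _ Hi Hy.
      split; first by apply: pair_lt; [apply: pair_lt; m_lra|m_lra].
      have := pair_gel (pairM i k) v; have := pair_ger (pairM i k) v.
      have := pair_gel i k; have := pair_ger i k => ? ? ? ?.
      by exists i; split; [m_lra|exists k; split; [m_lra|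
        exists v; split; [m_lra|]]]. }
  exists X'; split=> //; split; last exact: hits_ext.
  split; [|split].
  - move=> i Hi k kc; have [[v Hv] Hu] := H1 i Hi k kc.
    split; first by exists v; apply/E.
    by move=> u w /(E _ _ _ Hi kc) Hu' /(E _ _ _ Hi kc); apply: Hu.
  - by move=> i k v y Hi kc /(E _ _ _ Hi kc); apply: H2.
  - move=> i j Hi Hj; have [k [v [w [kc [Hv [Hw vw]]]]]] := H3 i j Hi Hj.
    by exists k, v, w; do !split=> //; apply/E => //; m_lra.
Qed.

Lemma admissible_removes c F a n X : admissible c F a (n + 1) X ->
  exists p, minimal (hits c n X) p /\ ~ hits c (n + 1) X p.
Proof.
  move=> [H1 [_ H3]]; apply: row_removes; first by apply: H1; m_lra.
  by move=> i Hi; apply: H3 => //; m_lra.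
Qed.

Definition chain C R k x l h : Prop :=
  fin_seqM l h /\ 0 < l /\ app h 0 x /\
  (forall i, i < l -> forall y, y < h -> app h i y -> y <= R) /\
  (forall i, i < l -> forall y, y < h -> forall z, z < h ->
     app h i y -> app h (i + 1) z -> y < z /\ bit (pairM (pairM y z) k) C).

Lemma D0_chain C R : D0_4 (chain C R).
Proof. by rewrite /chain; d0. Qed.

Hint Resolve D0_chain : d0.

Lemma chain_le C R k x l h i y : chain C R k x l h -> app h i y -> y <= R.
Proof.
  move=> [Hh [_ [_ [H _]]]] Hy.
  exact: (H i (fin_seq_dom Hh Hy) y (proj2 (app_lt Hy)) Hy).
Qed.

Lemma chain_step C R k x l h i y z : chain C R k x l h ->
  app h i y -> app h (i + 1) z -> y < z /\ bit (pairM (pairM y z) k) C.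
Proof.
  move=> [Hh [_ [_ [_ H]]]] Hy Hz.
  exact: (H i (fin_seq_dom Hh Hy) y (proj2 (app_lt Hy)) z
    (proj2 (app_lt Hz)) Hy Hz).
Qed.

Lemma chain_increasing C R k x l h i j y z : chain C R k x l h ->
  i < j -> app h i y -> app h j z -> y < z.
Proof.
  move=> Hc /lt_iff[d ->] Hy; have Hh := proj1 Hc.
  suff H : forall d z, z < h -> app h (i + d + 1) z -> y < z.
  { by move=> Hz; apply: (H d) => //; case: (app_lt Hz). }
  apply: induct; first by d0.
  - by move=> {}z _; rewrite add0 => Hz; case: (chain_step Hc Hy Hz).
  - move=> {}d IH {}z _; rewrite addS => Hz.
    have [u Hu] : defined h (i + d + 1).
    { by apply: (defined_le Hh (ex_intro _ z Hz)); m_lra. }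
    have := IH u (proj2 (app_lt Hu)) Hu; have := chain_step Hc Hu Hz; m_lra.
Qed.

Lemma chain_code C R k x l h :
  chain C R k x l h -> h < 2 ^ pairM l (R + 1).
Proof.
  move=> Hc; apply: bits_bound => z Hz.
  have [i [y [il zE]]] := proj1 (proj1 Hc) z Hz; subst z.
  by apply: pair_lt => //; have := chain_le Hc Hz; m_lra.
Qed.

Lemma chain_singleton C R k x : x <= R -> exists h, chain C R k x 1 h.
Proof.
  move=> xR; have [|||h [_ [Hh HE]]] := @fin_seq_intro _ (fun i y => y = x)
    1 (x + 1); first by d0.
  - by move=> i _; exists x; split=> //; m_lra.
  - by move=> i y z _ -> ->.
  - exists h; split=> //; split; first by m_lra.
    split; first by apply/HE; split=> //; m_lra.
    split; first by move=> i _ y _ /HE[_ ->].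
    by move=> i _ y _ z _ _ /HE[il _]; have := ge0 i; m_lra.
Qed.

Lemma chain_cons C R k x y l h : chain C R k y l h -> x < y -> x <= R ->
  bit (pairM (pairM x y) k) C -> exists g, chain C R k x (l + 1) g.
Proof.
  move=> Hc xy xR Hxy; have Hh := proj1 Hc.
  have [|||g [_ [Hg HE]]] := @fin_seq_intro _ (fun j z =>
    (j = 0 /\ z = x) \/ exists i, i < j /\ (j = i + 1 /\ app h i z))
    (l + 1) (R + 1); first by d0.
  - move=> j jl; have [->|[i [ij jE]]] := zero_or_succ j.
    + by exists x; split; [m_lra|left].
    + have [z Hz] := fin_seq_total Hh (ltac:(m_lra) : i < l).
      exists z; split; first by have := chain_le Hc Hz; m_lra.
      by right; exists i.
  - move=> j u v _ [[jE ->]|[i [ij [jE Hu]]]] [[jE' ->]|[i' [ij' [jE' Hv]]]] //.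
    + by move: jE'; rewrite jE => /esym /succ_neq0.
    + by move: jE; rewrite jE' => /esym /succ_neq0.
    + move: jE'; rewrite jE => /succ_inj iE; subst i'.
      exact: (fin_seq_fun Hh Hu Hv).
  - have HS : forall i z, app g (i + 1) z -> app h i z.
    { move=> i z /HE[_ [[/succ_neq0//]|[i' [_ [/succ_inj -> //]]]]]. }
    have H0 : forall z, app g 0 z -> z = x.
    { by move=> z /HE[_ [[_ ->//]|[i' [/lt0]]]]. }
    exists g; split=> //; split; first by have := ge0 l; m_lra.
    split; first by apply/HE; split; [have := ge0 l; m_lra|left].
    split.
    + move=> i _ z _; have [->|[j [_ ->]]] := zero_or_succ i.
      * by move=> /H0 ->.
      * by move=> /HS /(chain_le Hc).
    + move=> i _ u _ v _; have [->|[j [_ ->]]] := zero_or_succ i.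
      * move=> /H0 -> /HS Hv.
        by rewrite (fin_seq_fun Hh Hv (proj1 (proj2 (proj2 Hc)))).
      * by move=> /HS Hu /HS Hv; apply: (chain_step Hc Hu Hv).
Qed.

Definition large_homogeneous C F a R : Prop :=
  exists H l h,
    (forall x, bit x H -> a <= x /\ x <= R) /\
    increasing_enumM H l h /\
    weakly_homogeneousM C l h /\
    0 < l /\
    (exists x y, app h 0 x /\ sMem (pairM x y) F /\ y < l).

(** The elements of a one-coloured chain form a weakly homogeneous set with minimum [x], which would
    be large if [l] exceeded [y]. *)
Lemma chain_length C F a R k x y l h : ~ large_homogeneous C F a R ->
  chain C R k x l h -> a <= x -> sMem (pairM x y) F -> l <= y.
Proof.
  move=> Hn Hc ax Hy; have [//|yl] := le_or_lt l y.
  case: Hn; have Hh := proj1 Hc; have Hx := proj1 (proj2 (proj2 Hc)).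
  have [|H [_ HE]] := @bounded_comprehension _
    (fun z => exists i, i < h /\ app h i z) h; first by d0.
  exists H, l, h; split.
  { move=> z /HE[_ [i [_ Hz]]]; split; last exact: chain_le Hc Hz.
    have [iE|[j [_ jE]]] := zero_or_succ i.
    - by subst i; rewrite (fin_seq_fun Hh Hz Hx).
    - have i0 : 0 < i by have := ge0 j; m_lra.
      by have := chain_increasing Hc i0 Hx Hz; m_lra. }
  split.
  { split=> //; split.
    - by move=> i j u v ij Hu Hv; apply: (chain_increasing Hc ij Hu Hv).
    - move=> z; rewrite HE; split; first by move=> [_ [i [_ Hz]]]; exists i.
      move=> [i Hz]; split; first by case: (app_lt Hz).
      by exists i; split=> //; case: (app_lt Hz). }
  split.
  { move=> i u v w Hu Hv; rewrite addA => Hw; exists k.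
    by split; [case: (chain_step Hc Hu Hv)|case: (chain_step Hc Hv Hw)]. }
  split; first by case: Hc => _ [].
  by exists x, y.
Qed.

(** Entries are the maximal chain lengths. For badness, prefixing [a + i] to a longest chain from
    [a + j] in the colour of this pair gives a longer chain from [a + i]. *)
Lemma coloring_admissible c F a n C : is_funM F ->
  coloringM a (a + n) c C -> ~ large_homogeneous C F a (a + n) ->
  exists X, admissible c F a n X.
Proof.
  move=> HF HC Hn; set R := a + n in HC Hn *.
  have [b Hb] := fun_bound (R + 1) HF.
  pose L k x l := exists h, h < 2 ^ pairM l (R + 1) /\ chain C R k x l h.
  have HL : D0_3 L by rewrite /L; d0.
  (* By [chain_length] all chain lengths stay below [b], so maximality can be expressed with a
     bounded quantifier. *)
  pose Lmax k x l := L k x l /\ forall l', l' < b -> l < l' -> ~ L k x l'.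
  have HLm : D0_3 Lmax by rewrite /Lmax; d0.
  have Llt : forall k x l, a <= x -> x <= R -> L k x l -> l < b.
  { move=> k x l ax xR [h [_ Hh]]; have [y Hy] := fun_total x HF.
    have := chain_length Hn Hh ax Hy.
    have := Hb x y (ltac:(m_lra)) Hy; m_lra. }
  have Lmax_ge : forall k x l l', a <= x -> x <= R -> Lmax k x l ->
      L k x l' -> l' <= l.
  { move=> k x l l' ax xR [_ Hl] Hl'; have [//|ll] := le_or_lt l' l.
    by case: (Hl l' _ ll Hl'); apply: Llt Hl'. }
  have [|X [_ HX]] := @bounded_comprehension _ (fun z =>
    exists i, i < z + 1 /\ exists k, k < z + 1 /\ exists l, l < z + 1 /\
      (z = pairM (pairM i k) l /\ (i < n /\ (k < c /\ Lmax k (a + i) l))))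
    (pairM (pairM n c) b); first by d0.
  have xaR : forall i, i < n -> a <= a + i /\ a + i <= R.
  { by move=> i Hi; rewrite /R; have := ge0 i; m_lra. }
  have HXE : forall i k l, entry X i k l <-> i < n /\ k < c /\ Lmax k (a + i) l.
  { move=> i k l; rewrite [entry _ _ _ _]HX; split.
    - move=> [_ [i' [_ [k' [_ [l' [_ [zE H]]]]]]]].
      by have [/pair_inj[-> ->] ->] := pair_inj zE.
    - move=> [Hi [kc Hl]].
      have lb : l < b by have [? ?] := xaR i Hi; apply: (Llt k (a + i)); case: Hl.
      split; first by apply: pair_lt; [apply: pair_lt; m_lra|m_lra].
      have := pair_gel (pairM i k) l; have := pair_ger (pairM i k) l.
      have := pair_gel i k; have := pair_ger i k => ? ? ? ?.
      by exists i; split; [m_lra|exists k; split; [m_lra|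
        exists l; split; [m_lra|]]]. }
  exists X; split; [|split].
  - move=> i Hi k kc; have [ai iR] := xaR i Hi; split.
    + have [|||l [Hl Hmax]] := @greatest_number _ (L k (a + i)) b; first by d0.
      * have [h Hh] := chain_singleton C k iR; exists 1, h.
        by split=> //; apply: chain_code Hh.
      * by move=> l; apply: Llt.
      * exists l; apply/HXE; split=> //; split=> //; split=> // l' _ ll' /Hmax.
        m_lra.
    + move=> l l' /HXE[_ [_ H1]] /HXE[_ [_ H2]].
      by apply: le_antisym; [apply: (Lmax_ge _ _ _ _ ai iR H2)
        |apply: (Lmax_ge _ _ _ _ ai iR H1)]; [case: H1|case: H2].
  - move=> i k l y Hi kc /HXE[_ [_ [[h [_ Hh]] _]]].
    by have [ai _] := xaR i Hi; apply: (chain_length Hn Hh ai).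
  - move=> i j ij Hj; have [ai iR] := xaR i (ltac:(m_lra)).
    have [aj jR] := xaR j Hj.
    have aij : a + i < a + j by m_lra.
    have [[k Hk] _] := proj2 HC (a + i) (a + j) ai aij jR.
    have kc : k < c.
    { have [n' [m' [k' [_ [_ [_ [kc zE]]]]]]] := proj1 HC _ Hk.
      by have [_ ->] := pair_inj zE. }
    have Lmax_exists : forall i, i < n -> exists l, Lmax k (a + i) l.
    { move=> i' Hi'; have [ai' iR'] := xaR i' Hi'.
      have [|||l [Hl Hmax]] := @greatest_number _ (L k (a + i')) b;
        first by d0.
      - have [h Hh] := chain_singleton C k iR'; exists 1, h.
        by split=> //; apply: chain_code Hh.
      - by move=> l; apply: Llt.
      - by exists l; split=> // l' _ ll' /Hmax; m_lra. }
    have [v Hv] := Lmax_exists i (ltac:(m_lra)).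
    have [w Hw] := Lmax_exists j Hj.
    exists k, v, w; split=> //; split; first by apply/HXE; split=> //; m_lra.
    split; first by apply/HXE.
    have [[h [_ Hh]] _] := Hw; have [g Hg] := chain_cons Hh aij iR Hk.
    suff : w + 1 <= v by m_lra.
    apply: (Lmax_ge _ _ _ _ ai iR Hv); exists g; split=> //.
    exact: chain_code Hg.
Qed.

End BadMatrices.
#[export] Hint Resolve D0_chain : d0.

(** * Maximal ordinals and the descending sequence *)

Section MaximalOrdinals.
Context {A : rca_model}.
Notation M := (num A).
Implicit Types a b c d i j k l m n p q r s t u v w x y z h g C H R X : M.
Implicit Types F : nset A.
Local Open Scope m_scope.

Lemma cnf_lt_irrefl l s : fin_seqM l s -> ~ cnf_ltM s s.
Proof.
  move=> Hs [i [_ [y [Hy [[]|[x [Hx xy]]]]]]]; first by exists y.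
  by have := fin_seq_fun Hs Hx Hy; m_lra.
Qed.

(** The order of codes is not the order of ordinals, so a running maximum over the codes below [m]
    is kept by induction on [m]. *)
Lemma cnf_maximal (P : M -> Prop) b : D0_1 P -> (exists s, P s) ->
  (forall s, P s -> s < b /\ exists l, fin_seqM l s) ->
  exists s, P s /\ forall t, P t -> ~ cnf_ltM s t.
Proof.
  move=> HP [s0 Hs0] Hb.
  suff H : forall m, exists s, s < b /\ (P s /\ forall t, t < m -> P t ->
      ~ cnf_ltM s t).
  { have [s [_ [Hs Hmax]]] := H b.
    by exists s; split=> // t Ht; apply: Hmax => //; case: (Hb t Ht). }
  apply: induct; first by d0.
  - by exists s0; split; [case: (Hb s0 Hs0)|split=> // t /lt0].
  - move=> m [s [sb [Hs Hmax]]].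
    have [[Hm Hlt]|Hn] := classic (P m /\ cnf_ltM s m); last first.
    { exists s; split=> //; split=> // t /ltS[|->]; first exact: Hmax.
      by move=> Hm Hlt; apply: Hn. }
    have [mb [l Hl]] := Hb m Hm.
    exists m; split=> //; split=> // t /ltS[tm|->]; last first.
    { by move=> _; apply: cnf_lt_irrefl Hl. }
    by move=> Ht Hmt; apply: (Hmax t tm Ht); apply: (cnf_lt_trans Hl Hlt Hmt).
Qed.

Theorem WO_RPH c : WO_powM c -> RPHM c.
Proof.
  move=> HWO F HF a.
  have [c0|cpos] := le_or_lt c 0.
  (* For [R = a + 1] there is a pair to colour, hence no colouring without colours. *)
  { exists (a + 1) => C [H1 H2].
    have [|||[k Hk] _] := H2 a (a + 1); try by m_lra.
    have [n [m [k' [_ [_ [_ [kc _]]]]]]] := H1 _ Hk.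
    by have := ge0 k'; m_lra. }
  apply: NNPP => HR.
  have Hadm : forall n, exists X, admissible c F a n X.
  { move=> n; apply: NNPP => Hn; apply: HR; exists (a + n) => C HC.
    apply: NNPP => Hg; apply: Hn; exact: (coloring_admissible HF HC Hg). }
  have HDadm := @D0_admissible _ c _ a HF.
  (* Matrices have [n + 1] rows: the only region of an empty matrix is the whole space, counting for
     omega^c, which has no notation here. The bound on [X] is that of [admissible_truncate]. *)
  pose P n y s := exists X, X < 2 ^ pairM (pairM (n + 1) c) y /\
    (admissible c F a (n + 1) X /\ ordinal c (n + 1) X s).
  have HP : D0_3 P by rewrite /P; d0.
  have P_below : forall n y s, P n y s -> below_omega_powM c s.
  { by move=> n y s [X [_ [_ /ordinal_below]]]. }
  have P_fin : forall n y s, P n y s -> exists l, fin_seqM l s.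
  { by move=> n y s /P_below[/cnf_fin_seq]. }
  have P_lt : forall n y s, P n y s ->
      s < 2 ^ pairM (2 ^ 2 ^ pairM c (2 ^ pairM (pairM (n + 1) c) y)) c.
  { move=> n y s [X [HX [_ /ordinal_bound Hs]]].
    have : 2 ^ pairM (2 ^ 2 ^ pairM c X) c <=
        2 ^ pairM (2 ^ 2 ^ pairM c (2 ^ pairM (pairM (n + 1) c) y)) c.
    { apply: pow2_le; apply: pair_le; last by right.
      by do 2 apply: pow2_le; apply: pair_le; [right|left]. }
    by m_lra. }
  have P_truncate : forall n y X, (forall i v, i < n + 1 ->
      sMem (pairM (a + i) v) F -> v < y) -> admissible c F a (n + 1) X ->
      exists s, P n y s /\ ordinal c (n + 1) X s.
  { move=> n y X Hy HX.
    have [X' [HX' [Hadm' HE]]] := admissible_truncate HF HX Hy.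
    have [s Hs] := ordinal_exists (n + 1) X' cpos.
    exists s; split; first by exists X'.
    by move: Hs; rewrite /ordinal /exponent /level_code /level /minimalM HE. }
  (* A bound [y] on [f] is not given by a term in [n], so it is chosen together with the maximum.
     Any valid [y] will do, as by [P_truncate] it captures the ordinals of all admissible
     matrices. *)
  have [||F' [HF' HFE]] := @function_choice _ (fun n s y =>
    (forall i, i < n + 1 -> exists v, v < y /\ sMem (pairM (a + i) v) F) /\
    (P n y s /\ forall t, t < 2 ^ pairM (2 ^ 2 ^ pairM c
       (2 ^ pairM (pairM (n + 1) c) y)) c -> P n y t -> ~ cnf_ltM s t));
    first by d0.
  { move=> n; have [b Hb] := fun_bound (a + (n + 1)) HF.
    have Hb' : forall i v, i < n + 1 -> sMem (pairM (a + i) v) F -> v < b.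
    { by move=> i v Hi; apply: Hb; m_lra. }
    have [X HX] := Hadm (n + 1).
    have [s0 [Hs0 _]] := P_truncate n b X Hb' HX.
    have [|||s [Hs Hmax]] := @cnf_maximal (P n b)
      (2 ^ pairM (2 ^ 2 ^ pairM c (2 ^ pairM (pairM (n + 1) c) b)) c).
    - by d0.
    - by exists s0.
    - by move=> s Hs; split; [apply: P_lt|apply: P_fin Hs].
    - exists s, b; split; last by split=> // t _; apply: Hmax.
      move=> i Hi; have [v Hv] := fun_total (a + i) HF.
      by exists v; split=> //; apply: Hb' Hv. }
  apply: HWO; exists F'; split=> //; split.
  { by move=> n s /HFE[y [_ [/P_below]]]. }
  move=> n s t /HFE[y [Hy [Hs Hmax]]] /HFE[y' [_ [Ht _]]].
  have Hy' : forall i v, i < n + 1 -> sMem (pairM (a + i) v) F -> v < y.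
  { move=> i v Hi Hv; have [v' [v'y Hv']] := Hy i Hi.
    by rewrite (fun_unique HF Hv Hv'). }
  have [X [_ [HX HtX]]] := Ht.
  (* Here [u] is the ordinal of [X] without its last row. It is larger than [t] by [ordinal_step]
     and at most the maximum [s]. *)
  have [u [Hu HuX]] := P_truncate n y X Hy' (admissible_prev HX).
  have n0 : 0 < n + 1 by have := ge0 n; m_lra.
  have tu := ordinal_step n0 (admissible_removes HX) HuX HtX.
  have Hsu := Hmax u (P_lt _ _ _ Hu) Hu.
  have [l Hl] := P_fin _ _ _ Hs; have [m Hm] := P_fin _ _ _ Hu.
  have [//|[->//|us]] := cnf_lt_total Hl Hm.
  exact: (cnf_lt_trans Hm tu us).
Qed.

End MaximalOrdinals.

Theorem corollary23 :
  proves RCA0star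
    ((alln c, DL_ c <-> RPH_ c) /\
     (alln c, WO_omega_pow c <-> RPH_ c) /\
     (DL <-> WO_omega_omega) /\
     (WO_omega_omega <-> alln c, RPH_ c) /\
     (DL <-> alln c, RPH_ c))%SO.
Proof.
  apply: completeness => A0 HA e r.
  pose A := RcaModel HA (r O).
  (* Satisfaction of the closed formula computes to the conjunction of the semantic principles. *)
  change ((forall c : num A, DLM c <-> RPHM c) /\
     (forall c : num A, WO_powM c <-> RPHM c) /\
     ((forall c : num A, DLM c) <-> @WO_omegaM A) /\
     (@WO_omegaM A <-> forall c : num A, RPHM c) /\
     ((forall c : num A, DLM c) <-> forall c : num A, RPHM c)).
  have H1 : forall c : num A, DLM c <-> RPHM c.
  { by move=> c; split=> [/DL_WO/WO_RPH|/RPH_DL]. }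
  have H2 : forall c : num A, WO_powM c <-> RPHM c.
  { by move=> c; split=> [/WO_RPH|/RPH_DL/DL_WO]. }
  have H3 : (forall c : num A, DLM c) <-> @WO_omegaM A.
  { split=> [H|H c]; first by apply: WO_pow_omega => c; apply: DL_WO.
    by apply/H1/H2; apply: WO_omega_WO_pow. }
  have H4 : (forall c : num A, DLM c) <-> forall c : num A, RPHM c.
  { by split=> H c; apply/H1. }
  by split=> //; split=> //; split=> //; split=> //; rewrite -H3.
Qed.
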